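(* Let $H$ be a separable complex Hilbert space, $J$ a conjugation in $H$, and let $A$ be a bounded linear operator in $H$ (defined on all of $H$) with $0\notin\sigma(A)$. Put $A^T:=JA^*J$. Suppose that for some $\varphi\in[0,2\pi)$ the spectrum of $AA^T$ has empty intersection with the ray $L_\varphi=\{z\in\mathbb{C}: z=xe^{i\varphi},\ x\ge 0\}$. Then: (1) $A$ admits a representation $A=SU$, where $S=\sqrt{AA^T}$ is a bounded J-self-adjoint operator in $H$ and $U$ is a bounded J-unitary operator in $H$. The operators $U$ and $S$ commute if and only if $A$ is J-normal. (2) $A$ admits a representation $A=U_1S_1$, where $U_1$ is a bounded J-unitary operator in $H$ and $S_1=\sqrt{A^TA}$ is a bounded J-self-adjoint operator in $H$. The operators $U_1$ and $S_1$ commute if and only if $A$ is J-normal. In particular, the representations $A=SU$ and $A=U_1S_1$ of (1) and (2) hold (for a suitable ray $L_\varphi$) for every operator of the form $A=E+K$, where $E$ is the identity operator and $K$ is a compact operator in $H$ with $\|K\|<1$.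
   Context: A conjugation in a Hilbert space $H$ is a map $J:H\to H$ with $J^2=E$ (the identity) and $(Jx,Jy)=\overline{(x,y)}$ for all $x,y\in H$ (hence $J$ is antilinear). For a bounded operator $B$ on $H$: $B$ is J-self-adjoint if $B=JB^*J$; $B$ is J-unitary if $B$ is invertible and $B^{-1}=JB^*J$; $B$ is J-normal if $B^TB=BB^T$, where $B^T:=JB^*J$. Square roots are understood via the Riesz (holomorphic) functional calculus: fix an analytic branch of $\lambda\mapsto\sqrt{\lambda}$ on $\mathbb{C}\setminus L_\varphi$ (any branch); for a bounded operator $B$ with $\sigma(B)\cap L_\varphi=\emptyset$, $\sqrt{B}$ is the function of $B$ given by the contour integral of $\sqrt{\lambda}$ against the resolvent of $B$ along a contour in $\mathbb{C}\setminus L_\varphi$ surrounding $\sigma(B)$. (Under the hypotheses $\sigma(A^TA)\cap L_\varphi=\emptyset$ as well, so $\sqrt{A^TA}$ makes sense.) *)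

(* Defs.v *)
From Stdlib Require Import Reals Lra List.
From Stdlib Require Import ClassicalEpsilon FunctionalExtensionality ProofIrrelevance.
From Coquelicot Require Export Coquelicot.
Export ListNotations.

Set Implicit Arguments.
Unset Strict Implicit.
Unset Printing Implicit Defensive.

Open Scope R_scope.

(** * A complex normed module seen as a real one

    Coquelicot's [is_RInt] integrates functions with values in a
    [NormedModule R_AbsRing]. *)

Section RestrictScalars.

Variable V : NormedModule C_AbsRing.

Definition rscal (r : R) (v : V) : V := scal (RtoC r : C_AbsRing) v.

Lemma rscal_assoc (x y : R) (u : V) : rscal x (rscal y u) = rscal (mult x y) u.
Proof.
unfold rscal; rewrite scal_assoc; f_equal.
change (RtoC x * RtoC y = RtoC (x * y))%C; now rewrite RtoC_mult.
Qed.

Lemma rscal_one (u : V) : rscal one u = u.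
Proof. exact (scal_one u). Qed.

Lemma rscal_distr_l (x : R) (u v : V) :
  rscal x (plus u v) = plus (rscal x u) (rscal x v).
Proof. exact (scal_distr_l _ u v). Qed.

Lemma rscal_distr_r (x y : R) (u : V) :
  rscal (plus x y) u = plus (rscal x u) (rscal y u).
Proof.
unfold rscal; change (plus x y) with (x + y); rewrite RtoC_plus.
exact (scal_distr_r (RtoC x : C_AbsRing) (RtoC y) u).
Qed.

Definition restr_ModuleSpace_mixin : ModuleSpace.mixin_of R_Ring V :=
  ModuleSpace.Mixin R_Ring V rscal
    rscal_assoc rscal_one rscal_distr_l rscal_distr_r.

Definition restr_ModuleSpace : ModuleSpace R_Ring :=
  ModuleSpace.Pack R_Ring V
    (ModuleSpace.Class R_Ring V (AbelianGroup.class V) restr_ModuleSpace_mixin) V.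

Definition restr_NormedModuleAux : NormedModuleAux R_AbsRing :=
  NormedModuleAux.Pack R_AbsRing V
    (NormedModuleAux.Class R_AbsRing V
       (ModuleSpace.class R_Ring restr_ModuleSpace) (UniformSpace.class V)) V.

Lemma norm_rscal (l : R) (x : V) : norm (rscal l x) <= abs l * norm x.
Proof.
apply (Rle_trans _ _ _ (norm_scal (RtoC l : C_AbsRing) x)).
apply Req_le; f_equal; exact (Cmod_R l).
Qed.

Definition restr_NormedModule_mixin :
  NormedModule.mixin_of R_AbsRing restr_NormedModuleAux :=
  NormedModule.Mixin R_AbsRing restr_NormedModuleAux
    (@norm C_AbsRing V) (@norm_factor C_AbsRing V)
    norm_triangle norm_rscal norm_compat1 norm_compat2 norm_eq_zero.

Definition restr_NormedModule : NormedModule R_AbsRing :=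
  NormedModule.Pack R_AbsRing V
    (NormedModule.Class R_AbsRing V
       (NormedModuleAux.class R_AbsRing restr_NormedModuleAux)
       restr_NormedModule_mixin) V.

End RestrictScalars.

(** * Hilbert spaces *)

(** [norm] is the norm of the underlying Banach space; [ip_norm] says that it is
    the one induced by the inner product.  Definiteness comes from [norm]. *)
Record HilbertSpace := {
  hs_space :> CompleteNormedModule C_AbsRing;
  ip : hs_space -> hs_space -> C;
  ip_plus_l : forall x y z, ip (plus x y) z = (ip x z + ip y z)%C;
  ip_scal_l : forall (a : C) x y, ip (scal a x) y = (a * ip x y)%C;
  ip_conj : forall x y, ip y x = Cconj (ip x y);
  ip_norm : forall x, ip x x = RtoC (norm x ^ 2)
}.

Definition separable (H : HilbertSpace) : Prop :=
  exists u : nat -> H,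
    forall (x : H) (eps : R), 0 < eps -> exists n, norm (minus x (u n)) < eps.

(** * Bounded operators *)

(** Coquelicot's [is_linear] includes boundedness. *)
Record bounded_op (H : HilbertSpace) := BoundedOp {
  op_fun :> H -> H;
  op_linear : is_linear op_fun
}.

Section BoundedOperators.

Variable H : HilbertSpace.

Lemma bounded_op_ext (A B : bounded_op H) : (forall x, A x = B x) -> A = B.
Proof.
destruct A as [a la], B as [b lb]; simpl; intros E.
assert (a = b) by (now apply functional_extensionality); subst b.
f_equal; apply proof_irrelevance.
Qed.

Lemma op_plus_linear (A B : bounded_op H) : is_linear (fun x => plus (A x) (B x)).
Proof.
apply (is_linear_comp (fun x => (A x, B x)) (fun p => plus (fst p) (snd p))).
- apply is_linear_prod; apply op_linear.
- apply is_linear_plus.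
Qed.

Lemma op_scal_linear (a : C) (A : bounded_op H) :
  is_linear (fun x => scal (a : C_AbsRing) (A x)).
Proof.
apply (is_linear_comp A (fun x => scal (a : C_AbsRing) x)).
- apply op_linear.
- apply is_linear_scal_r; exact Cmult_comm.
Qed.

Definition op_zero : bounded_op H := BoundedOp is_linear_zero.
Definition op_id : bounded_op H := BoundedOp is_linear_id.
Definition op_plus (A B : bounded_op H) : bounded_op H := BoundedOp (op_plus_linear A B).
Definition op_opp (A : bounded_op H) : bounded_op H :=
  BoundedOp (is_linear_comp _ _ (op_linear A) is_linear_opp).
Definition op_scal (a : C) (A : bounded_op H) : bounded_op H := BoundedOp (op_scal_linear a A).
Definition op_mult (A B : bounded_op H) : bounded_op H :=
  BoundedOp (is_linear_comp _ _ (op_linear B) (op_linear A)).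

Lemma hs_norm_zero : norm (zero : H) = 0.
Proof. exact norm_zero. Qed.

Lemma hs_norm_scal (a : C) (x : H) :
  norm (scal (a : C_AbsRing) x) <= Cmod a * norm x.
Proof. exact (norm_scal (a : C_AbsRing) x). Qed.

Lemma hs_norm_triangle (x y : H) : norm (plus x y) <= norm x + norm y.
Proof. exact (norm_triangle x y). Qed.

Lemma op_fun_zero (A : bounded_op H) : A zero = zero.
Proof.
rewrite <- (scal_zero_l (zero : H)) at 1.
rewrite (linear_scal _ (op_linear A)); exact (scal_zero_l (A zero : H)).
Qed.

Definition op_norm (A : bounded_op H) : R :=
  real (Lub_Rbar (fun r => exists x : H, norm x <= 1 /\ r = norm (A x))).

Lemma op_norm_lub (A : bounded_op H) :
  is_lub_Rbar (fun r => exists x : H, norm x <= 1 /\ r = norm (A x))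
    (Finite (op_norm A)).
Proof.
unfold op_norm.
destruct (Lub_Rbar_correct
  (fun r => exists x : H, norm x <= 1 /\ r = norm (A x))) as [Hub Hle].
destruct (linear_norm _ (op_linear A)) as [M [HM HA]].
set (l := Lub_Rbar _) in *.
assert (H1 : Rbar_le l (Finite M)).
{ apply Hle; intros r [x [Hx ->]]; simpl.
  apply (Rle_trans _ _ _ (HA x)); rewrite <- (Rmult_1_r M) at 2.
  apply Rmult_le_compat_l; lra. }
assert (H0 : Rbar_le (Finite 0) l).
{ apply Hub; exists zero; rewrite op_fun_zero, hs_norm_zero; lra. }
split; destruct l; simpl in *; try contradiction; assumption.
Qed.

Lemma op_norm_ge (A : bounded_op H) (x : H) : norm x <= 1 -> norm (A x) <= op_norm A.
Proof.
intros Hx; destruct (op_norm_lub A) as [Hub _].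
exact (Hub (norm (A x)) (ex_intro _ x (conj Hx eq_refl))).
Qed.

Lemma op_norm_le (A : bounded_op H) (M : R) :
  (forall x : H, norm x <= 1 -> norm (A x) <= M) -> op_norm A <= M.
Proof.
intros HM; destruct (op_norm_lub A) as [_ Hle].
apply (Hle (Finite M)); intros r [x [Hx ->]]; now apply HM.
Qed.

Lemma op_norm_bound (A : bounded_op H) (x : H) : norm (A x) <= op_norm A * norm x.
Proof.
destruct (Req_dec (norm x) 0) as [E|E].
- rewrite E, Rmult_0_r.
  destruct (linear_norm _ (op_linear A)) as [M [_ HA]].
  rewrite <- (Rmult_0_r M), <- E; apply HA.
- assert (Hx : 0 < norm x) by (pose proof (norm_ge_0 x); lra).
  set (y := scal (RtoC (/ norm x) : C_AbsRing) x).
  assert (Hy : norm y <= 1).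
  { apply (Rle_trans _ _ _ (hs_norm_scal _ _)).
      rewrite Cmod_R, Rabs_pos_eq by (now apply Rlt_le, Rinv_0_lt_compat).
    apply Req_le; now field. }
  assert (Exy : A x = scal (RtoC (norm x) : C_AbsRing) (A y)).
  { unfold y; rewrite <- (linear_scal _ (op_linear A)), scal_assoc.
    f_equal; rewrite <- (scal_one x) at 1; f_equal.
    change (RtoC 1 = RtoC (norm x) * RtoC (/ norm x))%C.
    rewrite <- RtoC_mult; f_equal; now field. }
  rewrite Exy.
  apply (Rle_trans _ _ _ (hs_norm_scal _ _)).
  rewrite Cmod_R, Rabs_pos_eq by lra; rewrite Rmult_comm.
  apply Rmult_le_compat_r; [lra|]; now apply op_norm_ge.
Qed.

Lemma op_norm_plus (A B : bounded_op H) : op_norm (op_plus A B) <= op_norm A + op_norm B.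
Proof.
apply op_norm_le; intros x Hx; apply (Rle_trans _ _ _ (hs_norm_triangle _ _)).
apply Rplus_le_compat; now apply op_norm_ge.
Qed.

Lemma op_norm_scal (a : C) (A : bounded_op H) : op_norm (op_scal a A) <= Cmod a * op_norm A.
Proof.
apply op_norm_le; intros x Hx; apply (Rle_trans _ _ _ (hs_norm_scal _ _)).
apply Rmult_le_compat_l; [apply Cmod_ge_0 | now apply op_norm_ge].
Qed.

Lemma op_norm_zero : op_norm op_zero = 0.
Proof.
apply Rle_antisym.
- apply op_norm_le; intros x _; apply Req_le; exact hs_norm_zero.
- assert (E : norm (zero : H) <= 1) by (rewrite hs_norm_zero; lra).
  pose proof (op_norm_ge op_zero E) as Hz.
  change (norm (zero : H) <= op_norm op_zero) in Hz; now rewrite hs_norm_zero in Hz.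
Qed.

Lemma op_norm_eq_0 (A : bounded_op H) : op_norm A = 0 -> A = op_zero.
Proof.
intros E; apply bounded_op_ext; intros x; apply norm_eq_zero.
pose proof (op_norm_bound A x); pose proof (norm_ge_0 (A x)).
rewrite E in *; lra.
Qed.

Lemma op_plus_comm (A B : bounded_op H) : op_plus A B = op_plus B A.
Proof. apply bounded_op_ext; intros x; exact (plus_comm (A x) (B x)). Qed.

Lemma op_plus_assoc (A B D : bounded_op H) :
  op_plus A (op_plus B D) = op_plus (op_plus A B) D.
Proof. apply bounded_op_ext; intros x; exact (plus_assoc (A x) (B x) (D x)). Qed.

Lemma op_plus_zero_r (A : bounded_op H) : op_plus A op_zero = A.
Proof. apply bounded_op_ext; intros x; exact (plus_zero_r (A x)). Qed.

Lemma op_plus_opp_r (A : bounded_op H) : op_plus A (op_opp A) = op_zero.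
Proof. apply bounded_op_ext; intros x; exact (plus_opp_r (A x)). Qed.

Lemma op_scal_assoc (a b : C) (A : bounded_op H) :
  op_scal a (op_scal b A) = op_scal (a * b)%C A.
Proof. apply bounded_op_ext; intros x; exact (scal_assoc (a : C_AbsRing) b (A x)). Qed.

Lemma op_scal_one (A : bounded_op H) : op_scal (RtoC 1) A = A.
Proof. apply bounded_op_ext; intros x; exact (scal_one (A x)). Qed.

Lemma op_scal_distr_l (a : C) (A B : bounded_op H) :
  op_scal a (op_plus A B) = op_plus (op_scal a A) (op_scal a B).
Proof. apply bounded_op_ext; intros x; exact (scal_distr_l (a : C_AbsRing) (A x) (B x)). Qed.

Lemma op_scal_distr_r (a b : C) (A : bounded_op H) :
  op_scal (a + b)%C A = op_plus (op_scal a A) (op_scal b A).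
Proof. apply bounded_op_ext; intros x; exact (scal_distr_r (a : C_AbsRing) b (A x)). Qed.

Definition bounded_op_AbelianMonoid_mixin : AbelianMonoid.mixin_of (bounded_op H) :=
  AbelianMonoid.Mixin (bounded_op H) op_plus op_zero
    op_plus_comm op_plus_assoc op_plus_zero_r.

Canonical bounded_op_AbelianMonoid : AbelianMonoid :=
  AbelianMonoid.Pack (bounded_op H) bounded_op_AbelianMonoid_mixin (bounded_op H).

Definition bounded_op_AbelianGroup_mixin : AbelianGroup.mixin_of bounded_op_AbelianMonoid :=
  AbelianGroup.Mixin bounded_op_AbelianMonoid op_opp op_plus_opp_r.

Canonical bounded_op_AbelianGroup : AbelianGroup :=
  AbelianGroup.Pack (bounded_op H)
    (AbelianGroup.Class (bounded_op H) bounded_op_AbelianMonoid_mixin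
       bounded_op_AbelianGroup_mixin)
    (bounded_op H).

Definition bounded_op_ModuleSpace_mixin :
  ModuleSpace.mixin_of C_Ring bounded_op_AbelianGroup :=
  ModuleSpace.Mixin C_Ring bounded_op_AbelianGroup op_scal
    op_scal_assoc op_scal_one op_scal_distr_l op_scal_distr_r.

Canonical bounded_op_ModuleSpace : ModuleSpace C_Ring :=
  ModuleSpace.Pack C_Ring (bounded_op H)
    (ModuleSpace.Class C_Ring (bounded_op H)
       (AbelianGroup.class bounded_op_AbelianGroup) bounded_op_ModuleSpace_mixin) (bounded_op H).

Definition op_ball (A : bounded_op H) (eps : R) (B : bounded_op H) : Prop :=
  op_norm (minus B A) < eps.

Lemma op_ball_center (A : bounded_op H) (eps : posreal) : op_ball A eps A.
Proof.
unfold op_ball; rewrite minus_eq_zero.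
change (op_norm op_zero < eps); rewrite op_norm_zero; apply cond_pos.
Qed.

Lemma op_ball_sym (A B : bounded_op H) (eps : R) : op_ball A eps B -> op_ball B eps A.
Proof.
unfold op_ball; intros E.
replace (minus A B) with (op_scal (RtoC (-1)) (minus B A)).
- apply (Rle_lt_trans _ _ _ (op_norm_scal _ _)).
  rewrite Cmod_R, Rabs_left by lra; lra.
- change (RtoC (-1)) with (RtoC (- (1))); rewrite RtoC_opp.
  exact (eq_trans (scal_opp_one (minus B A : bounded_op_ModuleSpace)) (opp_minus B A)).
Qed.

Lemma op_ball_triangle (A B D : bounded_op H) (e1 e2 : R) :
  op_ball A e1 B -> op_ball B e2 D -> op_ball A (e1 + e2) D.
Proof.
unfold op_ball; intros E1 E2.
rewrite (minus_trans B D A).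
apply (Rle_lt_trans _ _ _ (op_norm_plus _ _)); lra.
Qed.

Definition bounded_op_UniformSpace_mixin : UniformSpace.mixin_of (bounded_op H) :=
  UniformSpace.Mixin (bounded_op H) op_zero op_ball
    op_ball_center op_ball_sym op_ball_triangle.

Canonical bounded_op_UniformSpace : UniformSpace :=
  UniformSpace.Pack (bounded_op H) bounded_op_UniformSpace_mixin (bounded_op H).

Canonical bounded_op_NormedModuleAux : NormedModuleAux C_AbsRing :=
  NormedModuleAux.Pack C_AbsRing (bounded_op H)
    (NormedModuleAux.Class C_AbsRing (bounded_op H)
       (ModuleSpace.class C_Ring bounded_op_ModuleSpace)
       (UniformSpace.class bounded_op_UniformSpace)) (bounded_op H).

Lemma bounded_op_norm_compat1 (A B : bounded_op H) (eps : R) :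
  op_norm (minus B A) < eps -> ball A eps B.
Proof. exact (fun h => h). Qed.

Lemma bounded_op_norm_compat2 (A B : bounded_op H) (eps : posreal) :
  ball A eps B -> op_norm (minus B A) < 1 * eps.
Proof. rewrite Rmult_1_l; exact (fun h => h). Qed.

Definition bounded_op_NormedModule_mixin :
  NormedModule.mixin_of C_AbsRing bounded_op_NormedModuleAux :=
  NormedModule.Mixin C_AbsRing bounded_op_NormedModuleAux op_norm 1
    op_norm_plus op_norm_scal bounded_op_norm_compat1 bounded_op_norm_compat2 op_norm_eq_0.

Canonical bounded_op_NormedModule : NormedModule C_AbsRing :=
  NormedModule.Pack C_AbsRing (bounded_op H)
    (NormedModule.Class C_AbsRing (bounded_op H)
       (NormedModuleAux.class C_AbsRing bounded_op_NormedModuleAux)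
       bounded_op_NormedModule_mixin) (bounded_op H).

(** Total by Hilbert's epsilon; the Riesz representation theorem provides the
    (unique) operator selected here. *)
Definition adj (A : bounded_op H) : bounded_op H :=
  epsilon (inhabits op_zero)
    (fun B : bounded_op H => forall x y : H, ip (A x) y = ip x (B y)).

Definition is_inverse (A B : bounded_op H) : Prop :=
  op_mult A B = op_id /\ op_mult B A = op_id.

Definition invertible (A : bounded_op H) : Prop := exists B, is_inverse A B.

(** The bounded inverse when it exists, unspecified otherwise. *)
Definition op_inv (A : bounded_op H) : bounded_op H :=
  epsilon (inhabits op_zero) (is_inverse A).

Definition spectrum (A : bounded_op H) (z : C) : Prop :=
  ~ invertible (minus (op_scal z op_id) A).

Definition resolvent (A : bounded_op H) (z : C) : bounded_op H :=
  op_inv (minus (op_scal z op_id) A).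

Definition compact_op (K : bounded_op H) : Prop :=
  forall u : nat -> H,
    (exists M : R, forall n, norm (u n) <= M) ->
    exists (s : nat -> nat) (y : H),
      (forall n, (s n < s (S n))%nat) /\
      filterlim (fun n => K (u (s n))) eventually (locally y).

End BoundedOperators.

(** * Conjugations *)

Record conjugation (H : HilbertSpace) := {
  conj_fun :> H -> H;
  conj_invol : forall x, conj_fun (conj_fun x) = x;
  conj_ip : forall x y, ip (conj_fun x) (conj_fun y) = Cconj (ip x y)
}.

Section Conjugation.

Variables (H : HilbertSpace) (J : conjugation H).

Lemma ip_minus_l (x y z : H) : ip (minus x y) z = (ip x z - ip y z)%C.
Proof.
assert (E : opp y = scal (- RtoC 1 : C_AbsRing)%C y)
  by (symmetry; exact (scal_opp_one (y : H))).
unfold minus; rewrite ip_plus_l, E, ip_scal_l; ring.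
Qed.

Lemma ip_separates (x y : H) : (forall z, ip x z = ip y z) -> x = y.
Proof.
intros E.
assert (N : norm (minus x y) = 0).
{ pose proof (ip_norm (minus x y)) as P; rewrite ip_minus_l, E in P.
  unfold Cminus in P; rewrite Cplus_opp_r in P.
  apply RtoC_inj in P; symmetry in P.
  destruct (Req_dec (norm (minus x y)) 0) as [|Nz]; [assumption|].
  now apply (pow_nonzero _ 2) in Nz. }
apply norm_eq_zero in N.
transitivity (plus (minus x y) y).
- symmetry.
  exact (eq_trans (eq_sym (plus_assoc x (opp y) y))
    (eq_trans (f_equal (plus x) (plus_opp_l y)) (plus_zero_r x))).
- rewrite N; exact (plus_zero_l y).
Qed.

Lemma conj_ip_l (x z : H) : ip (J x) z = Cconj (ip x (J z)).
Proof. now rewrite <- (conj_ip J), conj_invol. Qed.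

Lemma conj_plus (x y : H) : J (plus x y) = plus (J x) (J y).
Proof.
apply ip_separates; intros z.
now rewrite ip_plus_l, !conj_ip_l, ip_plus_l, Cplus_conj.
Qed.

Lemma conj_scal (a : C) (x : H) :
  J (scal (a : C_AbsRing) x) = scal (Cconj a : C_AbsRing) (J x).
Proof.
apply ip_separates; intros z.
now rewrite ip_scal_l, !conj_ip_l, ip_scal_l, Cmult_conj.
Qed.

Lemma conj_norm (x : H) : norm (J x) = norm x.
Proof.
pose proof (conj_ip J x x) as E; rewrite !ip_norm in E.
unfold Cconj, RtoC in E; simpl in E; injection E as E _.
apply Rsqr_inj; try apply norm_ge_0; unfold Rsqr; lra.
Qed.

Lemma conj_sandwich_linear (A : bounded_op H) : is_linear (fun x => J (A (J x))).
Proof.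
split.
- intros x y; now rewrite conj_plus, (linear_plus _ (op_linear A)), conj_plus.
- intros a x; rewrite conj_scal, (linear_scal _ (op_linear A)), conj_scal.
  f_equal; apply Cconj_conj.
- destruct (linear_norm _ (op_linear A)) as [M [HM HA]]; exists M; split; [easy|].
  intros x; rewrite conj_norm, <- (conj_norm x); apply HA.
Qed.

Definition conj_sandwich (A : bounded_op H) : bounded_op H :=
  BoundedOp (conj_sandwich_linear A).

Definition J_transp (A : bounded_op H) : bounded_op H := conj_sandwich (adj A).

Definition J_self_adjoint (A : bounded_op H) : Prop := A = J_transp A.

Definition J_unitary (A : bounded_op H) : Prop := invertible A /\ op_inv A = J_transp A.

Definition J_normal (A : bounded_op H) : Prop :=
  op_mult (J_transp A) A = op_mult A (J_transp A).

End Conjugation.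

(** * Contour integrals *)

(** Both conditions are two-sided at 0 and 1; a C^1 arc on [0,1] extends to the
    line, so this is no restriction. *)
Record C1_arc := {
  arc_fun :> R -> C;
  arc_der : R -> C;
  arc_derive : forall t, 0 <= t <= 1 ->
    is_derive (K := R_AbsRing) (V := C_R_NormedModule) arc_fun t (arc_der t);
  arc_der_cont : forall t, 0 <= t <= 1 ->
    continuous (U := C_UniformSpace) arc_der t
}.

(** A contour is a list of arcs traversed one after the other. *)
Fixpoint arc_chain (z : C) (G : list C1_arc) (w : C) : Prop :=
  match G with
  | [] => z = w
  | a :: G' => a 0 = z /\ arc_chain (a 1) G' w
  end.

Definition closed_contour (G : list C1_arc) : Prop :=
  exists z, arc_chain z G z.

Definition on_contour (G : list C1_arc) (z : C) : Prop :=
  exists a t, In a G /\ 0 <= t <= 1 /\ a t = z.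

Fixpoint is_contour_int (V : NormedModule C_AbsRing) (F : C -> V)
    (G : list C1_arc) (v : V) : Prop :=
  match G with
  | [] => v = zero
  | a :: G' => exists v1 v2 : V,
      is_RInt (V := restr_NormedModule V)
        (fun t => scal (arc_der a t : C_AbsRing) (F (a t))) 0 1 v1 /\
      is_contour_int F G' v2 /\
      v = plus v1 v2
  end.

Definition two_pi_i : C := (RtoC (2 * PI) * Ci)%C.

(** The closed contour [G] avoids [D] and has winding number 1 about each of its
    points. *)
Definition surrounds (G : list C1_arc) (D : C -> Prop) : Prop :=
  closed_contour G /\
  forall z, D z ->
    ~ on_contour G z /\
    is_contour_int (V := C_NormedModule) (fun w => / (w - z))%C G two_pi_i.

(** * The square root *)

Definition ray (phi : R) (z : C) : Prop :=
  exists x : R, 0 <= x /\ z = (RtoC x * (cos phi, sin phi))%C.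

Definition avoids_ray (phi : R) (D : C -> Prop) : Prop :=
  forall z, D z -> ~ ray phi z.

Definition sqrt_branch (phi : R) (g : C -> C) : Prop :=
  forall z : C, ~ ray phi z ->
    (g z * g z)%C = z /\ ex_derive (K := C_AbsRing) (V := C_NormedModule) g z.

(** [S] is the Riesz function [g(B) = 1/(2 pi i) \oint g(z) (zE - B)^{-1} dz].
    The slit plane is simply connected, so a contour in it has winding number 0
    about every point of the ray, and [S] does not depend on the contour. *)
Definition riesz_sqrt (H : HilbertSpace) (phi : R) (g : C -> C) (B S : bounded_op H) : Prop :=
  avoids_ray phi (spectrum B) /\
  exists G : list C1_arc,
    (forall z, on_contour G z -> ~ ray phi z) /\
    surrounds G (spectrum B) /\
    is_contour_int (fun z => op_scal (g z) (resolvent B z)) G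
      (op_scal two_pi_i S).

(** * The two polar representations *)

Definition left_polar (H : HilbertSpace) (J : conjugation H) (phi : R) (g : C -> C)
    (A : bounded_op H) : Prop :=
  exists S U : bounded_op H,
    riesz_sqrt phi g (op_mult A (J_transp J A)) S /\
    J_self_adjoint J S /\
    J_unitary J U /\
    A = op_mult S U /\
    (op_mult U S = op_mult S U <-> J_normal J A).

Definition right_polar (H : HilbertSpace) (J : conjugation H) (phi : R) (g : C -> C)
    (A : bounded_op H) : Prop :=
  exists U1 S1 : bounded_op H,
    riesz_sqrt phi g (op_mult (J_transp J A) A) S1 /\
    J_self_adjoint J S1 /\
    J_unitary J U1 /\
    A = op_mult U1 S1 /\
    (op_mult U1 S1 = op_mult S1 U1 <-> J_normal J A).

(* Main.v *)
From Stdlib Require Import Ncring Ncring_tac.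
Require Import Defs.
From Stdlib Require Import Reals Lra Psatz Lia Classical ClassicalEpsilon ProofIrrelevance.
From Stdlib Require Import FunctionalExtensionality PropExtensionality.
From Coquelicot Require Import Coquelicot.

Open Scope R_scope.

(** The heart of the matter is the square root: if the spectrum of [B] avoids the ray,
    the Riesz integral of the branch defines an operator [S] with [S^2 = B], which commutes
    with everything that commutes with [B] and is J-self-adjoint when [B] is
    ([riesz_sqrt_exists]). Given this for [B = A A^T], the representation [A = S U] is
    algebra: [U = S^{-1} A] satisfies [U U^T = S^{-1} A A^T S^{-1} = 1], and the statement on
    commutation follows from the position of [S] in the bicommutant
    ([left_polar_exists]). The right representation is the transpose of the left
    representation of [A^T].

    The contour and the identity [S^2 = B] come from the substitution [z = c v^2] with
    [c = - exp(i phi)], which maps the right half-plane bijectively onto the slit plane.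
    After rotating, the slit is the negative axis and the branch is [v] up to a constant
    factor. As contour for [v] a circle in the right half-plane is enough: a large one
    that nearly touches the imaginary axis surrounds the square roots of any compact part of the
    slit plane ([contour_choice]). Its winding numbers are explicit, because
    [2 v / (v^2 - u^2) = 1 / (v - u) + 1 / (v + u)] and [- u] is outside.

    Let [T] be the integral of [(v^2 - B)^{-1} dv]. Since [2 v^2 (v^2 - B)^{-1} =
    2 + 2 B (v^2 - B)^{-1}], the Riesz integral is a multiple of [B T], and [S^2 = B] amounts
    to [B T^2 = (pi i)^2]. Rather than multiplying two contour integrals, deform [B] to
    the identity along the segment [B_s = (1 - s) + s B]: the slit plane is star-shaped about 1,
    so the resolvents exist on one common circle with a common bound. Integration by
    parts of [v (v^2 - B_s)^{-1}] gives the derivative of [T_s], and with it the derivative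
    of [B_s T_s^2] vanishes ([segment_integral_const]). At [s = 0] everything is
    scalar.

    For [A = 1 + K] with [|K| < 1] the ray [phi = pi] works. For [x >= 0] one has
    [A A^T + x = (A + x (A^T)^{-1}) A^T], and [A + x (A^T)^{-1}] is coercive since both [A] and
    [A^T] are, hence invertible ([perturbed_identity_negative_axis]).

    The adjoint exists by the Riesz representation theorem, proved by minimising
    [|x|^2 - 2 Re (f x)]; integrals and Neumann series converge because the bounded
    operators form a Banach space. *)

(** * The Riesz representation theorem *)

Lemma plus_minus (G : AbelianGroup) (x y : G) : plus y (minus x y) = x.
Proof.
unfold minus; rewrite (plus_comm x), plus_assoc, plus_opp_r; apply plus_zero_l.
Qed.

Section InnerProduct.

Variable H : HilbertSpace.
Implicit Types x y z : H.

Lemma ip_plus_r x y z : ip x (plus y z) = (ip x y + ip x z)%C.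
Proof. rewrite ip_conj, ip_plus_l, Cplus_conj, <- !ip_conj; reflexivity. Qed.

Lemma ip_scal_r (a : C) x y : ip x (scal (a : C_AbsRing) y) = (Cconj a * ip x y)%C.
Proof. rewrite ip_conj, ip_scal_l, Cmult_conj, <- ip_conj; reflexivity. Qed.

Lemma ip_minus_r x y z : ip x (minus y z) = (ip x y - ip x z)%C.
Proof.
rewrite ip_conj, ip_minus_l, Cminus_conj, <- !ip_conj; reflexivity.
Qed.

Lemma Re_ip_sym x y : Re (ip y x) = Re (ip x y).
Proof. now rewrite ip_conj. Qed.

Lemma norm_plus_sq x y :
  norm (plus x y) ^ 2 = norm x ^ 2 + 2 * Re (ip x y) + norm y ^ 2.
Proof.
pose proof (ip_norm (plus x y)) as E.
rewrite ip_plus_l, !ip_plus_r, !ip_norm in E.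
apply (f_equal Re) in E; rewrite re_RtoC in E.
rewrite !re_plus, !re_RtoC, (Re_ip_sym x y) in E; lra.
Qed.

Lemma norm_minus_sq x y :
  norm (minus x y) ^ 2 = norm x ^ 2 - 2 * Re (ip x y) + norm y ^ 2.
Proof.
pose proof (ip_norm (minus x y)) as E.
rewrite ip_minus_l, !ip_minus_r, !ip_norm in E.
apply (f_equal Re) in E; rewrite re_RtoC in E; unfold Cminus in E.
rewrite !re_plus, !re_opp, !re_plus, !re_opp, !re_RtoC, (Re_ip_sym x y) in E; lra.
Qed.

Lemma norm_scal_real_sq (r : R) x :
  norm (scal (RtoC r : C_AbsRing) x) ^ 2 = r ^ 2 * norm x ^ 2.
Proof.
pose proof (ip_norm (scal (RtoC r : C_AbsRing) x)) as E.
rewrite ip_scal_l, ip_scal_r, ip_norm in E.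
apply (f_equal Re) in E; rewrite re_RtoC in E; rewrite <- E; unfold Re, Im; simpl; ring.
Qed.

Lemma ip_null_l x y : norm x = 0 -> ip x y = RtoC 0.
Proof.
intros E; apply norm_eq_zero in E.
assert (Ex : x = minus x x) by (rewrite minus_eq_zero; exact E).
rewrite Ex, ip_minus_l; ring.
Qed.

Lemma Re_ip_le x y : Re (ip x y) <= norm x * norm y.
Proof.
(* Expand 0 <= | |y| x - |x| y |^2. *)
assert (P := pow2_ge_0
  (norm (minus (scal (RtoC (norm y) : C_AbsRing) x)
               (scal (RtoC (norm x) : C_AbsRing) y)))).
rewrite norm_minus_sq in P.
rewrite !norm_scal_real_sq, ip_scal_l, ip_scal_r in P.
replace (Re (norm y * (Cconj (norm x) * ip x y))%C)
  with (norm x * norm y * Re (ip x y)) in P by (unfold Re, Im; simpl; ring).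
pose proof (norm_ge_0 x) as Px; pose proof (norm_ge_0 y) as Py.
destruct (Req_dec (norm x) 0) as [Ex|Ex].
{ rewrite ip_null_l, re_RtoC, Ex by assumption; lra. }
destruct (Req_dec (norm y) 0) as [Ey|Ey].
{ rewrite ip_conj, ip_null_l, re_conj, re_RtoC, Ey by assumption; lra. }
assert (0 < norm x * norm y) by (apply Rmult_lt_0_compat; lra).
apply Rmult_le_reg_l with (norm x * norm y); [assumption|]; nra.
Qed.

Section Functional.

Variable f : H -> C.
Hypothesis f_plus : forall x y, f (plus x y) = (f x + f y)%C.
Hypothesis f_scal : forall (a : C) x, f (scal (a : C_AbsRing) x) = (a * f x)%C.
Variable M : R.
Hypothesis f_bound : forall x, Re (f x) <= M * norm x.

(** For [f = ip _ z] this is [|x - z|^2 - |z|^2], so its minimum must be [z]. *)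
Let q x := norm x ^ 2 - 2 * Re (f x).

Lemma energy_parallelogram x y :
  let mid := scal (RtoC (/ 2) : C_AbsRing) (plus x y) in
  norm (minus x y) ^ 2 = 2 * q x + 2 * q y - 4 * q mid.
Proof.
intros mid; unfold q, mid.
rewrite norm_minus_sq, f_scal, f_plus.
rewrite norm_scal_real_sq, norm_plus_sq.
replace (Re (RtoC (/ 2) * (f x + f y))%C) with (/ 2 * (Re (f x) + Re (f y)))
  by (unfold Re, Im; simpl; ring).
field.
Qed.

Lemma energy_increment z h (t : R) :
  q (plus z (scal (RtoC t : C_AbsRing) h))
  = q z + 2 * t * (Re (ip h z) - Re (f h)) + t ^ 2 * norm h ^ 2.
Proof.
unfold q; rewrite norm_plus_sq, f_plus, f_scal, ip_scal_r.
rewrite norm_scal_real_sq, (Re_ip_sym z h).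
replace (Re (Cconj t * ip z h)%C) with (t * Re (ip z h)) by (unfold Re, Im; simpl; ring).
replace (Re (f z + t * f h)%C) with (Re (f z) + t * Re (f h)) by (unfold Re, Im; simpl; ring).
rewrite (Re_ip_sym h z); ring.
Qed.

Lemma energy_bounded_below x : - M ^ 2 <= q x.
Proof. unfold q; pose proof (f_bound x); pose proof (pow2_ge_0 (norm x - M)); nra. Qed.

(** The minimum of the energy is attained: nearly minimal points are close to
    each other by the parallelogram identity, so they form a Cauchy filter. *)
Lemma energy_minimum : exists z, forall x, q z <= q x.
Proof.
destruct (completeness (fun r => exists x, r = - q x)) as [m [Ub Lub]].
{ exists (M ^ 2); intros r [x ->]; pose proof (energy_bounded_below x); lra. }
{ exists (- q zero); now exists zero. }
assert (Hm : forall x, - m <= q x).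
{ intros x; assert (- q x <= m) by (apply Ub; now exists x); lra. }
assert (Hlow : forall eps, 0 < eps -> exists x, q x < - m + eps).
{ intros eps He; apply NNPP; intros N.
  assert (m <= m - eps); [|lra].
  apply Lub; intros r [x ->]; apply Rnot_lt_le; intros L; apply N; exists x; lra. }
set (F := fun P : H -> Prop => exists eps, 0 < eps /\ forall x, q x < - m + eps -> P x).
assert (PF : ProperFilter F).
{ split.
  - intros P [eps [He HP]]; destruct (Hlow eps He) as [x Hx]; exists x; now apply HP.
  - split.
    + exists 1; split; [lra|easy].
    + intros P Q [e1 [H1 HP]] [e2 [H2 HQ]]; exists (Rmin e1 e2).
      split; [now apply Rmin_pos|].
      intros x Hx; split; [apply HP | apply HQ];
        [pose proof (Rmin_l e1 e2) | pose proof (Rmin_r e1 e2)]; lra.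
    + intros P Q I [e [He HP]]; exists e; split; [assumption|]; auto. }
assert (Near : forall eps x y, 0 < eps -> q x < - m + eps -> q y < - m + eps ->
   norm (minus x y) ^ 2 < 4 * eps).
{ intros eps x y He Hx Hy; rewrite energy_parallelogram.
  pose proof (Hm (scal (RtoC (/ 2) : C_AbsRing) (plus x y))); lra. }
assert (CF : cauchy F).
{ intros eps.
  set (e := eps ^ 2 / 4).
  assert (He : 0 < e) by (pose proof (cond_pos eps); unfold e; nra).
  destruct (Hlow e He) as [x Hx]; exists x, e; split; [assumption|].
  intros y Hy; apply (norm_compat1 (V := H)).
  assert (N : norm (minus y x) < eps); [|exact N].
  pose proof (Near e y x He Hy Hx) as N; unfold e in N.
  apply Rsqr_incrst_0; [unfold Rsqr; nra | apply norm_ge_0 | apply Rlt_le, cond_pos]. }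
set (z := lim F).
exists z; intros x; apply Rle_trans with (- m); [|apply Hm].
apply le_epsilon; intros eps He.
(* q is continuous at z, and z is a limit of points of nearly minimal energy. *)
set (L := 2 * norm z + 1 + 2 * Rabs M).
assert (HL : 0 < L) by (unfold L; pose proof (norm_ge_0 z); pose proof (Rabs_pos M); lra).
assert (Hk : 0 < norm_factor (V := H)) by apply norm_factor_gt_0.
set (d := Rmin 1 (eps / 2 / L)).
assert (Hd : 0 < d) by (apply Rmin_pos; [lra|]; repeat apply Rdiv_lt_0_compat; lra).
assert (Hd' : 0 < d / norm_factor (V := H)) by now apply Rdiv_lt_0_compat.
pose proof (complete_cauchy F PF CF (mkposreal _ Hd')) as B.
fold z in B.
assert (B2 : F (fun y => q y < - m + eps / 2)) by (exists (eps / 2); split; [lra|easy]).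
destruct (filter_ex _ (filter_and _ _ B B2)) as [y [By Qy]].
apply (norm_compat2 (V := H)) in By; simpl in By.
replace (norm_factor (V := H) * (d / norm_factor (V := H))) with d in By by (field; lra).
assert (Ez : y = plus z (scal (RtoC 1 : C_AbsRing) (minus y z))).
{ transitivity (plus z (minus y z)).
  - symmetry; apply plus_minus.
  - f_equal; symmetry; apply (scal_one (V := H)). }
rewrite Ez, energy_increment in Qy.
set (h := minus y z) in *.
assert (Bh : norm h < d) by exact By.
assert (I1 : - (norm h * norm z) <= Re (ip h z)).
{ pose proof (Re_ip_le (scal (RtoC (-1) : C_AbsRing) h) z) as I.
  rewrite ip_scal_l in I.
  assert (norm (scal (RtoC (-1) : C_AbsRing) h) <= norm h).
  { apply (Rle_trans _ _ _ (hs_norm_scal _ _)); rewrite Cmod_R, Rabs_left; lra. }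
  replace (Re (RtoC (-1) * ip h z)%C) with (- Re (ip h z)) in I by (unfold Re, Im; simpl; ring).
  pose proof (norm_ge_0 z); nra. }
pose proof (f_bound h) as I2.
pose proof (Rle_abs M); pose proof (norm_ge_0 h); pose proof (norm_ge_0 z).
assert (I3 : norm h * L <= eps / 2).
{ apply Rle_trans with (eps / 2 / L * L); [|apply Req_le; field; lra].
  apply Rmult_le_compat_r; [lra|]; pose proof (Rmin_r 1 (eps / 2 / L)); unfold d in Bh; lra. }
assert (norm h <= 1) by (pose proof (Rmin_l 1 (eps / 2 / L)); unfold d in Bh; lra).
unfold L in I3; nra.
Qed.

(** The first variation of the energy vanishes at its minimum, and this is the
    representation of [f] by the minimum. *)
Lemma riesz_representation : exists z, forall x, f x = ip x z.
Proof.
destruct energy_minimum as [z Hz]; exists z.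
assert (E : forall h, Re (f h) = Re (ip h z)).
{ intros h; set (b := Re (ip h z) - Re (f h)).
  assert (V : forall t, 0 <= 2 * t * b + t ^ 2 * norm h ^ 2).
  { intros t; pose proof (Hz (plus z (scal (RtoC t : C_AbsRing) h))) as V.
    rewrite energy_increment in V; unfold b; lra. }
  set (n := norm h ^ 2 + 1).
  assert (Hn : 0 < n) by (unfold n; pose proof (pow2_ge_0 (norm h)); lra).
  pose proof (V (- b / n)) as Vt.
  assert (b ^ 2 <= 0).
  { replace (2 * (- b / n) * b + (- b / n) ^ 2 * norm h ^ 2)
      with (b ^ 2 * ((norm h ^ 2 - 2 * n) / (n * n))) in Vt by (field; lra).
    assert ((norm h ^ 2 - 2 * n) / (n * n) < 0).
    { apply Rmult_lt_reg_r with (n * n); [nra|].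
      unfold Rdiv; rewrite Rmult_assoc, Rinv_l, Rmult_1_r, Rmult_0_l by nra.
      unfold n; pose proof (pow2_ge_0 (norm h)); lra. }
    nra. }
  assert (b = 0) by nra.
  unfold b in *; lra. }
intros x; apply injective_projections; [apply E|].
pose proof (E (scal (Ci : C_AbsRing) x)) as Ei.
rewrite f_scal, ip_scal_l in Ei; simpl in Ei; lra.
Qed.

End Functional.

End InnerProduct.

(** * Adjoint and transpose *)

Section Adjoint.

Variable H : HilbertSpace.
Implicit Types (x y z : H) (A B : bounded_op H).

Lemma ip_separates_r x y : (forall z, ip z x = ip z y) -> x = y.
Proof. intros E; apply ip_separates; intros z; now rewrite ip_conj, E, <- ip_conj. Qed.

Lemma op_norm_ge_0 A : 0 <= op_norm A.
Proof.
pose proof (@op_norm_ge H A zero) as P; rewrite hs_norm_zero in P.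
pose proof (norm_ge_0 (A zero)); lra.
Qed.

Lemma adj_exists A : exists B, forall x y, ip (A x) y = ip x (B y).
Proof.
assert (E : forall y, exists z, forall x, ip (A x) y = ip x z).
{ intros y.
  apply (@riesz_representation H (fun x => ip (A x) y)) with (M := op_norm A * norm y).
  - intros x x'; rewrite (linear_plus _ (op_linear A)); apply ip_plus_l.
  - intros a x; rewrite (linear_scal _ (op_linear A)); apply ip_scal_l.
  - intros x; apply (Rle_trans _ _ _ (Re_ip_le _ _ _)).
    pose proof (op_norm_bound A x); pose proof (norm_ge_0 y); nra. }
set (b := fun y => proj1_sig (constructive_indefinite_description _ (E y))).
assert (Eb : forall x y, ip (A x) y = ip x (b y)).
{ intros x y; unfold b; now destruct constructive_indefinite_description. }
assert (L : is_linear (K := C_AbsRing) (U := H) (V := H) b).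
{ split.
  - intros x y; apply ip_separates_r; intros z.
    now rewrite ip_plus_r, <- !Eb, ip_plus_r.
  - intros a x; apply ip_separates_r; intros z.
    now rewrite ip_scal_r, <- !Eb, ip_scal_r.
  - exists (op_norm A + 1); pose proof (op_norm_ge_0 A); split; [lra|]; intros x.
    (* |b x|^2 = (A (b x), x) *)
    pose proof (Re_ip_le _ (A (b x)) x) as P.
    rewrite Eb, ip_norm, re_RtoC in P.
    pose proof (op_norm_bound A (b x)); pose proof (norm_ge_0 x).
    destruct (Req_dec (norm (b x)) 0) as [Z|Z].
    + rewrite Z; nra.
    + assert (0 < norm (b x)) by (pose proof (norm_ge_0 (b x)); lra).
      apply Rmult_le_reg_l with (norm (b x)); [assumption|]; nra. }
exists (BoundedOp L); exact Eb.
Qed.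

Lemma adj_spec A x y : ip (A x) y = ip x (adj A y).
Proof. exact (epsilon_spec _ _ (adj_exists A) x y). Qed.

Variable J : conjugation H.

Local Infix "**" := (@op_mult H) (at level 40, left associativity).

(** The form [(x, y) |-> ip x (J y)] is bilinear, and the transpose is the adjoint
    for it; its symmetry is what makes the transpose an involution. *)
Lemma J_form_sym x y : ip x (J y) = ip y (J x).
Proof. rewrite ip_conj; now rewrite conj_ip_l, Cconj_conj. Qed.

Lemma transp_spec A x y : ip (A x) (J y) = ip x (J (J_transp J A y)).
Proof. simpl; rewrite conj_invol; apply adj_spec. Qed.

Lemma transp_unique A B :
  (forall x y, ip (A x) (J y) = ip x (J (B y))) -> B = J_transp J A.
Proof.
intros E; apply bounded_op_ext; intros y.
rewrite <- (conj_invol J (B y)), <- (conj_invol J (J_transp J A y)); f_equal.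
apply ip_separates_r; intros x; now rewrite <- E, transp_spec.
Qed.

Lemma transp_transp A : J_transp J (J_transp J A) = A.
Proof.
symmetry; apply transp_unique; intros x y.
now rewrite J_form_sym, <- transp_spec, J_form_sym.
Qed.

Lemma transp_mult A B : J_transp J (A ** B) = J_transp J B ** J_transp J A.
Proof.
symmetry; apply transp_unique; intros x y; simpl op_fun at 1.
now rewrite transp_spec, transp_spec.
Qed.

Lemma transp_id : J_transp J (op_id H) = op_id H.
Proof. symmetry; now apply transp_unique. Qed.

Lemma transp_plus A B :
  J_transp J (op_plus A B) = op_plus (J_transp J A) (J_transp J B).
Proof.
symmetry; apply transp_unique; intros x y; simpl.
now rewrite ip_plus_l, !conj_plus, ip_plus_r, !conj_invol, <- !adj_spec.
Qed.

Lemma transp_scal (a : C) A : J_transp J (op_scal a A) = op_scal a (J_transp J A).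
Proof.
symmetry; apply transp_unique; intros x y; simpl.
now rewrite ip_scal_l, !conj_scal, ip_scal_r, !conj_invol, Cconj_conj, <- !adj_spec.
Qed.

Lemma transp_norm A : op_norm (J_transp J A) <= op_norm A.
Proof.
apply op_norm_le; intros x Hx; set (y := J_transp J A x).
pose proof (Re_ip_le _ (A (J y)) (J x)) as P.
rewrite transp_spec in P; fold y in P; rewrite ip_norm, re_RtoC, !conj_norm in P.
pose proof (op_norm_bound A (J y)) as Q; rewrite conj_norm in Q.
pose proof (norm_ge_0 x); pose proof (norm_ge_0 y); pose proof (op_norm_ge_0 A).
pose proof (norm_ge_0 (A (J y))).
destruct (Req_dec (norm y) 0) as [Z|Z]; [lra|].
apply Rmult_le_reg_l with (norm y); [lra|].
apply Rle_trans with (norm (A (J y)) * norm x); [simpl in P; lra|].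
apply Rle_trans with (norm (A (J y)) * 1); [now apply Rmult_le_compat_l|lra].
Qed.

End Adjoint.

(** * Completeness of the space of bounded operators *)

Section Completeness.

Variable H : HilbertSpace.
Implicit Types (x y z : H) (A B : bounded_op H).

(** Chosen by its defining property, since a filter that is not Cauchy needs a value
    too. *)
Definition op_lim (F : (bounded_op H -> Prop) -> Prop) : bounded_op H :=
  epsilon (inhabits (op_zero H)) (fun L => forall eps : posreal, F (ball L eps)).

Lemma norm_minus_trans x y z : norm (minus x z) <= norm (minus x y) + norm (minus y z).
Proof. rewrite (minus_trans y x z); apply (norm_triangle (V := H)). Qed.

Lemma norm_minus_sym x y : norm (minus x y) = norm (minus y x).
Proof. rewrite <- opp_minus; exact (norm_opp (V := H) (minus y x)). Qed.

Lemma cauchy_pointwise F (PF : ProperFilter F) :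
  cauchy F -> forall x, exists y, filterlim (fun A : bounded_op H => A x) F (locally y).
Proof.
intros CF x.
apply (filterlim_locally_cauchy (U := H)).
intros eps.
assert (Hn : 0 < norm x + 1) by (pose proof (norm_ge_0 x); lra).
assert (He : 0 < eps / 2 / (norm x + 1))
  by (pose proof (cond_pos eps); repeat apply Rdiv_lt_0_compat; lra).
destruct (CF (mkposreal _ He)) as [A HA].
exists (ball A (mkposreal _ He)); split; [exact HA|].
assert (N : forall B, ball A (mkposreal _ He) B -> norm (minus (B x) (A x)) < eps / 2).
{ intros B HB.
  pose proof (op_norm_bound (minus B A) x) as P.
  change (norm (minus (B x) (A x)) <= op_norm (minus B A) * norm x) in P.
  change (op_norm (minus B A) < eps / 2 / (norm x + 1)) in HB.
  apply (Rle_lt_trans _ _ _ P).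
  apply Rle_lt_trans with (eps / 2 / (norm x + 1) * norm x).
  - apply Rmult_le_compat_r; [apply norm_ge_0 | lra].
  - apply Rlt_le_trans with (eps / 2 / (norm x + 1) * (norm x + 1)).
    + apply Rmult_lt_compat_l; [exact He | lra].
    + apply Req_le; field; lra. }
intros B D HB HD; apply (norm_compat1 (V := H)).
apply Rle_lt_trans with (1 := norm_minus_trans _ (A x) _).
rewrite (norm_minus_sym (A x)).
pose proof (N B HB); pose proof (N D HD); lra.
Qed.

(** A Cauchy filter of operators converges pointwise; the pointwise limit is linear
    and bounded, and the convergence is uniform on the unit ball because the Cauchy
    condition is. *)
Lemma op_cauchy_limit F (PF : ProperFilter F) :
  cauchy F -> exists L : bounded_op H, forall eps : posreal, F (ball L eps).
Proof.
intros CF.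
set (b := fun x => proj1_sig (constructive_indefinite_description _
                                (cauchy_pointwise F PF CF x))).
assert (Hb : forall x, filterlim (fun A : bounded_op H => A x) F (locally (b x))).
{ intros x; unfold b; now destruct constructive_indefinite_description. }
assert (FF : Filter F) by apply PF.
assert (Near : forall x (eta : R), 0 < eta -> F (fun A => norm (minus (A x) (b x)) < eta)).
{ intros x eta He.
  apply (Hb x (fun y => norm (minus y (b x)) < eta)).
  apply (locally_le_locally_norm (V := H)).
  now exists (mkposreal _ He). }
assert (Close : forall A (e : R), F (ball A e) -> forall x, norm (minus (A x) (b x)) <= e * norm x).
{ intros A e HA x; apply le_epsilon; intros eta Heta.
  destruct (filter_ex _ (filter_and _ _ HA (Near x eta Heta))) as [B [HB HB']].
  apply Rle_trans with (1 := norm_minus_trans _ (B x) _).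
  apply Rplus_le_compat; [|lra].
  rewrite norm_minus_sym.
  pose proof (op_norm_bound (minus B A) x) as P.
  change (norm (minus (B x) (A x)) <= op_norm (minus B A) * norm x) in P.
  change (op_norm (minus B A) < e) in HB.
  apply Rle_trans with (1 := P); apply Rmult_le_compat_r; [apply norm_ge_0 | lra]. }
assert (Lb : is_linear (K := C_AbsRing) (U := H) (V := H) b).
{ split.
  - intros x y.
    apply (filterlim_locally_unique (V := H) (F := F) (fun A : bounded_op H => A (plus x y))).
    + apply Hb.
    + apply filterlim_ext with (fun A : bounded_op H => plus (A x) (A y)).
      { intros A; symmetry; apply (linear_plus _ (op_linear A)). }
      exact (filterlim_comp_2 _ _ _ (Hb x) (Hb y) (filterlim_plus (V := H) (b x) (b y))).
  - intros k x.
    apply (filterlim_locally_unique (V := H) (F := F)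
             (fun A : bounded_op H => A (scal k x))).
    + apply Hb.
    + apply filterlim_ext with (fun A : bounded_op H => scal k (A x)).
      { intros A; symmetry; apply (linear_scal _ (op_linear A)). }
      apply (filterlim_comp _ _ _ _ _ _ _ _ (Hb x) (filterlim_scal_r (V := H) k (b x))).
  - destruct (CF (mkposreal 1 Rlt_0_1)) as [A HA].
    exists (op_norm A + 1); pose proof (op_norm_ge_0 _ A); split; [lra|]; intros x.
    pose proof (Close A 1 HA x) as N; rewrite norm_minus_sym in N.
    pose proof (op_norm_bound A x).
    pose proof (hs_norm_triangle (A x) (minus (b x) (A x))) as T.
    replace (plus (A x) (minus (b x) (A x))) with (b x) in T
      by (symmetry; exact (plus_minus (CompleteNormedModule.AbelianGroup _ H) _ _)).
    lra. }
exists (BoundedOp Lb); intros eps.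
assert (He : 0 < eps / 4) by (pose proof (cond_pos eps); lra).
destruct (CF (mkposreal _ He)) as [A HA].
apply filter_imp with (2 := HA); intros B HB.
change (op_norm (minus B (BoundedOp Lb)) < eps).
apply Rle_lt_trans with (eps / 2); [|lra].
apply op_norm_le; intros x Hx.
change (norm (minus (B x) (b x)) <= eps / 2).
apply Rle_trans with (1 := norm_minus_trans _ (A x) _).
pose proof (Close A _ HA x) as P; simpl in P.
pose proof (op_norm_bound (minus B A) x) as Q.
change (norm (minus (B x) (A x)) <= op_norm (minus B A) * norm x) in Q.
change (op_norm (minus B A) < eps / 4) in HB.
pose proof (norm_ge_0 x); pose proof (op_norm_ge_0 _ (minus B A)); nra.
Qed.

Lemma op_complete (F : (bounded_op H -> Prop) -> Prop) :
  ProperFilter F -> cauchy F -> forall eps : posreal, F (ball (op_lim F) eps).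
Proof. intros PF CF; exact (epsilon_spec _ _ (op_cauchy_limit F PF CF)). Qed.

Lemma op_lim_close (F1 F2 : (bounded_op H -> Prop) -> Prop) :
  filter_le F1 F2 -> filter_le F2 F1 -> close (op_lim F1) (op_lim F2).
Proof.
intros L1 L2; replace F2 with F1; [apply close_refl|].
apply functional_extensionality; intros P; apply propositional_extensionality.
split; [apply L2 | apply L1].
Qed.

Definition bounded_op_CompleteSpace_mixin : CompleteSpace.mixin_of (bounded_op_UniformSpace H) :=
  CompleteSpace.Mixin (bounded_op_UniformSpace H) op_lim op_complete op_lim_close.

(** Its projection to normed modules is convertible to [bounded_op_NormedModule H], so
    that theorems on Banach spaces apply to integrals stated there. *)
Definition bounded_op_Complete : CompleteNormedModule C_AbsRing :=
  CompleteNormedModule.Pack C_AbsRing (bounded_op H)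
    (CompleteNormedModule.Class C_AbsRing (bounded_op H)
       (NormedModule.class C_AbsRing (bounded_op_NormedModule H))
       bounded_op_CompleteSpace_mixin) (bounded_op H).

End Completeness.

(** Integrability of continuous functions is a theorem about real Banach spaces. *)
Definition restr_Complete (V : CompleteNormedModule C_AbsRing) : CompleteNormedModule R_AbsRing :=
  CompleteNormedModule.Pack R_AbsRing V
    (CompleteNormedModule.Class R_AbsRing V
       (NormedModule.class R_AbsRing (restr_NormedModule V))
       (CompleteSpace.class (CompleteNormedModule.CompleteSpace C_AbsRing V))) V.

(** * The algebra of bounded operators *)

Declare Scope op_scope.
Delimit Scope op_scope with op.
Infix "+" := op_plus : op_scope.
Infix "*" := op_mult : op_scope.
Notation "A - B" := (op_plus A (op_opp B)) : op_scope.
Notation "- A" := (op_opp A) : op_scope.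
Notation "a *: A" := (op_scal a A) (at level 40, left associativity) : op_scope.

Local Arguments op_norm {H} A%_op_scope.

Section Algebra.

Variable H : HilbertSpace.
Implicit Types (A B X Y : bounded_op H).
Notation I := (op_id H).

Lemma op_mult_assoc A B X : (A * (B * X) = A * B * X)%op.
Proof. now apply bounded_op_ext. Qed.

Lemma op_mult_id_l A : (I * A = A)%op.
Proof. now apply bounded_op_ext. Qed.

Lemma op_mult_id_r A : (A * I = A)%op.
Proof. now apply bounded_op_ext. Qed.

Lemma op_mult_plus_l A B X : ((A + B) * X = A * X + B * X)%op.
Proof. now apply bounded_op_ext. Qed.

Lemma op_mult_plus_r A B X : (X * (A + B) = X * A + X * B)%op.
Proof. apply bounded_op_ext; intros x; apply (linear_plus _ (op_linear X)). Qed.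

Lemma op_scal_mult_l (a : C) A B : (a *: A * B = a *: (A * B))%op.
Proof. now apply bounded_op_ext. Qed.

Lemma op_scal_mult_r (a : C) A B : (A * (a *: B) = a *: (A * B))%op.
Proof. apply bounded_op_ext; intros x; apply (linear_scal _ (op_linear A)). Qed.

Lemma op_scal_zero_l A : (RtoC 0 *: A = op_zero H)%op.
Proof. apply bounded_op_ext; intros x; exact (scal_zero_l (V := H) (A x)). Qed.

Lemma op_scal_opp_one A : (- A = (- RtoC 1)%C *: A)%op.
Proof. apply bounded_op_ext; intros x; symmetry; exact (scal_opp_one (V := H) (A x)). Qed.

#[global] Instance op_ring_ops :
  @Ring_ops (bounded_op H) (op_zero H) I (@op_plus H) (@op_mult H)
    (fun A B => A - B)%op (@op_opp H) eq := {}.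

#[global] Instance op_ring : Ncring.Ring (Ro := op_ring_ops).
Proof.
split; try (unfold "_==_"; cbn; intros; reflexivity).
- exact eq_equivalence.
- intros ? ? -> ? ? ->; reflexivity.
- intros ? ? -> ? ? ->; reflexivity.
- intros ? ? -> ? ? ->; reflexivity.
- intros ? ? ->; reflexivity.
- intros A; exact (eq_trans (op_plus_comm (op_zero H) A) (op_plus_zero_r A)).
- apply op_plus_comm.
- apply op_plus_assoc.
- apply op_mult_id_l.
- apply op_mult_id_r.
- apply op_mult_assoc.
- apply op_mult_plus_l.
- intros; apply op_mult_plus_r.
- apply op_plus_opp_r.
Qed.

Lemma op_norm_mult A B : op_norm (A * B) <= op_norm A * op_norm B.
Proof.
apply op_norm_le; intros x Hx; simpl.
apply Rle_trans with (1 := op_norm_bound _ _).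
apply Rmult_le_compat_l; [apply op_norm_ge_0 | now apply op_norm_ge].
Qed.

Lemma op_norm_id : op_norm I <= 1.
Proof. now apply op_norm_le. Qed.

Lemma op_norm_opp A : op_norm (- A) = op_norm A.
Proof. exact (norm_opp (V := bounded_op_NormedModule H) A). Qed.

Lemma op_mult_linear_l A :
  is_linear (U := bounded_op_NormedModule H) (V := bounded_op_NormedModule H)
    (fun X => A * X)%op.
Proof.
split.
- intros X Y; apply op_mult_plus_r.
- intros a X; apply op_scal_mult_r.
- exists (op_norm A + 1)%R; pose proof (op_norm_ge_0 _ A); split; [lra|]; intros X.
  change (op_norm (A * X) <= (op_norm A + 1) * op_norm X)%R.
  pose proof (op_norm_mult A X); pose proof (op_norm_ge_0 _ X); nra.
Qed.

Lemma op_mult_linear_r A :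
  is_linear (U := bounded_op_NormedModule H) (V := bounded_op_NormedModule H)
    (fun X => X * A)%op.
Proof.
split.
- intros X Y; apply op_mult_plus_l.
- intros a X; apply op_scal_mult_l.
- exists (op_norm A + 1)%R; pose proof (op_norm_ge_0 _ A); split; [lra|]; intros X.
  change (op_norm (X * A) <= (op_norm A + 1) * op_norm X)%R.
  pose proof (op_norm_mult X A); pose proof (op_norm_ge_0 _ X); nra.
Qed.

Lemma is_inverse_unique A X Y : is_inverse A X -> is_inverse A Y -> X = Y.
Proof.
intros [_ L] [R _].
rewrite <- (op_mult_id_r X), <- R, op_mult_assoc, L; apply op_mult_id_l.
Qed.

Lemma op_inv_spec A : invertible A -> is_inverse A (op_inv A).
Proof. intros I0; exact (epsilon_spec _ _ I0). Qed.

Lemma op_inv_eq A X : is_inverse A X -> op_inv A = X.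
Proof.
intros E; apply is_inverse_unique with A; [|exact E].
apply op_inv_spec; now exists X.
Qed.

Lemma is_inverse_sym A X : is_inverse A X -> is_inverse X A.
Proof. intros [L R]; now split. Qed.

Lemma is_inverse_mult A B X Y : is_inverse A X -> is_inverse B Y -> is_inverse (A * B)%op (Y * X)%op.
Proof.
intros [L R] [L' R']; split.
- replace (A * B * (Y * X))%op with (A * (B * Y) * X)%op by (rewrite !op_mult_assoc; reflexivity).
  now rewrite L', op_mult_id_r.
- replace (Y * X * (A * B))%op with (Y * (X * A) * B)%op by (rewrite !op_mult_assoc; reflexivity).
  now rewrite R, op_mult_id_r.
Qed.

Lemma is_inverse_scal (a : C) A X : a <> RtoC 0 -> is_inverse A X -> is_inverse (a *: A)%op ((/ a)%C *: X)%op.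
Proof.
intros Na [L R]; split; rewrite op_scal_mult_l, op_scal_mult_r, op_scal_assoc.
- now rewrite L, Cinv_r, op_scal_one.
- now rewrite R, Cinv_l, op_scal_one.
Qed.

Lemma inverse_commute A X Y : is_inverse A X -> (A * Y = Y * A)%op -> (X * Y = Y * X)%op.
Proof.
intros [L R] E.
transitivity (X * (Y * A) * X)%op.
- now rewrite <- !op_mult_assoc, L, op_mult_id_r.
- now rewrite <- E, op_mult_assoc, R, op_mult_id_l.
Qed.

(** The Neumann series of [X] is dominated by a geometric series; its sum [L] satisfies
    [L - 1 = X L], which also gives the bound [|L| <= 1 + q |L|]. *)
Lemma neumann X (q : R) : op_norm X <= q -> q < 1 ->
  exists L, is_inverse (I - X)%op L /\ op_norm L <= / (1 - q).
Proof.
intros Hq Hq1.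
set (a := fix a (n : nat) := match n with O => I | S n => (X * a n)%op end).
assert (Q0 : 0 <= q) by (pose proof (op_norm_ge_0 _ X); lra).
assert (Na : forall n, op_norm (a n) <= q ^ n).
{ induction n as [|n IH]; simpl; [apply op_norm_id|].
  apply Rle_trans with (1 := op_norm_mult _ _).
  apply Rmult_le_compat; auto using op_norm_ge_0. }
assert (Ca : forall n, (a n * X = X * a n)%op).
{ induction n as [|n IH]; simpl.
  - now rewrite op_mult_id_l, op_mult_id_r.
  - now rewrite <- op_mult_assoc, IH. }
assert (Gq : ex_series (fun n => q ^ n)).
{ apply ex_series_geom; rewrite Rabs_pos_eq; assumption. }
destruct (ex_series_le (V := bounded_op_Complete H) a _ Na Gq) as [L HL].
change (bounded_op H) in L.
assert (Lim : forall g : bounded_op H -> bounded_op H,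
  is_linear (U := bounded_op_NormedModule H) (V := bounded_op_NormedModule H) g ->
  filterlim (fun n => g (sum_n (G := bounded_op_AbelianMonoid H) a n)) eventually
    (locally (g L))).
{ intros g Lg; apply (filterlim_comp _ _ _ _ g _ (locally L)); [exact HL|].
  exact (linear_cont (U := bounded_op_NormedModule H) (V := bounded_op_NormedModule H)
           g L Lg). }
assert (Step : (L - I = X * L)%op).
{ apply (filterlim_locally_unique (V := bounded_op_NormedModule H) (F := eventually)
    (fun n => X * sum_n (G := bounded_op_AbelianMonoid H) a n)%op).
  - apply filterlim_ext with (fun n => (sum_n (G := bounded_op_AbelianMonoid H) a (S n) - I)%op).
    { induction x as [|n IH].
      - rewrite sum_Sn, sum_O; simpl. change plus with (@op_plus H).
        now non_commutative_ring.
      - transitivity (sum_n (G := bounded_op_AbelianMonoid H) a (S n) - I + X * a (S n))%op.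
        + rewrite (sum_Sn a (S n)); change plus with (@op_plus H); change (a (S (S n))) with (X * a (S n))%op.
          generalize (sum_n (G := bounded_op_AbelianMonoid H) a (S n)) (a (S n)); intros.
          now non_commutative_ring.
        + rewrite IH, <- op_mult_plus_r; f_equal; symmetry; exact (sum_Sn a n). }
    apply (filterlim_comp _ _ _
       (fun n => sum_n (G := bounded_op_AbelianMonoid H) a (S n)) (fun Y => (Y - I)%op)
       _ (locally L)).
    + apply filterlim_comp with (2 := HL); apply eventually_subseq; intros; lia.
    + apply (filterlim_comp_2 (F := locally L) (fun Y => Y) (fun _ => (- I)%op) (@op_plus H)
         (filterlim_id _ _) (filterlim_const _)
         (filterlim_plus (V := bounded_op_NormedModule H) L (- I)%op)).
  - apply (Lim _ (op_mult_linear_l X)). }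
assert (Com : (L * X = X * L)%op).
{ apply (filterlim_locally_unique (V := bounded_op_NormedModule H) (F := eventually)
    (fun n => X * sum_n (G := bounded_op_AbelianMonoid H) a n)%op).
  - apply filterlim_ext with (fun n => (sum_n (G := bounded_op_AbelianMonoid H) a n * X)%op).
    { induction x as [|n IH].
      - rewrite !sum_O; apply (Ca 0%nat).
      - rewrite !sum_Sn; change plus with (@op_plus H).
        now rewrite op_mult_plus_l, op_mult_plus_r, IH, Ca. }
    apply (Lim _ (op_mult_linear_r X)).
  - apply (Lim _ (op_mult_linear_l X)). }
assert (E : (L - X * L = I)%op) by (rewrite <- Step; non_commutative_ring).
exists L; split; [split|].
- rewrite <- E at 2; non_commutative_ring.
- rewrite <- E at 2; rewrite <- Com; non_commutative_ring.
- assert (L = I + X * L)%op by (rewrite <- E at 1; non_commutative_ring).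
  assert (op_norm L <= 1 + q * op_norm L).
  { rewrite H0 at 1; apply Rle_trans with (1 := op_norm_plus _ _).
    apply Rplus_le_compat; [apply op_norm_id|].
    apply Rle_trans with (1 := op_norm_mult _ _).
    apply Rmult_le_compat_r; [apply op_norm_ge_0 | assumption]. }
  apply Rmult_le_reg_l with (1 - q); [lra|]; rewrite Rinv_r; lra.
Qed.

(** Factor [X' = (1 - (X - X') Y) X] and invert the first factor by a Neumann series. *)
Lemma inverse_perturb X Y X' :
  is_inverse X Y -> op_norm (X' - X) * op_norm Y <= / 2 ->
  exists Y', is_inverse X' Y' /\ op_norm Y' <= 2 * op_norm Y.
Proof.
intros E Hn.
destruct (neumann ((X - X') * Y)%op (/ 2)) as [L [EL NL]]; [|lra|].
{ apply Rle_trans with (1 := op_norm_mult _ _).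
  replace (X - X')%op with (- (X' - X))%op by non_commutative_ring.
  now rewrite op_norm_opp. }
exists (Y * L)%op; split.
- replace X' with ((I - (X - X') * Y) * X)%op; [now apply is_inverse_mult|].
  destruct E as [_ R].
  transitivity (X - (X - X') * (Y * X))%op; [non_commutative_ring|].
  rewrite R; non_commutative_ring.
- apply Rle_trans with (1 := op_norm_mult _ _).
  replace (/ (1 - / 2)) with 2 in NL by field.
  pose proof (op_norm_ge_0 _ Y); nra.
Qed.

End Algebra.

(** * Integrals and derivatives of vector-valued functions *)

(** A bounded linear map sends Riemann sums to Riemann sums and is continuous. *)
Lemma is_RInt_linear (U V : NormedModule C_AbsRing) (l : U -> V) (f : R -> U) (a b : R) (v : U) :
  is_linear l ->
  is_RInt (V := restr_NormedModule U) f a b v ->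
  is_RInt (V := restr_NormedModule V) (fun t => l (f t)) a b (l v).
Proof.
intros L Hf.
assert (Es : forall (r : R) (x : U),
   l (@scal R_Ring (restr_ModuleSpace U) r x) = @scal R_Ring (restr_ModuleSpace V) r (l x)).
{ intros r x; apply (linear_scal _ L). }
assert (Ez : l zero = zero).
{ pose proof (@scal_zero_l R_Ring (restr_ModuleSpace U) zero) as E1.
  pose proof (@scal_zero_l R_Ring (restr_ModuleSpace V) (l zero)) as E2.
  exact (eq_trans (eq_sym (f_equal l E1)) (eq_trans (Es _ _) E2)). }
assert (Er : forall ptd,
   @Riemann_sum (restr_ModuleSpace V) (fun t => l (f t)) ptd
   = l (@Riemann_sum (restr_ModuleSpace U) f ptd)).
{ intros ptd; induction ptd as [h|h s IH] using SF_cons_ind.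
  - symmetry; exact Ez.
  - rewrite !Riemann_sum_cons, IH.
    symmetry; apply (eq_trans (linear_plus _ L _ _)); f_equal; apply Es. }
unfold is_RInt.
apply filterlim_ext with
  (fun ptd => l (@scal R_Ring (restr_ModuleSpace U) (sign (b - a))
                   (@Riemann_sum (restr_ModuleSpace U) f ptd))).
{ intros ptd; rewrite Es; f_equal; symmetry; apply Er. }
apply (filterlim_comp _ _ _ _ l _ (locally v)); [exact Hf|].
exact (linear_cont l v L).
Qed.

(** Reduces integrals of complex functions to integrals of their real and imaginary
    parts, taking [v = 1] and [v = i]. *)
Lemma is_RInt_real_scal (V : NormedModule C_AbsRing) (f : R -> R) (a b r : R) (v : V) :
  is_RInt f a b r ->
  is_RInt (V := restr_NormedModule V) (fun t => scal (RtoC (f t) : C_AbsRing) v) a b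
    (scal (RtoC r : C_AbsRing) v).
Proof.
intros Hf.
assert (Er : forall ptd,
   @Riemann_sum (restr_ModuleSpace V) (fun t => scal (RtoC (f t) : C_AbsRing) v) ptd
   = scal (RtoC (Riemann_sum f ptd) : C_AbsRing) v).
{ intros ptd; induction ptd as [h|h s IH] using SF_cons_ind.
  - symmetry; exact (scal_zero_l v).
  - rewrite !Riemann_sum_cons, IH.
    change (plus (scal (RtoC (SF_h s - fst h) : C_AbsRing) (scal (RtoC (f (snd h)) : C_AbsRing) v))
      (scal (RtoC (Riemann_sum f s) : C_AbsRing) v)
      = scal (RtoC ((SF_h s - fst h) * f (snd h) + Riemann_sum f s) : C_AbsRing) v).
    rewrite scal_assoc, RtoC_plus, RtoC_mult; symmetry; apply (scal_distr_r (K := C_Ring)). }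
unfold is_RInt.
apply filterlim_ext with
  (fun ptd => scal (RtoC (scal (sign (b - a)) (Riemann_sum f ptd)) : C_AbsRing) v).
{ intros ptd; rewrite Er.
  change (scal (RtoC (sign (b - a) * Riemann_sum f ptd) : C_AbsRing) v
    = scal (RtoC (sign (b - a)) : C_AbsRing) (scal (RtoC (Riemann_sum f ptd) : C_AbsRing) v)).
  now rewrite scal_assoc, RtoC_mult. }
apply (filterlim_comp _ _ _ _ (fun r => scal (RtoC r : C_AbsRing) v) _ (locally r)); [exact Hf|].
apply (filterlim_comp _ _ _ RtoC (fun c => scal (c : C_AbsRing) v) _ (locally (RtoC r : C_AbsRing))).
- intros P [eps He]; exists eps; intros y Hy; apply He.
  change (Cmod (minus (RtoC y) (RtoC r)) < eps).
  change (Rabs (y - r) < eps) in Hy.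
  change (Cmod (RtoC y - RtoC r)%C < eps); now rewrite <- RtoC_minus, Cmod_R.
- apply (filterlim_scal_l (RtoC r : C_AbsRing) v).
Qed.

Lemma is_derive_of_quadratic (V : NormedModule R_AbsRing) (f : R -> V) (x C : R) (l : V) :
  (forall y, norm (minus (minus (f y) (f x)) (scal (y - x) l)) <= C * (y - x) ^ 2) ->
  is_derive f x l.
Proof.
intros Q; split.
- apply (is_linear_scal_l (K := R_AbsRing)).
- intros z Hz; apply (is_filter_lim_locally_unique (V := R_NormedModule)) in Hz; subst z.
  intros eps.
  assert (Hc : 0 < Rabs C + 1) by (pose proof (Rabs_pos C); lra).
  assert (Hd : 0 < eps / (Rabs C + 1)) by (apply Rdiv_lt_0_compat; [apply cond_pos | lra]).
  exists (mkposreal _ Hd); intros y Hy.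
  change (Rabs (y - x) < eps / (Rabs C + 1)) in Hy.
  apply Rle_trans with (1 := Q y).
  change (norm (minus y x)) with (Rabs (y - x)).
  rewrite <- (pow2_abs (y - x)).
  apply Rmult_lt_compat_r with (r := Rabs C + 1) in Hy; [|lra].
  replace (eps / (Rabs C + 1) * (Rabs C + 1)) with (pos eps) in Hy by (field; lra).
  pose proof (Rabs_pos (y - x)); pose proof (Rle_abs C); nra.
Qed.

(** Cutting [0, 1] into [n] equal pieces bounds the total increment by [C / n]. *)
Lemma const_of_quadratic (K : AbsRing) (V : NormedModule K) (X : R -> V) (C : R) :
  (forall s s', 0 <= s <= 1 -> 0 <= s' <= 1 -> norm (minus (X s') (X s)) <= C * (s' - s) ^ 2) ->
  X 1 = X 0.
Proof.
intros Q.
assert (P : forall n k : nat, (0 < n)%nat -> (k <= n)%nat ->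
   norm (minus (X (INR k / INR n)) (X 0)) <= INR k * (C / INR n ^ 2)).
{ intros n k Hn; assert (Hn' : 0 < INR n) by now apply lt_0_INR.
  induction k as [|k IH]; intros Hk.
  - replace (INR 0 / INR n) with 0 by (simpl; field; lra).
    replace (norm (minus (X 0) (X 0))) with 0
      by (rewrite minus_eq_zero; symmetry; exact (norm_zero (V := V))).
    simpl; lra.
  - rewrite (minus_trans (X (INR k / INR n))).
    apply Rle_trans with (1 := norm_triangle _ _).
    assert (Hi : forall j, (j <= n)%nat -> 0 <= INR j / INR n <= 1).
    { intros j Hj; apply le_INR in Hj; pose proof (pos_INR j); split.
      - apply Rmult_le_pos; [assumption | now apply Rlt_le, Rinv_0_lt_compat].
      - apply Rmult_le_reg_r with (INR n); [assumption|].
        unfold Rdiv; rewrite Rmult_assoc, Rinv_l; lra. }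
    pose proof (Q _ _ (Hi k ltac:(lia)) (Hi (S k) Hk)) as Qk.
    replace (INR (S k) / INR n - INR k / INR n) with (/ INR n) in Qk
      by (rewrite S_INR; field; lra).
    replace (C * (/ INR n) ^ 2) with (C / INR n ^ 2) in Qk by (field; lra).
    pose proof (IH ltac:(lia)).
    apply Rle_trans with (INR k * (C / INR n ^ 2) + C / INR n ^ 2); [lra|].
    rewrite (S_INR k); lra. }
assert (Z : norm (minus (X 1) (X 0)) <= 0).
{ apply le_epsilon; intros eps He; rewrite Rplus_0_l.
  destruct (archimed_cor1 (eps / (Rabs C + 1))) as [n [Hn Hn0]].
  { apply Rdiv_lt_0_compat; [assumption|]; pose proof (Rabs_pos C); lra. }
  assert (Hn' : 0 < INR n) by now apply lt_0_INR.
  pose proof (P n n Hn0 (le_n n)) as Pn.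
  replace (INR n / INR n) with 1 in Pn by (field; lra).
  replace (INR n * (C / INR n ^ 2)) with (C * / INR n) in Pn by (field; lra).
  apply Rle_trans with (1 := Pn).
  pose proof (Rle_abs C); pose proof (Rabs_pos C); pose proof (Rinv_0_lt_compat _ Hn').
  apply Rle_trans with ((Rabs C + 1) * / INR n); [nra|].
  apply Rmult_lt_compat_l with (r := Rabs C + 1) in Hn; [|lra].
  replace ((Rabs C + 1) * (eps / (Rabs C + 1))) with eps in Hn by (field; lra); lra. }
assert (Z0 : minus (X 1) (X 0) = zero).
{ apply norm_eq_zero; pose proof (norm_ge_0 (minus (X 1) (X 0))); lra. }
rewrite <- (plus_minus _ (X 1) (X 0)), Z0; apply plus_zero_r.
Qed.

(** * The circle and its winding numbers *)

Lemma Cmod_le_abs (z : C) : Cmod z <= Rabs (Re z) + Rabs (Im z).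
Proof.
replace z with (RtoC (Re z) + Ci * RtoC (Im z))%C at 1.
- apply Rle_trans with (1 := Cmod_triangle _ _).
  rewrite Cmod_mult, Cmod_Ci, !Cmod_R; lra.
- destruct z as [x y]; apply injective_projections; simpl; ring.
Qed.

(** A closed curve in the right half-plane does not wind around 0, because
    the principal logarithm is a primitive of [dF / F] there. *)
Lemma log_integral (X Y dX dY : R -> R) :
  (forall t, is_derive X t (dX t)) -> (forall t, is_derive Y t (dY t)) ->
  (forall t, continuous dX t) -> (forall t, continuous dY t) ->
  (forall t, 0 < X t) -> X 1 = X 0 -> Y 1 = Y 0 ->
  is_RInt (V := restr_NormedModule C_NormedModule)
    (fun t => ((dX t, dY t) / (X t, Y t))%C) 0 1 (RtoC 0).
Proof.
intros DX DY CX CY PX EX EY.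
assert (P2 : forall t, 0 < X t * X t + Y t * Y t).
{ intros t; pose proof (PX t); pose proof (Rle_0_sqr (Y t)); unfold Rsqr in *; nra. }
assert (cX : forall t, continuous X t).
{ intros t; apply (ex_derive_continuous (V := R_NormedModule)); now exists (dX t). }
assert (cY : forall t, continuous Y t).
{ intros t; apply (ex_derive_continuous (V := R_NormedModule)); now exists (dY t). }
assert (cN : forall t, continuous (fun t => / (X t * X t + Y t * Y t)) t).
{ intros t; apply continuous_Rinv_comp; [|pose proof (P2 t); lra].
  apply (continuous_plus (V := R_NormedModule));
    apply (continuous_mult (K := R_AbsRing)); auto. }
assert (I1 : is_RInt (fun t => (X t * dX t + Y t * dY t) * / (X t * X t + Y t * Y t)) 0 1 0).
{ replace 0 with (minus (/ 2 * ln (X 1 * X 1 + Y 1 * Y 1)) (/ 2 * ln (X 0 * X 0 + Y 0 * Y 0))) at 2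
    by (rewrite EX, EY; apply (minus_eq_zero (G := R_AbelianGroup))).
  apply (is_RInt_derive (V := R_CompleteNormedModule) (fun t => / 2 * ln (X t * X t + Y t * Y t))).
  - intros t _.
    evar_last.
    + apply is_derive_scal, (is_derive_comp ln).
      * apply is_derive_ln, P2.
      * apply (is_derive_plus (V := R_NormedModule)); apply (is_derive_mult (K := R_AbsRing)); auto;
          intros; apply Rmult_comm.
    + unfold plus, scal, mult; simpl; unfold mult; simpl; pose proof (P2 t); field; lra.
  - intros t _; apply (continuous_mult (K := R_AbsRing)); [|auto].
    apply (continuous_plus (V := R_NormedModule));
      apply (continuous_mult (K := R_AbsRing)); auto. }
assert (I2 : is_RInt (fun t => (X t * dY t - Y t * dX t) * / (X t * X t + Y t * Y t)) 0 1 0).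
{ replace 0 with (minus (atan (Y 1 * / X 1)) (atan (Y 0 * / X 0))) at 2
    by (rewrite EX, EY; apply (minus_eq_zero (G := R_AbelianGroup))).
  apply (is_RInt_derive (V := R_CompleteNormedModule) (fun t => atan (Y t * / X t))).
  - intros t _; pose proof (PX t); pose proof (P2 t).
    evar_last.
    + apply (is_derive_comp atan).
      * apply is_derive_atan.
      * apply (is_derive_mult (K := R_AbsRing)); [auto | | intros; apply Rmult_comm].
        apply is_derive_inv; [auto | lra].
    + unfold plus, scal, mult, opp; simpl; unfold mult; simpl; unfold Rsqr.
      field; repeat split; nra.
  - intros t _; apply (continuous_mult (K := R_AbsRing)); [|auto].
    apply (continuous_minus (V := R_NormedModule));
      apply (continuous_mult (K := R_AbsRing)); auto. }
apply (is_RInt_real_scal C_NormedModule _ _ _ _ (RtoC 1)) in I1.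
apply (is_RInt_real_scal C_NormedModule _ _ _ _ Ci) in I2.
pose proof (is_RInt_plus (V := restr_NormedModule C_NormedModule) _ _ _ _ _ _ I1 I2) as I3.
apply is_RInt_ext with (2 := eq_ind _ (is_RInt (V := restr_NormedModule C_NormedModule) _ 0 1) I3 (RtoC 0)
   ltac:(apply injective_projections; simpl; ring)).
intros t _; pose proof (P2 t).
apply injective_projections; simpl; field; lra.
Qed.

Section Circle.

Variables a rho : R.
Hypothesis rho_pos : 0 < rho.
Hypothesis rho_lt : rho < a.

Definition circ (t : R) : C := (a + rho * cos (2 * PI * t), rho * sin (2 * PI * t)).
Definition dcirc (t : R) : C := (- (rho * (2 * PI) * sin (2 * PI * t)), rho * (2 * PI) * cos (2 * PI * t)).

Lemma cos_sin_1 x : cos x * cos x + sin x * sin x = 1.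
Proof. pose proof (sin2_cos2 x) as E; unfold Rsqr in E; lra. Qed.

Lemma circ_Re_pos t : 0 < Re (circ t).
Proof. simpl; pose proof (COS_bound (2 * PI * t)); nra. Qed.

Lemma circ_mod t : Cmod (circ t - RtoC a) = rho.
Proof.
unfold Cmod, circ; simpl.
pose proof (cos_sin_1 (2 * PI * t)).
match goal with |- sqrt ?e = _ => replace e with (rho * rho) by nra end.
apply sqrt_square; lra.
Qed.

Lemma circ_closed : circ 1 = circ 0.
Proof.
unfold circ; rewrite Rmult_1_r, Rmult_0_r, cos_2PI, sin_2PI, cos_0, sin_0; reflexivity.
Qed.

Lemma winding_outside (z : C) : 0 < Re z ->
  is_RInt (V := restr_NormedModule C_NormedModule)
    (fun t => (dcirc t / (circ t + z))%C) 0 1 (RtoC 0).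
Proof.
intros Hz.
apply (log_integral (fun t => a + rho * cos (2 * PI * t) + Re z) (fun t => rho * sin (2 * PI * t) + Im z)
  (fun t => - (rho * (2 * PI) * sin (2 * PI * t))) (fun t => rho * (2 * PI) * cos (2 * PI * t))).
- intros t; auto_derive; [easy|ring].
- intros t; auto_derive; [easy|ring].
- intros t; apply (ex_derive_continuous (V := R_NormedModule)); auto_derive; easy.
- intros t; apply (ex_derive_continuous (V := R_NormedModule)); auto_derive; easy.
- intros t; pose proof (circ_Re_pos t); simpl in *; lra.
- now rewrite Rmult_1_r, Rmult_0_r, cos_2PI, cos_0.
- now rewrite Rmult_1_r, Rmult_0_r, sin_2PI, sin_0.
Qed.

(** Write [circ t - z = rho e (1 - q / e)] with [e = exp (2 pi i t)]; the factor
    [1 - q / e] stays in the right half-plane and only [e] winds. *)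
Lemma winding_inside (z : C) : Cmod (z - RtoC a) < rho ->
  is_RInt (V := restr_NormedModule C_NormedModule)
    (fun t => (dcirc t / (circ t - z))%C) 0 1 two_pi_i.
Proof.
intros Hz.
set (q1 := (Re z - a) / rho); set (q2 := Im z / rho).
assert (Hq : q1 * q1 + q2 * q2 < 1).
{ apply Rmult_lt_reg_r with (rho * rho); [nra|].
  replace ((q1 * q1 + q2 * q2) * (rho * rho)) with (Cmod (z - RtoC a) ^ 2).
  - pose proof (Cmod_ge_0 (z - RtoC a)); nra.
  - rewrite Cmod2_alt; unfold q1, q2; unfold Re, Im; simpl; field; lra. }
set (F := fun t => (1 - (q1 * cos (2 * PI * t) + q2 * sin (2 * PI * t)),
                    q1 * sin (2 * PI * t) - q2 * cos (2 * PI * t)) : C).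
set (dF := fun t => (2 * PI * (q1 * sin (2 * PI * t) - q2 * cos (2 * PI * t)),
                     2 * PI * (q1 * cos (2 * PI * t) + q2 * sin (2 * PI * t))) : C).
assert (PF : forall t, 0 < Re (F t)).
{ intros t; unfold F; simpl; pose proof (cos_sin_1 (2 * PI * t)) as E.
  set (c := cos _) in *; set (s := sin _) in *.
  pose proof (Rle_0_sqr (q1 - c)); pose proof (Rle_0_sqr (q2 - s)); unfold Rsqr in *; nra. }
assert (IF : is_RInt (V := restr_NormedModule C_NormedModule) (fun t => (dF t / F t)%C) 0 1 (RtoC 0)).
{ apply (log_integral (fun t => Re (F t)) (fun t => Im (F t)) (fun t => Re (dF t)) (fun t => Im (dF t)));
    try assumption; unfold F, dF; simpl.
  - intros t; auto_derive; [easy|ring].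
  - intros t; auto_derive; [easy|ring].
  - intros t; apply (ex_derive_continuous (V := R_NormedModule)); auto_derive; easy.
  - intros t; apply (ex_derive_continuous (V := R_NormedModule)); auto_derive; easy.
  - now rewrite Rmult_1_r, Rmult_0_r, sin_2PI, sin_0, cos_2PI, cos_0.
  - now rewrite Rmult_1_r, Rmult_0_r, sin_2PI, sin_0, cos_2PI, cos_0. }
pose proof (is_RInt_real_scal C_NormedModule (fun _ => 1) 0 1 1 two_pi_i) as I1.
assert (I0 : is_RInt (fun _ : R => 1) 0 1 1).
{ evar_last; [apply (is_RInt_const (V := R_NormedModule))|].
  unfold scal; simpl; unfold mult; simpl; ring. }
specialize (I1 I0).
pose proof (is_RInt_plus (V := restr_NormedModule C_NormedModule) _ _ _ _ _ _ I1 IF) as I3.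
apply is_RInt_ext with (2 := eq_ind _ (is_RInt (V := restr_NormedModule C_NormedModule) _ 0 1) I3 two_pi_i
   ltac:(apply injective_projections; simpl; ring)).
intros t _.
set (e := (cos (2 * PI * t), sin (2 * PI * t)) : C).
assert (E1 : (circ t - z = RtoC rho * e * F t)%C).
{ unfold circ, e, F; pose proof (cos_sin_1 (2 * PI * t)) as E.
  set (c := cos _) in *; set (s := sin _) in *.
  apply injective_projections; simpl; unfold q1, q2, Re, Im.
  - transitivity (a + rho * c + - fst z + (1 - (c * c + s * s)) * (fst z - a)); [rewrite E; ring | field; lra].
  - transitivity (rho * s + - snd z + (1 - (c * c + s * s)) * (snd z)); [rewrite E; ring | field; lra]. }
assert (E2 : (dcirc t = two_pi_i * (RtoC rho * e))%C).
{ unfold dcirc, two_pi_i, e; apply injective_projections; simpl; ring. }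
assert (E3 : (dF t = two_pi_i * (RtoC 1 - F t))%C).
{ unfold dF, F, two_pi_i; apply injective_projections; simpl; ring. }
assert (NF : F t <> RtoC 0).
{ intros Z; pose proof (PF t) as P; rewrite Z in P; simpl in P; lra. }
assert (Ne : e <> RtoC 0).
{ intros Z; pose proof (cos_sin_1 (2 * PI * t)) as E; injection Z as Zc Zs.
  rewrite Zc, Zs in E; lra. }
assert (Nr : RtoC rho <> RtoC 0) by (intros Z; apply RtoC_inj in Z; lra).
rewrite E1, E2, E3.
change (RtoC 1 * two_pi_i + two_pi_i * (RtoC 1 - F t) / F t
  = two_pi_i * (RtoC rho * e) / (RtoC rho * e * F t))%C.
field; auto.
Qed.

Lemma cos_lip x y : Rabs (cos y - cos x) <= Rabs (y - x).
Proof.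
rewrite <- (Rmult_1_l (Rabs (y - x))).
apply (bounded_variation cos (fun t => - sin t)); intros t _; split.
- auto_derive; [easy|ring].
- rewrite Rabs_Ropp; apply Rabs_le; pose proof (SIN_bound t); lra.
Qed.

Lemma sin_lip x y : Rabs (sin y - sin x) <= Rabs (y - x).
Proof.
rewrite <- (Rmult_1_l (Rabs (y - x))).
apply (bounded_variation sin cos); intros t _; split.
- auto_derive; [easy|ring].
- apply Rabs_le; pose proof (COS_bound t); lra.
Qed.

Lemma cos_taylor x y : Rabs (cos y - cos x + (y - x) * sin x) <= (y - x) ^ 2.
Proof.
replace (cos y - cos x + (y - x) * sin x)
  with ((cos y + y * sin x) - (cos x + x * sin x)) by ring.
rewrite <- pow2_abs; simpl; rewrite Rmult_1_r.
apply (bounded_variation (fun t => cos t + t * sin x) (fun t => - sin t + sin x)); intros t Ht; split.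
- auto_derive; [easy|ring].
- replace (- sin t + sin x) with (- (sin t - sin x)) by ring; rewrite Rabs_Ropp.
  apply Rle_trans with (1 := sin_lip x t); exact Ht.
Qed.

Lemma sin_taylor x y : Rabs (sin y - sin x - (y - x) * cos x) <= (y - x) ^ 2.
Proof.
replace (sin y - sin x - (y - x) * cos x)
  with ((sin y - y * cos x) - (sin x - x * cos x)) by ring.
rewrite <- pow2_abs; simpl; rewrite Rmult_1_r.
apply (bounded_variation (fun t => sin t - t * cos x) (fun t => cos t - cos x)); intros t Ht; split.
- auto_derive; [easy|ring].
- apply Rle_trans with (1 := cos_lip x t); exact Ht.
Qed.

Lemma circ_lip t t' : Cmod (circ t' - circ t) <= 4 * PI * rho * Rabs (t' - t).
Proof.
apply Rle_trans with (1 := Cmod_le_abs _); unfold circ; simpl.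
pose proof (cos_lip (2 * PI * t) (2 * PI * t')) as C.
pose proof (sin_lip (2 * PI * t) (2 * PI * t')) as S.
replace (2 * PI * t' - 2 * PI * t) with (2 * PI * (t' - t)) in * by ring.
pose proof PI_RGT_0.
rewrite (Rabs_mult (2 * PI)), (Rabs_pos_eq (2 * PI)) in C, S by lra.
replace (a + rho * cos (2 * PI * t') + - (a + rho * cos (2 * PI * t)))
  with (rho * (cos (2 * PI * t') - cos (2 * PI * t))) by ring.
replace (rho * sin (2 * PI * t') + - (rho * sin (2 * PI * t)))
  with (rho * (sin (2 * PI * t') - sin (2 * PI * t))) by ring.
rewrite !Rabs_mult, (Rabs_pos_eq rho) by lra; nra.
Qed.

Lemma dcirc_lip t t' : Cmod (dcirc t' - dcirc t) <= 8 * PI ^ 2 * rho * Rabs (t' - t).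
Proof.
apply Rle_trans with (1 := Cmod_le_abs _); unfold dcirc; simpl.
pose proof (cos_lip (2 * PI * t) (2 * PI * t')) as C.
pose proof (sin_lip (2 * PI * t) (2 * PI * t')) as S.
replace (2 * PI * t' - 2 * PI * t) with (2 * PI * (t' - t)) in * by ring.
pose proof PI_RGT_0.
rewrite (Rabs_mult (2 * PI)), (Rabs_pos_eq (2 * PI)) in C, S by lra.
replace (- (rho * (2 * PI) * sin (2 * PI * t')) + - - (rho * (2 * PI) * sin (2 * PI * t)))
  with (- (rho * (2 * PI) * (sin (2 * PI * t') - sin (2 * PI * t)))) by ring.
replace (rho * (2 * PI) * cos (2 * PI * t') + - (rho * (2 * PI) * cos (2 * PI * t)))
  with (rho * (2 * PI) * (cos (2 * PI * t') - cos (2 * PI * t))) by ring.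
assert (0 < rho * (2 * PI)) by nra.
rewrite Rabs_Ropp, !(Rabs_mult (rho * (2 * PI))), (Rabs_pos_eq (rho * (2 * PI))) by lra.
apply Rle_trans with (rho * (2 * PI) * (2 * PI * Rabs (t' - t)) + rho * (2 * PI) * (2 * PI * Rabs (t' - t)));
  [apply Rplus_le_compat; apply Rmult_le_compat_l; lra | apply Req_le; ring].
Qed.

Lemma dcirc_bound t : Cmod (dcirc t) <= 4 * PI * rho.
Proof.
apply Rle_trans with (1 := Cmod_le_abs _); unfold dcirc; simpl; pose proof PI_RGT_0.
assert (0 < rho * (2 * PI)) by nra.
rewrite Rabs_Ropp, !(Rabs_mult (rho * (2 * PI))), (Rabs_pos_eq (rho * (2 * PI))) by lra.
assert (Rabs (sin (2 * PI * t)) <= 1) by (apply Rabs_le; pose proof (SIN_bound (2 * PI * t)); lra).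
assert (Rabs (cos (2 * PI * t)) <= 1) by (apply Rabs_le; pose proof (COS_bound (2 * PI * t)); lra).
apply Rle_trans with (rho * (2 * PI) * 1 + rho * (2 * PI) * 1);
  [apply Rplus_le_compat; apply Rmult_le_compat_l; lra | apply Req_le; ring].
Qed.

Lemma circ_taylor t t' :
  Cmod (circ t' - circ t - RtoC (t' - t) * dcirc t) <= 8 * PI ^ 2 * rho * (t' - t) ^ 2.
Proof.
apply Rle_trans with (1 := Cmod_le_abs _); unfold circ, dcirc; simpl.
pose proof (cos_taylor (2 * PI * t) (2 * PI * t')) as C.
pose proof (sin_taylor (2 * PI * t) (2 * PI * t')) as S.
replace (2 * PI * t' - 2 * PI * t) with (2 * PI * (t' - t)) in * by ring.
match goal with |- Rabs ?x + Rabs ?y <= _ =>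
  replace x with (rho * (cos (2 * PI * t') - cos (2 * PI * t) + 2 * PI * (t' - t) * sin (2 * PI * t))) by ring;
  replace y with (rho * (sin (2 * PI * t') - sin (2 * PI * t) - 2 * PI * (t' - t) * cos (2 * PI * t))) by ring
end.
rewrite !(Rabs_mult rho), (Rabs_pos_eq rho) by lra.
apply Rle_trans with (rho * (2 * PI * (t' - t)) ^ 2 + rho * (2 * PI * (t' - t)) ^ 2);
  [apply Rplus_le_compat; apply Rmult_le_compat_l; lra | apply Req_le; ring].
Qed.

Lemma circ_bound t : Cmod (circ t) <= 2 * a.
Proof.
replace (circ t) with (circ t - RtoC a + RtoC a)%C by ring.
apply Rle_trans with (1 := Cmod_triangle _ _).
rewrite circ_mod, Cmod_R, Rabs_pos_eq; lra.
Qed.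

End Circle.

(** * Identities between commuting operators *)

Section Bicommutant.

Variable H : HilbertSpace.
Variable B : bounded_op H.
Notation I := (op_id H).

(** The bicommutant of [B]. It is commutative, and it contains everything that is built
    from [B] below, the contour integrals included. *)
Definition bicomm (X : bounded_op H) : Prop :=
  forall Y, (Y * B = B * Y)%op -> (Y * X = X * Y)%op.

Lemma bicomm_self : bicomm B.
Proof. now intros Y HY. Qed.

Lemma bicomm_id : bicomm I.
Proof. intros Y _; now rewrite op_mult_id_l, op_mult_id_r. Qed.

Lemma bicomm_zero : bicomm (op_zero H).
Proof. intros Y _; non_commutative_ring. Qed.

Lemma bicomm_plus X X' : bicomm X -> bicomm X' -> bicomm (X + X')%op.
Proof. intros E E' Y HY; now rewrite op_mult_plus_l, op_mult_plus_r, E, E'. Qed.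

Lemma bicomm_scal (c : C) X : bicomm X -> bicomm (c *: X)%op.
Proof. intros E Y HY; now rewrite op_scal_mult_l, op_scal_mult_r, E. Qed.

Lemma bicomm_opp X : bicomm X -> bicomm (- X)%op.
Proof. intros E; rewrite op_scal_opp_one; now apply bicomm_scal. Qed.

Lemma bicomm_mult X X' : bicomm X -> bicomm X' -> bicomm (X * X')%op.
Proof.
intros E E' Y HY.
now rewrite op_mult_assoc, E, <- op_mult_assoc, E', op_mult_assoc.
Qed.

Lemma bicomm_inverse X Y : is_inverse X Y -> bicomm X -> bicomm Y.
Proof.
intros EI E Z HZ; symmetry; apply inverse_commute with X; [exact EI|].
symmetry; now apply E.
Qed.

Lemma bicomm_comm X Y : bicomm X -> bicomm Y -> (X * Y = Y * X)%op.
Proof. intros EX EY; apply EY; symmetry; now apply EX. Qed.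

(** The bicommutant as a commutative ring, so that [ring] proves identities in it. *)
Definition calg := {X : bounded_op H | bicomm X}.

Lemma calg_eq (x y : calg) : proj1_sig x = proj1_sig y -> x = y.
Proof.
destruct x as [x px], y as [y py]; simpl; intros E; subst y.
f_equal; apply proof_irrelevance.
Qed.

Definition calg_zero : calg := exist _ _ bicomm_zero.
Definition calg_one : calg := exist _ _ bicomm_id.
Definition calg_add (x y : calg) : calg := exist _ _ (bicomm_plus _ _ (proj2_sig x) (proj2_sig y)).
Definition calg_mul (x y : calg) : calg := exist _ _ (bicomm_mult _ _ (proj2_sig x) (proj2_sig y)).
Definition calg_opp (x : calg) : calg := exist _ _ (bicomm_opp _ (proj2_sig x)).
Definition calg_sub (x y : calg) : calg := calg_add x (calg_opp y).

Lemma calg_ring : ring_theory calg_zero calg_one calg_add calg_mul calg_sub calg_opp eq.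
Proof.
split; intros; apply calg_eq; simpl.
- non_commutative_ring.
- apply op_plus_comm.
- apply op_plus_assoc.
- apply op_mult_id_l.
- apply bicomm_comm; apply proj2_sig.
- apply op_mult_assoc.
- apply op_mult_plus_l.
- reflexivity.
- apply op_plus_opp_r.
Qed.

Add Ring calg_ring : calg_ring.

(** With [u = (1 - x) t + e], the terms of [b (1 + 2x) u^2] of first order in [x] cancel:
    [(1 + 2x) (1 - x)^2 = 1 - 3x^2 + 2x^3]. *)
Lemma commuting_const_identity (b x t e : bounded_op H) :
  bicomm b -> bicomm x -> bicomm t -> bicomm e ->
  (b * (I + (x + x)) * ((t - x * t + e) * (t - x * t + e)) - b * (t * t)
   = b * (x * x * (x + x - (I + I + I)) * (t * t)
       + (I + (x + x)) * (e * (t - x * t + (t - x * t) + e))))%op.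
Proof.
intros pb px pt pe.
assert (Id : forall b x t e : calg,
  calg_sub (calg_mul (calg_mul b (calg_add calg_one (calg_add x x)))
     (calg_mul (calg_add (calg_sub t (calg_mul x t)) e) (calg_add (calg_sub t (calg_mul x t)) e))) (calg_mul b (calg_mul t t))
  = calg_mul b (calg_add (calg_mul (calg_mul (calg_mul x x) (calg_sub (calg_add x x) (calg_add (calg_add calg_one calg_one) calg_one))) (calg_mul t t))
      (calg_mul (calg_add calg_one (calg_add x x))
        (calg_mul e (calg_add (calg_add (calg_sub t (calg_mul x t)) (calg_sub t (calg_mul x t))) e))))).
{ intros; ring. }
exact (f_equal (@proj1_sig _ _)
  (Id (exist _ b pb) (exist _ x px) (exist _ t pt) (exist _ e pe))).
Qed.

(** Let [r] and [s] be the inverses of [p^2 - b] and [q^2 - b]. The derivative of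
    [q (q^2 - b)^{-1}] with respect to the scalar [q] is [s - 2 q^2 s^2 = - (s + 2 b s^2)].
    The right-hand side displays the remainder of the first order expansion as a sum of
    terms that are of second order when [d] approximates [p - q]. *)
Lemma commuting_derivative_identity (b p q r s d : bounded_op H) :
  bicomm b -> bicomm p -> bicomm q -> bicomm r -> bicomm s -> bicomm d ->
  ((p * p - b) * r = I)%op -> ((q * q - b) * s = I)%op ->
  (p * r - q * s - d * (- (s + (b * (s * s) + b * (s * s))))
   = (p - q - d) * (s - (q * q * (s * s) + q * q * (s * s)))
     + (p - q) * (r - s - q * ((p - q) * (r * s) + (q * ((r - s) * s) + q * ((r - s) * s)))))%op.
Proof.
intros pb pp pq pr ps pd er es.
assert (Id : forall b p q r s d : calg,
  calg_mul (calg_sub (calg_mul p p) b) r = calg_one -> calg_mul (calg_sub (calg_mul q q) b) s = calg_one ->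
  calg_sub (calg_sub (calg_mul p r) (calg_mul q s))
    (calg_mul d (calg_opp (calg_add s (calg_add (calg_mul b (calg_mul s s)) (calg_mul b (calg_mul s s))))))
  = calg_add (calg_mul (calg_sub (calg_sub p q) d)
            (calg_sub s (calg_add (calg_mul (calg_mul q q) (calg_mul s s)) (calg_mul (calg_mul q q) (calg_mul s s)))))
      (calg_mul (calg_sub p q)
        (calg_sub (calg_sub r s)
          (calg_mul q (calg_add (calg_mul (calg_sub p q) (calg_mul r s))
             (calg_add (calg_mul q (calg_mul (calg_sub r s) s)) (calg_mul q (calg_mul (calg_sub r s) s)))))))).
{ clear; intros b p q r s d er es.
  assert (e1 : calg_sub r s = calg_mul (calg_mul r s) (calg_sub (calg_mul q q) (calg_mul p p))).
  { transitivity (calg_sub (calg_mul r (calg_mul (calg_sub (calg_mul q q) b) s)) (calg_mul s (calg_mul (calg_sub (calg_mul p p) b) r))).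
    - rewrite er, es; ring.
    - ring. }
  assert (e2 : calg_mul b s = calg_sub (calg_mul (calg_mul q q) s) calg_one) by (rewrite <- es; ring).
  transitivity (calg_sub (calg_sub (calg_mul p r) (calg_mul q s))
    (calg_mul d (calg_opp (calg_add s (calg_add (calg_mul (calg_mul b s) s) (calg_mul (calg_mul b s) s)))))); [ring|].
  rewrite e2.
  match goal with |- ?l = ?r' =>
    transitivity (calg_add r' (calg_mul q (calg_sub (calg_sub r s) (calg_mul (calg_mul r s) (calg_sub (calg_mul q q) (calg_mul p p))))))
  end; [ring|].
  assert (e3 : calg_sub (calg_sub r s) (calg_mul (calg_mul r s) (calg_sub (calg_mul q q) (calg_mul p p))) = calg_zero)
    by (rewrite e1; ring).
  rewrite e3; ring. }
exact (f_equal (@proj1_sig _ _)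
  (Id (exist _ b pb) (exist _ p pp) (exist _ q pq) (exist _ r pr) (exist _ s ps) (exist _ d pd)
    (calg_eq (calg_mul (calg_sub (calg_mul (exist _ p pp) (exist _ p pp)) (exist _ b pb)) (exist _ r pr)) calg_one er)
    (calg_eq (calg_mul (calg_sub (calg_mul (exist _ q pq) (exist _ q pq)) (exist _ b pb)) (exist _ s ps)) calg_one es))).
Qed.

(** The hypothesis is the resolvent identity; it is used twice. *)
Lemma commuting_resolvent_identity (c r s : bounded_op H) :
  bicomm c -> bicomm r -> bicomm s -> (r - s = c * (r * s))%op ->
  (r - s - c * (s * s) = c * c * (r * (s * s)))%op.
Proof.
intros pc pr ps E.
assert (Id : forall c r s : calg, calg_sub r s = calg_mul c (calg_mul r s) ->
  calg_sub (calg_sub r s) (calg_mul c (calg_mul s s)) = calg_mul (calg_mul c c) (calg_mul r (calg_mul s s))).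
{ clear; intros c r s E.
  rewrite E; transitivity (calg_mul c (calg_mul s (calg_sub r s))); [ring|].
  rewrite E; ring. }
exact (f_equal (@proj1_sig _ _) (Id (exist _ c pc) (exist _ r pr) (exist _ s ps)
  (calg_eq (calg_sub (exist _ r pr) (exist _ s ps))
     (calg_mul (exist _ c pc) (calg_mul (exist _ r pr) (exist _ s ps))) E))).
Qed.

End Bicommutant.

(** * Contour integrals of the resolvent *)

Section Bounds.

Variable H : HilbertSpace.
Notation I := (op_id H).
Implicit Types A B X Y : bounded_op H.

Lemma le_norm_plus A B p q : op_norm A <= p -> op_norm B <= q -> op_norm (A + B) <= p + q.
Proof. intros; apply Rle_trans with (1 := op_norm_plus _ _); lra. Qed.

Lemma le_norm_opp A p : op_norm A <= p -> op_norm (- A) <= p.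
Proof. now rewrite op_norm_opp. Qed.

Lemma le_norm_mult A B p q : op_norm A <= p -> op_norm B <= q -> op_norm (A * B) <= p * q.
Proof.
intros; apply Rle_trans with (1 := op_norm_mult _ _ _).
apply Rmult_le_compat; auto using op_norm_ge_0.
Qed.

Lemma le_norm_scal c A p q : Cmod c <= p -> op_norm A <= q -> op_norm (c *: A) <= p * q.
Proof.
intros; apply Rle_trans with (1 := op_norm_scal _ _).
apply Rmult_le_compat; auto using op_norm_ge_0, Cmod_ge_0.
Qed.

Lemma le_norm_scalar c p : Cmod c <= p -> op_norm (c *: I) <= p.
Proof. intros; rewrite <- (Rmult_1_r p); apply le_norm_scal; auto using op_norm_id. Qed.

Lemma op_scalar_mult (c d : C) : ((c * d)%C *: I = (c *: I) * (d *: I))%op.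
Proof. now rewrite op_scal_mult_l, op_mult_id_l, op_scal_assoc. Qed.

Lemma op_scalar_minus (c d : C) : ((c - d)%C *: I = (c *: I) - (d *: I))%op.
Proof.
unfold Cminus; rewrite op_scal_distr_r; f_equal.
replace (- d)%C with (- RtoC 1 * d)%C by ring.
now rewrite <- op_scal_assoc, <- op_scal_opp_one.
Qed.

Lemma op_scalar_left (c : C) A : (c *: A = (c *: I) * A)%op.
Proof. now rewrite op_scal_mult_l, op_mult_id_l. Qed.

Lemma op_scal_opp (c : C) A : (c *: (- A) = - (c *: A))%op.
Proof. exact (scal_opp_r (V := bounded_op_ModuleSpace H) c A). Qed.

Lemma op_scal_minus (c : C) A B : (c *: (A - B) = c *: A - c *: B)%op.
Proof. now rewrite op_scal_distr_l, op_scal_opp. Qed.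

Lemma inverse_diff X X' Y Y' : is_inverse X Y -> is_inverse X' Y' ->
  (Y' - Y = Y' * (X - X') * Y)%op.
Proof.
intros [E _] [_ E'].
transitivity (Y' * (X * Y) - Y' * X' * Y)%op.
- now rewrite E, E', op_mult_id_r, op_mult_id_l.
- non_commutative_ring.
Qed.

Lemma continuous_of_lipschitz (V : NormedModule R_AbsRing) (f : R -> V) (C x : R) :
  (forall y, norm (minus (f y) (f x)) <= C * Rabs (y - x)) -> continuous f x.
Proof.
intros L P HP.
destruct (locally_norm_le_locally (V := V) _ _ HP) as [eps He].
assert (Hc : 0 < Rabs C + 1) by (pose proof (Rabs_pos C); lra).
assert (Hd : 0 < eps / (Rabs C + 1)) by (apply Rdiv_lt_0_compat; [apply cond_pos | lra]).
exists (mkposreal _ Hd); intros y Hy.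
change (Rabs (y - x) < eps / (Rabs C + 1)) in Hy.
apply He, Rle_lt_trans with (1 := L y).
apply Rmult_lt_compat_r with (r := Rabs C + 1) in Hy; [|lra].
replace (eps / (Rabs C + 1) * (Rabs C + 1)) with (pos eps) in Hy by (field; lra).
pose proof (Rabs_pos (y - x)); pose proof (Rle_abs C); nra.
Qed.

(** Boundedness is part of the notion because products of unbounded Lipschitz functions
    need not be Lipschitz. *)
Definition lip (F : R -> bounded_op H) : Prop :=
  exists m, 0 <= m /\ forall t t', op_norm (F t) <= m /\ op_norm (F t' - F t) <= m * Rabs (t' - t).

Lemma lip_continuous F : lip F ->
  forall t, continuous (U := restr_NormedModule (bounded_op_NormedModule H)) F t.
Proof.
intros [m [_ Hm]] t.
apply (continuous_of_lipschitz (restr_NormedModule (bounded_op_NormedModule H)) F m).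
intros y; apply Hm.
Qed.

Lemma lip_const A : lip (fun _ => A).
Proof.
exists (op_norm A); split; [apply op_norm_ge_0|]; intros t t'; split; [lra|].
rewrite op_plus_opp_r, op_norm_zero; apply Rmult_le_pos; [apply op_norm_ge_0 | apply Rabs_pos].
Qed.

Lemma lip_plus F G : lip F -> lip G -> lip (fun t => F t + G t)%op.
Proof.
intros [m [Hm HF]] [n [Hn HG]]; exists (m + n); split; [lra|]; intros t t'.
destruct (HF t t') as [F1 F2]; destruct (HG t t') as [G1 G2]; split.
- now apply le_norm_plus.
- replace (F t' + G t' - (F t + G t))%op with (F t' - F t + (G t' - G t))%op
    by non_commutative_ring.
  rewrite Rmult_plus_distr_r; now apply le_norm_plus.
Qed.

Lemma lip_mult F G : lip F -> lip G -> lip (fun t => F t * G t)%op.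
Proof.
intros [m [Hm HF]] [n [Hn HG]]; exists (2 * (m * n)); split; [nra|]; intros t t'.
destruct (HF t t') as [F1 F2]; destruct (HG t t') as [G1 G2]; split.
- apply Rle_trans with (m * n); [now apply le_norm_mult | nra].
- replace (F t' * G t' - F t * G t)%op with ((F t' - F t) * G t' + F t * (G t' - G t))%op
    by non_commutative_ring.
  apply Rle_trans with (m * Rabs (t' - t) * n + m * (n * Rabs (t' - t))).
  + apply le_norm_plus; apply le_norm_mult; auto; apply (HG t' t).
  + apply Req_le; ring.
Qed.

End Bounds.

(** Bounds the norm of an algebraic expression term by term; a subexpression whose
    norm is bounded by a hypothesis is not decomposed. *)
Ltac le_norm :=
  first
  [ match goal with h : ?P |- ?P => exact h end
  | lazymatch goal with
    | |- op_norm (op_plus _ _) <= _ => apply le_norm_plus; le_norm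
    | |- op_norm (op_mult _ _) <= _ => apply le_norm_mult; le_norm
    | |- op_norm (op_opp _) <= _ => apply le_norm_opp; le_norm
    | |- _ => idtac
    end ].

Section Resolvent.

Variable H : HilbertSpace.
Notation I := (op_id H).
Notation VO := (restr_NormedModule (bounded_op_NormedModule H)).
Variables a rho M : R.
Hypothesis rho_pos : 0 < rho.
Hypothesis rho_lt : rho < a.
Variable b : bounded_op H.
Notation v := (circ a rho).
Notation dv := (dcirc rho).

(** The resolvent of [b] at the square of the point of the circle: in the variable
    [v = sqrt z], the slit plane becomes a half-plane and the contour a circle. *)
Definition sq_resolvent (t : R) : bounded_op H := op_inv ((v t * v t)%C *: I - b)%op.

Hypothesis resolvent_ex : forall t, exists R,
  is_inverse ((v t * v t)%C *: I - b)%op R /\ op_norm R <= M.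

Lemma resolvent_inv t : is_inverse ((v t * v t)%C *: I - b)%op (sq_resolvent t).
Proof. destruct (resolvent_ex t) as [R [E _]]; apply op_inv_spec; now exists R. Qed.

Lemma resolvent_norm t : op_norm (sq_resolvent t) <= M.
Proof. destruct (resolvent_ex t) as [R [E N]]; unfold sq_resolvent; now rewrite (op_inv_eq _ _ _ E). Qed.

Lemma resolvent_bound_ge_0 : 0 <= M.
Proof. apply Rle_trans with (2 := resolvent_norm 0), op_norm_ge_0. Qed.

Lemma resolvent_lip_bound t t' :
  op_norm (sq_resolvent t' - sq_resolvent t) <= M * (4 * PI * rho * Rabs (t' - t) * (4 * a)) * M.
Proof.
rewrite (inverse_diff _ _ _ _ _ (resolvent_inv t) (resolvent_inv t')).
apply le_norm_mult; [apply le_norm_mult|]; try apply resolvent_norm.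
replace ((v t * v t)%C *: I - b - ((v t' * v t')%C *: I - b))%op
  with (- (((v t' * v t')%C *: I) - ((v t * v t)%C *: I)))%op by non_commutative_ring.
apply le_norm_opp; rewrite <- op_scalar_minus; apply le_norm_scalar.
replace (v t' * v t' - v t * v t)%C with ((v t' - v t) * (v t' + v t))%C by ring.
rewrite Cmod_mult; apply Rmult_le_compat; try apply Cmod_ge_0.
- now apply circ_lip.
- apply Rle_trans with (1 := Cmod_triangle _ _).
  pose proof (circ_bound a rho rho_pos rho_lt t); pose proof (circ_bound a rho rho_pos rho_lt t'); lra.
Qed.

Lemma lip_resolvent : lip H sq_resolvent.
Proof.
pose proof resolvent_bound_ge_0; pose proof PI_RGT_0.
exists (M + M * (4 * PI * rho * (4 * a)) * M); split.
{ assert (0 <= 4 * PI * rho * (4 * a)) by (repeat first [lra | apply Rmult_le_pos]).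
  assert (0 <= M * (4 * PI * rho * (4 * a)) * M) by (repeat first [lra | apply Rmult_le_pos]); lra. }
assert (0 <= M * (4 * PI * rho * (4 * a)) * M) by (repeat first [lra | apply Rmult_le_pos]).
intros t t'; split.
- pose proof (resolvent_norm t); lra.
- apply Rle_trans with (1 := resolvent_lip_bound t t').
  pose proof (Rabs_pos (t' - t)).
  replace (M * (4 * PI * rho * Rabs (t' - t) * (4 * a)) * M)
    with (M * (4 * PI * rho * (4 * a)) * M * Rabs (t' - t)) by ring.
  apply Rmult_le_compat_r; lra.
Qed.

Lemma lip_dcirc : lip H (fun t => dv t *: I)%op.
Proof.
pose proof PI_RGT_0.
assert (0 <= 4 * PI * rho) by (repeat first [lra | apply Rmult_le_pos]).
assert (0 <= 8 * PI ^ 2 * rho) by (repeat first [lra | apply pow2_ge_0 | apply Rmult_le_pos]).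
exists (4 * PI * rho + 8 * PI ^ 2 * rho); split; [lra|].
intros t t'; split.
- apply le_norm_scalar; pose proof (dcirc_bound rho rho_pos t); lra.
- rewrite <- op_scalar_minus; apply le_norm_scalar.
  apply Rle_trans with (1 := dcirc_lip rho rho_pos t t').
  apply Rmult_le_compat_r; [apply Rabs_pos | lra].
Qed.

Lemma continuous_dcirc_scal F : lip H F -> forall t, continuous (U := VO) (fun t => dv t *: F t)%op t.
Proof.
intros L; apply lip_continuous.
destruct (lip_mult _ _ _ lip_dcirc L) as [m [Hm HF]]; exists m; split; [assumption|].
intros t t'; rewrite !(op_scalar_left H _ (F _)); apply HF.
Qed.

Lemma contour_integral_exists :
  exists T, is_RInt (V := VO) (fun t => dv t *: sq_resolvent t)%op 0 1 T.
Proof.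
apply (ex_RInt_continuous (V := restr_Complete (bounded_op_Complete H))).
intros t _; apply continuous_dcirc_scal, lip_resolvent.
Qed.

Lemma bicomm_resolvent t : bicomm H b (sq_resolvent t).
Proof.
apply bicomm_inverse with (1 := resolvent_inv t).
apply bicomm_plus; [apply bicomm_scal, bicomm_id | apply bicomm_opp, bicomm_self].
Qed.

Let q t := (v t *: I)%op.
Let G t := (sq_resolvent t + (b * (sq_resolvent t * sq_resolvent t) + b * (sq_resolvent t * sq_resolvent t)))%op.

Lemma lip_G : lip H G.
Proof.
unfold G; repeat first [apply lip_plus | apply lip_mult | apply lip_resolvent | apply lip_const].
Qed.

Lemma scaled_resolvent_derive t : is_derive (V := VO) (fun t => q t * sq_resolvent t)%op t (dv t *: (- G t))%op.
Proof.
pose proof PI_RGT_0 as HPI; pose proof resolvent_bound_ge_0 as HM.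
set (L := 4 * PI * rho); set (L2 := 8 * PI ^ 2 * rho); set (L1 := M * (L * (4 * a)) * M).
set (K := L2 * (M + (2 * a * (2 * a) * (M * M) + 2 * a * (2 * a) * (M * M)))
  + L * (L1 + 2 * a * (L * (M * M) + (2 * a * (L1 * M) + 2 * a * (L1 * M))))).
apply is_derive_of_quadratic with K.
intros t'.
change (op_norm (q t' * sq_resolvent t' - q t * sq_resolvent t - RtoC (t' - t) *: (dv t *: (- G t)))%op <= K * (t' - t) ^ 2).
rewrite op_scal_assoc, (op_scalar_left H _ (- G t)%op).
unfold G; rewrite (commuting_derivative_identity H b); unfold q;
  auto using bicomm_scal, bicomm_id, bicomm_self, bicomm_resolvent.
2, 3: rewrite <- op_scalar_mult; apply resolvent_inv.
set (h := Rabs (t' - t)).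
assert (Hh : 0 <= h) by apply Rabs_pos.
replace ((t' - t) ^ 2) with (h * h) by (unfold h; rewrite <- (pow2_abs (t' - t)); ring).
assert (Bv : forall t, op_norm (v t *: I) <= 2 * a)
  by (intros; now apply le_norm_scalar, circ_bound).
assert (Bd : op_norm (v t' *: I - v t *: I)%op <= L * h)
  by (rewrite <- op_scalar_minus; now apply le_norm_scalar, circ_lip).
assert (Bq : op_norm (v t' *: I - v t *: I - (RtoC (t' - t) * dv t)%C *: I)%op <= L2 * (h * h)).
{ rewrite <- !op_scalar_minus; apply le_norm_scalar.
  apply Rle_trans with (1 := circ_taylor a rho rho_pos t t').
  unfold L2, h; rewrite <- (pow2_abs (t' - t)); apply Req_le; ring. }
assert (Br : op_norm (sq_resolvent t' - sq_resolvent t) <= L1 * h).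
{ apply Rle_trans with (1 := resolvent_lip_bound t t'); unfold L1, L, h; apply Req_le; ring. }
pose proof resolvent_norm as Bn.
apply Rle_trans with
  (L2 * (h * h) * (M + (2 * a * (2 * a) * (M * M) + 2 * a * (2 * a) * (M * M)))
  + L * h * (L1 * h + 2 * a * (L * h * (M * M) + (2 * a * (L1 * h * M) + 2 * a * (L1 * h * M))))).
- le_norm; first [apply Bv | apply Bn].
- apply Req_le; unfold K; ring.
Qed.

(** The integrand is minus the derivative of [v (v^2 - b)^{-1}], and the contour is closed.
    This expresses the integral of the squared resolvent by that of the resolvent. *)
Lemma contour_integral_by_parts : is_RInt (V := VO) (fun t => dv t *: G t)%op 0 1 (op_zero H).
Proof.
assert (D : is_RInt (V := VO) (fun t => dv t *: (- G t))%op 0 1 (op_zero H)).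
{ evar_last.
  - apply (is_RInt_derive (V := restr_Complete (bounded_op_Complete H)) (fun t => q t * sq_resolvent t)%op).
    + intros t _; apply scaled_resolvent_derive.
    + intros t _; apply continuous_dcirc_scal.
      destruct lip_G as [m [Hm HG]]; exists m; split; [assumption|]; intros s s'; split.
      * apply le_norm_opp; apply (HG s s').
      * replace (- G s' - - G s)%op with (- (G s' - G s))%op by non_commutative_ring.
        apply le_norm_opp; apply (HG s s').
  - cbv beta; unfold q, sq_resolvent; rewrite circ_closed.
    apply op_plus_opp_r. }
pose proof (is_RInt_linear _ _ _ _ _ _ _ (op_mult_linear_l H (- I)%op) D) as D'.
cbv beta in D'.
replace (- I * op_zero H)%op with (op_zero H) in D' by non_commutative_ring.
apply is_RInt_ext with (2 := D'); intros t _.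
rewrite op_scal_opp; non_commutative_ring.
Qed.

End Resolvent.

(** * Deformation of the contour integral from the identity *)

Section Family.

Variable H : HilbertSpace.
Notation I := (op_id H).
Notation VO := (restr_NormedModule (bounded_op_NormedModule H)).
Variables a rho M : R.
Hypothesis rho_pos : 0 < rho.
Hypothesis rho_lt : rho < a.
Hypothesis one_inside : Cmod (RtoC 1 - RtoC a) < rho.
Variable B : bounded_op H.
Notation v := (circ a rho).
Notation dv := (dcirc rho).

Definition segment (s : R) : bounded_op H := (RtoC (1 - s) *: I + RtoC s *: B)%op.

Hypothesis segment_resolvent : forall s t, 0 <= s <= 1 -> exists R,
  is_inverse ((v t * v t)%C *: I - segment s)%op R /\ op_norm R <= M.
Hypothesis segment_inverse : forall s, 0 <= s <= 1 -> exists Y,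
  is_inverse (segment s) Y /\ op_norm Y <= M.

Lemma is_RInt_op_unique (f : R -> bounded_op H) (x y : R) (S T : bounded_op H) :
  is_RInt (V := VO) f x y S -> is_RInt (V := VO) f x y T -> S = T.
Proof.
intros ES ET.
exact (eq_trans (eq_sym (is_RInt_unique (V := restr_Complete (bounded_op_Complete H)) _ _ _ _ ES))
         (is_RInt_unique (V := restr_Complete (bounded_op_Complete H)) _ _ _ _ ET)).
Qed.

Lemma integral_commute (w : R -> C) (F : R -> bounded_op H) (T Y : bounded_op H) :
  is_RInt (V := VO) (fun t => w t *: F t)%op 0 1 T ->
  (forall t, Y * F t = F t * Y)%op -> (Y * T = T * Y)%op.
Proof.
intros ET E.
apply is_RInt_op_unique with (fun t => Y * (w t *: F t))%op 0 1.
- exact (is_RInt_linear _ _ _ _ _ _ _ (op_mult_linear_l H Y) ET).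
- apply is_RInt_ext with (fun t => (w t *: F t) * Y)%op.
  + intros t _; now rewrite op_scal_mult_l, op_scal_mult_r, E.
  + exact (is_RInt_linear _ _ _ _ _ _ _ (op_mult_linear_r H Y) ET).
Qed.

Notation res s := (sq_resolvent H a rho (segment s)).

Definition segment_integral (s : R) : bounded_op H :=
  epsilon (inhabits (op_zero H)) (fun T => is_RInt (V := VO) (fun t => dv t *: res s t)%op 0 1 T).

Lemma segment_integral_spec s : 0 <= s <= 1 ->
  is_RInt (V := VO) (fun t => dv t *: res s t)%op 0 1 (segment_integral s).
Proof.
intros Hs; unfold segment_integral; apply epsilon_spec.
apply contour_integral_exists with M; auto.
Qed.

Lemma bicomm_segment s : bicomm H B (segment s).
Proof.
apply bicomm_plus; apply bicomm_scal; [apply bicomm_id | apply bicomm_self].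
Qed.

Lemma bicomm_trans b X : bicomm H B b -> bicomm H b X -> bicomm H B X.
Proof. intros E E' Y HY; apply E'; now apply E. Qed.

Lemma bicomm_segment_resolvent s t : 0 <= s <= 1 -> bicomm H B (res s t).
Proof.
intros Hs; apply bicomm_trans with (segment s); [apply bicomm_segment|].
apply bicomm_resolvent with M; auto.
Qed.

Lemma bicomm_segment_integral s : 0 <= s <= 1 -> bicomm H B (segment_integral s).
Proof.
intros Hs Y HY; apply (integral_commute _ _ _ _ (segment_integral_spec s Hs)).
intros t; now apply bicomm_segment_resolvent.
Qed.

Lemma segment_norm s : 0 <= s <= 1 -> op_norm (segment s) <= 1 + op_norm B.
Proof.
intros Hs; unfold segment; apply le_norm_plus.
- apply le_norm_scalar; rewrite Cmod_R, Rabs_pos_eq; lra.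
- rewrite <- (Rmult_1_l (op_norm B)); apply le_norm_scal; [rewrite Cmod_R, Rabs_pos_eq|]; lra.
Qed.

Lemma segment_increment s s' :
  (segment s' - segment s = RtoC (s' - s) *: (B - I))%op.
Proof.
unfold segment.
rewrite op_scal_minus, !(op_scalar_left H _ B).
rewrite !RtoC_minus, !op_scalar_minus; non_commutative_ring.
Qed.

Lemma op_scal_half (X : bounded_op H) : (RtoC (/ 2) *: (X + X) = X)%op.
Proof.
rewrite op_scal_distr_l, <- op_scal_distr_r, <- RtoC_plus.
replace (/ 2 + / 2) with 1 by field; apply op_scal_one.
Qed.

Lemma integral_of_square s Y : 0 <= s <= 1 -> is_inverse (segment s) Y ->
  is_RInt (V := VO) (fun t => dv t *: (res s t * res s t))%op 0 1
    (- (RtoC (/ 2) *: (Y * segment_integral s)))%op.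
Proof.
intros Hs EY.
pose proof (contour_integral_by_parts H a rho M rho_pos rho_lt (segment s)
  (fun t => segment_resolvent s t Hs)) as P.
apply (is_RInt_linear _ _ _ _ _ _ _ (op_mult_linear_l H Y)) in P; cbv beta in P.
pose proof (is_RInt_linear _ _ _ _ _ _ _ (op_mult_linear_l H Y) (segment_integral_spec s Hs)) as Q.
cbv beta in Q.
pose proof (is_RInt_minus (V := VO) _ _ _ _ _ _ P Q) as D.
apply (is_RInt_linear _ _ _ _ _ _ _ (op_mult_linear_l H (RtoC (/ 2) *: I)%op)) in D.
cbv beta in D.
evar_last.
- apply is_RInt_ext with (2 := D); intros t _.
  change (RtoC (/ 2) *: I * (Y * (dv t *: (res s t + (segment s * (res s t * res s t)
     + segment s * (res s t * res s t)))) - Y * (dv t *: res s t))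
   = dv t *: (res s t * res s t))%op.
  rewrite !op_scal_mult_r, <- op_scal_minus, op_scal_mult_l, op_mult_id_l, op_scal_assoc.
  rewrite Cmult_comm, <- op_scal_assoc; f_equal.
  destruct EY as [_ EY].
  replace (Y * (res s t + (segment s * (res s t * res s t) + segment s * (res s t * res s t))) -
    Y * res s t)%op with (Y * segment s * (res s t * res s t) + Y * segment s * (res s t * res s t))%op
    by non_commutative_ring.
  rewrite EY, op_mult_id_l; apply op_scal_half.
- change ((RtoC (/ 2) *: I) * (Y * op_zero H - Y * segment_integral s) = - (RtoC (/ 2) *: (Y * segment_integral s)))%op.
  rewrite (op_scalar_left H _ (Y * segment_integral s)%op); non_commutative_ring.
Qed.

Lemma segment_integral_norm s : 0 <= s <= 1 -> op_norm (segment_integral s) <= 4 * PI * rho * M.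
Proof.
intros Hs.
replace (4 * PI * rho * M) with ((1 - 0) * (4 * PI * rho * M)) by ring.
apply (norm_RInt_le_const (V := VO) _ 0 1 _ _ Rle_0_1) with (2 := segment_integral_spec s Hs).
intros t _; apply le_norm_scal.
- now apply dcirc_bound.
- apply resolvent_norm; auto.
Qed.

(** To first order in [h = s' - s] the resolvent [R] increases by [h (B - 1) R^2], and
    [integral_of_square] evaluates the integral of this term; the remainder has the
    integrand [h^2 (B - 1)^2 R' R^2]. *)
Lemma segment_integral_increment s s' Y : 0 <= s <= 1 -> 0 <= s' <= 1 -> is_inverse (segment s) Y ->
  op_norm (segment_integral s' - segment_integral s + RtoC ((s' - s) / 2) *: ((B - I) * Y) * segment_integral s)%op
  <= 4 * PI * rho * ((s' - s) ^ 2 * (op_norm (B - I) * op_norm (B - I)) * (M * (M * M))).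
Proof.
intros Hs Hs' EY.
set (h := s' - s).
set (c := (RtoC h *: (B - I))%op).
pose proof (is_RInt_minus (V := VO) _ _ _ _ _ _
  (is_RInt_minus (V := VO) _ _ _ _ _ _ (segment_integral_spec s' Hs') (segment_integral_spec s Hs))
  (is_RInt_linear _ _ _ _ _ _ _ (op_mult_linear_l H c) (integral_of_square s Y Hs EY))) as P.
cbv beta in P.
assert (bc : bicomm H B c).
{ apply bicomm_scal, bicomm_plus; [apply bicomm_self | apply bicomm_opp, bicomm_id]. }
assert (E : (segment_integral s' - segment_integral s + RtoC (h / 2) *: ((B - I) * Y) * segment_integral s
  = segment_integral s' - segment_integral s - c * (- (RtoC (/ 2) *: (Y * segment_integral s))))%op).
{ replace (RtoC (h / 2) *: ((B - I) * Y) * segment_integral s)%op with (c * (RtoC (/ 2) *: (Y * segment_integral s)))%op.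
  - non_commutative_ring.
  - unfold c, Rdiv; rewrite !op_scal_mult_l, op_scal_mult_r, op_scal_assoc, RtoC_mult, op_mult_assoc.
    reflexivity. }
rewrite E; clear E.
match goal with |- _ <= ?k => replace k with ((1 - 0) * k) by ring end.
apply (norm_RInt_le_const (V := VO) _ 0 1 _ _ Rle_0_1) with (2 := P).
intros t _.
assert (E : (res s' t - res s t - c * (res s t * res s t)
  = c * c * (res s' t * (res s t * res s t)))%op).
{ apply commuting_resolvent_identity with B; auto using bicomm_segment_resolvent.
  pose proof (fun s Hs => resolvent_inv H a rho M (segment s) (fun t => segment_resolvent s t Hs) t) as Ri.
  rewrite (inverse_diff _ _ _ _ _ (Ri s Hs) (Ri s' Hs')).
  replace ((v t * v t)%C *: I - segment s - ((v t * v t)%C *: I - segment s'))%op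
    with (segment s' - segment s)%op by non_commutative_ring.
  rewrite segment_increment; fold h; fold c.
  rewrite (bicomm_comm H B (res s' t) c) by auto using bicomm_segment_resolvent.
  symmetry; apply op_mult_assoc. }
change (op_norm (dv t *: res s' t - dv t *: res s t - c * (dv t *: (res s t * res s t)))%op
  <= 4 * PI * rho * (h ^ 2 * (op_norm (B - I) * op_norm (B - I)) * (M * (M * M)))).
rewrite op_scal_mult_r, <- !op_scal_minus, E.
apply le_norm_scal; [now apply dcirc_bound|].
assert (Nc : op_norm c <= Rabs h * op_norm (B - I)) by (apply le_norm_scal; [rewrite Cmod_R|]; lra).
rewrite <- (pow2_abs h).
apply Rle_trans with (Rabs h * op_norm (B - I) * (Rabs h * op_norm (B - I)) * (M * (M * M))).
- repeat apply le_norm_mult; auto; apply resolvent_norm; auto.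
- apply Req_le; ring.
Qed.

(** From [s] to [s' = s + h], the operator [b] of the segment becomes [b (1 + 2x)] with
    [x = h (B - 1) b^{-1} / 2], and the integral [T] becomes [(1 - x) T + O(h^2)]. By
    [commuting_const_identity] the product [b T^2] changes by [O(h^2)] only. *)
Lemma segment_integral_const :
  (segment 1 * (segment_integral 1 * segment_integral 1) = segment 0 * (segment_integral 0 * segment_integral 0))%op.
Proof.
set (d := op_norm (B - I)); set (l := d * M); set (tau := 4 * PI * rho * M).
set (k := 4 * PI * rho * (d * d * (M * (M * M)))).
set (beta := 1 + op_norm B).
apply (const_of_quadratic _ (bounded_op_NormedModule H)
  (fun s => segment s * (segment_integral s * segment_integral s))%op
  (beta * (l * l * (l + l + 3) * (tau * tau)
   + (1 + (l + l)) * (k * (tau + l * tau + (tau + l * tau) + k))))).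
intros s s' Hs Hs'.
destruct (segment_inverse s Hs) as [Y [EY NY]].
set (h := s' - s).
change (op_norm (segment s' * (segment_integral s' * segment_integral s') - segment s * (segment_integral s * segment_integral s))%op <=
  beta * (l * l * (l + l + 3) * (tau * tau)
   + (1 + (l + l)) * (k * (tau + l * tau + (tau + l * tau) + k))) * h ^ 2).
set (x := (RtoC (h / 2) *: ((B - I) * Y))%op).
set (e := (segment_integral s' - segment_integral s + x * segment_integral s)%op).
assert (bY : bicomm H B Y) by (apply bicomm_inverse with (1 := EY); apply bicomm_segment).
assert (bD : bicomm H B (B - I)%op).
{ apply bicomm_plus; [apply bicomm_self | apply bicomm_opp, bicomm_id]. }
assert (bx : bicomm H B x) by (apply bicomm_scal, bicomm_mult; assumption).
assert (be : bicomm H B e).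
{ unfold e; auto using bicomm_plus, bicomm_opp, bicomm_segment_integral, bicomm_mult. }
assert (Es : segment s' = (segment s * (I + (x + x)))%op).
{ transitivity (segment s + (segment s' - segment s))%op; [non_commutative_ring|].
  rewrite segment_increment; fold h.
  rewrite op_mult_plus_r, op_mult_id_r; f_equal; unfold x.
  rewrite <- op_scal_distr_r, op_scal_mult_r, op_mult_assoc.
  rewrite (bicomm_comm H B (segment s) (B - I)%op) by auto using bicomm_segment.
  destruct EY as [EY _]; rewrite <- op_mult_assoc, EY, op_mult_id_r.
  f_equal; rewrite <- RtoC_plus; f_equal; field. }
assert (Et : segment_integral s' = (segment_integral s - x * segment_integral s + e)%op) by (unfold e; non_commutative_ring).
rewrite Es, Et, (commuting_const_identity H B) by auto using bicomm_segment, bicomm_segment_integral.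
pose proof (op_norm_ge_0 _ (B - I)%op : 0 <= d) as Hd.
assert (HM : 0 <= M) by (apply Rle_trans with (2 := NY), op_norm_ge_0).
assert (Hl : 0 <= l) by (unfold l; now apply Rmult_le_pos).
pose proof PI_RGT_0.
assert (Hpr : 0 <= 4 * PI * rho) by (repeat first [lra | apply Rmult_le_pos]).
assert (Ht : 0 <= tau) by (unfold tau; now apply Rmult_le_pos).
assert (Hk : 0 <= k) by (unfold k; repeat first [assumption | apply Rmult_le_pos]).
assert (Hb : 0 <= beta) by (unfold beta; pose proof (op_norm_ge_0 _ B); lra).
assert (Hh : Rabs h <= 1) by (apply Rabs_le; unfold h; lra).
assert (Hh0 : 0 <= Rabs h) by apply Rabs_pos.
assert (Nx : op_norm x <= Rabs h * l).
{ unfold x; apply le_norm_scal; [|apply le_norm_mult; [apply Rle_refl | exact NY]].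
  rewrite Cmod_R; unfold Rdiv; rewrite Rabs_mult, (Rabs_pos_eq (/ 2)) by lra; lra. }
assert (Nx1 : op_norm x <= l) by nra.
assert (Ne : op_norm e <= k * h ^ 2).
{ apply Rle_trans with (1 := segment_integral_increment s s' Y Hs Hs' EY).
  fold h; fold d; unfold k; apply Req_le; ring. }
rewrite <- (pow2_abs h) in *.
assert (Hh2 : Rabs h ^ 2 <= 1) by (simpl; nra).
assert (Ne1 : op_norm e <= k) by nra.
pose proof (segment_integral_norm s Hs) as Nt; fold tau in Nt.
apply Rle_trans with (beta * (Rabs h * l * (Rabs h * l) * (l + l + (1 + 1 + 1)) * (tau * tau)
   + (1 + (l + l)) * (k * Rabs h ^ 2 * (tau + l * tau + (tau + l * tau) + k)))).
- pose proof (segment_norm s Hs).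
  le_norm; apply op_norm_id.
- apply Req_le; ring.
Qed.

(** For the identity the resolvent is scalar, and [2 / (v^2 - 1) = 1 / (v - 1) - 1 / (v + 1)]
    where only the pole 1 is inside the circle. *)
Lemma segment_integral_0 : segment_integral 0 = (two_pi_i / RtoC 2 *: I)%C%op.
Proof.
assert (N1 : forall t, (v t - RtoC 1 <> RtoC 0)%C).
{ intros t Z.
  pose proof (circ_mod a rho rho_pos t) as E.
  replace (v t) with (RtoC 1) in E; [lra|].
  replace (v t) with (v t - RtoC 1 + RtoC 1)%C by ring; rewrite Z; ring. }
assert (N2 : forall t, (v t + RtoC 1 <> RtoC 0)%C).
{ intros t Z; pose proof (circ_Re_pos a rho rho_pos rho_lt t) as P.
  apply (f_equal Re) in Z; rewrite re_plus, !re_RtoC in Z; lra. }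
assert (N3 : forall t, (v t * v t - RtoC 1 <> RtoC 0)%C).
{ intros t; replace (v t * v t - RtoC 1)%C with ((v t - RtoC 1) * (v t + RtoC 1))%C by ring.
  now apply Cmult_neq_0. }
assert (N4 : RtoC 2 <> RtoC 0) by (intros E; apply RtoC_inj in E; lra).
assert (L : is_linear (U := C_NormedModule) (V := bounded_op_NormedModule H)
   (fun c : C => (c / RtoC 2)%C *: I)%op).
{ split.
  - intros x y; change (((x + y) / RtoC 2)%C *: I = (x / RtoC 2)%C *: I + (y / RtoC 2)%C *: I)%op.
    rewrite <- op_scal_distr_r; f_equal; now field.
  - intros k x; change (((k * x) / RtoC 2)%C *: I = k *: ((x / RtoC 2)%C *: I))%op.
    rewrite op_scal_assoc; f_equal; now field.
  - exists 1; split; [lra|]; intros x.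
    change (op_norm ((x / RtoC 2)%C *: I) <= 1 * Cmod x).
    apply le_norm_scalar; unfold Cdiv; rewrite Cmod_mult.
    rewrite <- RtoC_inv, Cmod_R, Rabs_pos_eq by lra; pose proof (Cmod_ge_0 x); lra. }
pose proof (winding_inside a rho rho_pos (RtoC 1) one_inside) as P.
pose proof (winding_outside a rho rho_pos rho_lt (RtoC 1) ltac:(rewrite re_RtoC; lra)) as Q.
pose proof (is_RInt_minus (V := restr_NormedModule C_NormedModule) _ _ _ _ _ _ P Q) as D.
apply (is_RInt_linear _ _ _ _ _ _ _ L) in D; cbv beta in D.
assert (H0 : 0 <= 0 <= 1) by lra.
apply is_RInt_op_unique with (fun t => dv t *: res 0 t)%op 0 1; [now apply segment_integral_spec|].
evar_last.
- apply is_RInt_ext with (2 := D); intros t _.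
  change ((((dv t / (v t - RtoC 1)) - (dv t / (v t + RtoC 1))) / RtoC 2)%C *: I = dv t *: res 0 t)%op.
  replace (res 0 t) with ((/ (v t * v t - RtoC 1))%C *: I)%op.
  + rewrite op_scal_assoc; f_equal.
    field; auto.
  + symmetry; apply op_inv_eq.
    replace ((v t * v t)%C *: I - segment 0)%op with ((v t * v t - RtoC 1)%C *: I)%op.
    * apply is_inverse_scal.
      -- apply N3.
      -- split; apply op_mult_id_l.
    * rewrite op_scalar_minus; do 2 f_equal; unfold segment.
      rewrite op_scal_zero_l, Rminus_0_r, op_plus_zero_r; reflexivity.
- change (((two_pi_i - RtoC 0) / RtoC 2)%C *: I = (two_pi_i / RtoC 2)%C *: I)%op.
  f_equal; now field.
Qed.

(** In functional calculus [2 T] is [2 pi i B^{-1/2}]. The identity for [T^2] holds at the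
    scalar end of the segment and is transported to [B]. *)
Lemma contour_integral_inverse_root : exists T : bounded_op H,
  is_RInt (V := VO) (fun t => dv t *: op_inv ((v t * v t)%C *: I - B))%op 0 1 T /\
  (B * (T * T) = (two_pi_i / RtoC 2 * (two_pi_i / RtoC 2))%C *: I)%op.
Proof.
assert (E1 : segment 1 = B).
{ unfold segment; rewrite Rminus_diag, op_scal_zero_l, op_scal_one.
  rewrite op_plus_comm; apply op_plus_zero_r. }
assert (E0 : segment 0 = I).
{ unfold segment; now rewrite op_scal_zero_l, Rminus_0_r, op_plus_zero_r, op_scal_one. }
exists (segment_integral 1); split.
- pose proof (segment_integral_spec 1 ltac:(lra)) as P; unfold sq_resolvent in P; rewrite E1 in P; exact P.
- pose proof segment_integral_const as P; rewrite E1, E0, segment_integral_0 in P.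
  rewrite P, op_mult_id_l; symmetry; apply op_scalar_mult.
Qed.

End Family.

(** * Choice of the contour *)

Section ContourChoice.

Variable H : HilbertSpace.
Notation I := (op_id H).

Lemma inverse_far (X : bounded_op H) (z : C) (m : R) : 1 <= m -> op_norm X <= m -> 2 * m <= Cmod z ->
  exists Y, is_inverse (z *: I - X)%op Y /\ op_norm Y <= 1.
Proof.
intros Hm HX Hz.
assert (Nz : z <> RtoC 0) by (apply Cmod_gt_0; lra).
assert (Hi : op_norm ((/ z)%C *: I) <= / Cmod z).
{ apply le_norm_scalar; rewrite Cmod_inv by assumption; apply Rle_refl. }
assert (Pz : 0 < / Cmod z) by (apply Rinv_0_lt_compat; lra).
destruct (inverse_perturb H (z *: I)%op ((/ z)%C *: I)%op (z *: I - X)%op) as [Y [EY NY]].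
- apply is_inverse_scal; [assumption|]; split; apply op_mult_id_l.
- replace (z *: I - X - z *: I)%op with (- X)%op by non_commutative_ring.
  rewrite op_norm_opp.
  apply Rle_trans with (m * / Cmod z).
  + apply Rmult_le_compat; auto using op_norm_ge_0.
  + apply Rmult_le_reg_r with (Cmod z); [lra|].
    rewrite Rmult_assoc, Rinv_l; lra.
- exists Y; split; [assumption|].
  apply Rle_trans with (1 := NY), Rle_trans with (2 * / Cmod z); [lra|].
  apply Rmult_le_reg_r with (Cmod z); [lra|]; rewrite Rmult_assoc, Rinv_l; lra.
Qed.

Variable B : bounded_op H.
Hypothesis negative_axis : forall x, x <= 0 -> invertible (RtoC x *: I - B)%op.

Notation segment := (segment H B).

(** The slit plane is star-shaped about 1, so no operator of the segment from the
    identity to [B] meets the negative axis. *)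
Lemma segment_invertible x s : x <= 0 -> 0 <= s <= 1 ->
  invertible (RtoC x *: I - segment s)%op.
Proof.
intros Hx Hs; destruct (Req_dec s 0) as [->|Ns].
- replace (RtoC x *: I - segment 0)%op with (RtoC (x - 1) *: I)%op.
  + exists ((/ RtoC (x - 1))%C *: I)%op; apply is_inverse_scal.
    * intros E; apply RtoC_inj in E; lra.
    * split; apply op_mult_id_l.
  + unfold segment; rewrite op_scal_zero_l, Rminus_0_r, op_plus_zero_r, op_scal_one.
    rewrite RtoC_minus, op_scalar_minus, op_scal_one; reflexivity.
- destruct (negative_axis ((x - (1 - s)) / s)) as [Y EY].
  { apply Rmult_le_reg_r with s; [lra|]; unfold Rdiv; rewrite Rmult_assoc, Rinv_l; lra. }
  exists ((/ RtoC s)%C *: Y)%op.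
  replace (RtoC x *: I - segment s)%op with (RtoC s *: (RtoC ((x - (1 - s)) / s) *: I - B))%op.
  + apply is_inverse_scal; [|assumption]; intros E; apply RtoC_inj in E; lra.
  + rewrite op_scal_minus, op_scal_assoc, <- RtoC_mult.
    replace (s * ((x - (1 - s)) / s)) with (x - (1 - s)) by (field; lra).
    unfold segment; rewrite (RtoC_minus x), op_scalar_minus; non_commutative_ring.
Qed.

(** By compactness of [-r, 0] x [0, 1], the inverses exist and are bounded on a whole
    neighbourhood of the slit, uniformly along the segment. *)
Lemma uniform_neighbourhood (r : R) : exists d, 0 < d /\
  forall x s z, - r <= x <= 0 -> 0 <= s <= 1 -> Cmod (z - RtoC x) < d ->
  exists Y, is_inverse (z *: I - segment s)%op Y /\ op_norm Y <= / d.
Proof.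
set (D := op_norm (B - I)).
assert (HD : 0 <= D) by apply op_norm_ge_0.
set (Yn := fun u w => op_norm (op_inv (RtoC u *: I - segment w)%op)).
assert (HY : forall u w, 0 <= Yn u w) by (intros; apply op_norm_ge_0).
assert (Hdelta : forall u w, 0 < / (4 * (Yn u w + 1) * (1 + D))).
{ intros u w; specialize (HY u w); apply Rinv_0_lt_compat; nra. }
destruct (compactness_value_2d (- r) 0 0 1 (fun u w => mkposreal _ (Hdelta u w))) as [d Hd].
exists d; split; [apply cond_pos|].
intros x s z Hx Hs Hz.
destruct (NNPP _ (Hd x s Hx Hs)) as [u [w [Hu [Hw [H1 [H2 H3]]]]]]; simpl in H1, H2, H3.
pose proof (op_inv_spec _ _ (segment_invertible u w ltac:(lra) Hw)) as E.
set (delta := / (4 * (Yn u w + 1) * (1 + D))) in *.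
pose proof (HY u w) as HYu; pose proof (Hdelta u w) as Hdu; fold delta in Hdu.
assert (Ed : delta * (4 * (Yn u w + 1) * (1 + D)) = 1) by (unfold delta; apply Rinv_l; nra).
destruct (inverse_perturb H _ _ (z *: I - segment s)%op E) as [Y [EY NY]].
- apply Rle_trans with ((2 * delta + delta * D) * Yn u w).
  + apply Rmult_le_compat_r; [apply HY|].
    replace (z *: I - segment s - (RtoC u *: I - segment w))%op
      with ((z *: I - RtoC u *: I) - (segment s - segment w))%op by non_commutative_ring.
    rewrite <- op_scalar_minus, segment_increment.
    apply le_norm_plus; [apply le_norm_scalar | apply le_norm_opp, le_norm_scal; [|apply Rle_refl]].
    * replace (z - RtoC u)%C with ((z - RtoC x) + RtoC (x - u))%C by (rewrite RtoC_minus; ring).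
      apply Rle_trans with (1 := Cmod_triangle _ _); rewrite Cmod_R; lra.
    * rewrite Cmod_R; lra.
  + nra.
- exists Y; split; [assumption|].
  apply Rle_trans with (1 := NY), Rle_trans with (/ delta).
  + fold (Yn u w); unfold delta; rewrite Rinv_inv; nra.
  + apply Rinv_le_contravar; [apply cond_pos | assumption].
Qed.

Lemma Cmod_sq_components (z : C) : Cmod z ^ 2 = Re z * Re z + Im z * Im z.
Proof. rewrite Cmod2_alt; ring. Qed.

(** A circle with a large centre [a] and radius [a - eps / 2] stays within [Re z <= eps] as
    long as [|z|^2 <= r], so the squares of its points are close to the slit or far from
    0. Its interior contains all points with [Re z > eps] and [|z|^2 < r], among them the
    square roots of the spectrum. *)
Lemma contour_choice : exists a rho M : R,
  0 < rho /\ rho < a /\ Cmod (RtoC 1 - RtoC a) < rho /\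
  (forall s t, 0 <= s <= 1 -> exists R,
     is_inverse ((circ a rho t * circ a rho t)%C *: I - segment s)%op R /\ op_norm R <= M) /\
  (forall s, 0 <= s <= 1 -> exists Y, is_inverse (segment s) Y /\ op_norm Y <= M) /\
  (forall z, 0 < Re z -> ~ invertible ((z * z)%C *: I - B)%op -> Cmod (z - RtoC a) < rho).
Proof.
set (m := 1 + op_norm B).
assert (Hm : 1 <= m) by (pose proof (op_norm_ge_0 _ B); unfold m; lra).
set (r := 2 * m).
destruct (uniform_neighbourhood r) as [d [Hd Near]].
assert (Hi : 0 < / d) by now apply Rinv_0_lt_compat.
set (eps := Rmin (/ 2) (d / (4 + 2 * r))).
assert (He : 0 < eps) by (apply Rmin_pos; [lra | apply Rdiv_lt_0_compat; unfold r; lra]).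
assert (He2 : eps <= / 2) by apply Rmin_l.
assert (Hed : eps * (3 + 2 * r) < d).
{ apply Rlt_le_trans with (eps * (4 + 2 * r)); [nra|].
  apply Rle_trans with (d / (4 + 2 * r) * (4 + 2 * r)).
  - apply Rmult_le_compat_r; [unfold r; lra | apply Rmin_r].
  - apply Req_le; field; unfold r; lra. }
(* Squares of points close to the imaginary axis are close to the slit, where
   [uniform_neighbourhood] applies; far from 0 the Neumann series does. *)
assert (Thin : forall z s, 0 <= s <= 1 -> 0 <= Re z <= eps -> Cmod z ^ 2 <= r ->
  exists Y, is_inverse ((z * z)%C *: I - segment s)%op Y /\ op_norm Y <= / d).
{ intros z s Hs Hz Hr; rewrite Cmod_sq_components in Hr.
  apply Near with (- (Im z * Im z)); [nra | assumption |].
  replace (z * z - RtoC (- (Im z * Im z)))%C with (RtoC (Re z) * (RtoC (Re z) + RtoC 2 * Ci * RtoC (Im z)))%C.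
  - rewrite Cmod_mult, Cmod_R, Rabs_pos_eq by lra.
    apply Rle_lt_trans with (2 := Hed).
    apply Rmult_le_compat; [lra | apply Cmod_ge_0 | lra |].
    apply Rle_trans with (1 := Cmod_triangle _ _).
    rewrite !Cmod_mult, Cmod_Ci, !Cmod_R, (Rabs_pos_eq (Re z)), (Rabs_pos_eq 2) by lra.
    assert (Rabs (Im z) <= 1 + r) by (apply Rabs_le; nra); lra.
  - destruct z as [p q]; apply injective_projections; simpl; ring. }
assert (Far : forall z s, 0 <= s <= 1 -> r <= Cmod z ^ 2 ->
  exists Y, is_inverse ((z * z)%C *: I - segment s)%op Y /\ op_norm Y <= 1).
{ intros z s Hs Hz; apply inverse_far with m; [assumption | now apply segment_norm |].
  rewrite Cmod_mult; simpl in Hz; unfold r in Hz; lra. }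
set (a := r / eps + 1).
assert (Ha : a * eps = r + eps) by (unfold a; field; lra).
assert (Hr : 2 <= r) by (unfold r; lra).
assert (Ha1 : 1 < a) by nra.
exists a, (a - eps / 2), (1 + / d).
split; [lra|]; split; [lra|]; split; [|split; [|split]].
- rewrite <- RtoC_minus, Cmod_R, Rabs_left; lra.
- intros s t Hs; set (z := circ a (a - eps / 2) t).
  destruct (Rle_lt_dec r (Cmod z ^ 2)) as [Hz|Hz].
  { destruct (Far z s Hs Hz) as [Y [EY NY]]; exists Y; split; [assumption | lra]. }
  destruct (Thin z s Hs) as [Y [EY NY]]; [|lra|exists Y; split; [assumption | lra]].
  pose proof (circ_Re_pos a (a - eps / 2) ltac:(lra) ltac:(lra) t) as Pz.
  pose proof (circ_mod a (a - eps / 2) ltac:(lra) t) as Mz; fold z in Pz, Mz; clearbody z.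
  apply (f_equal (fun x => x ^ 2)) in Mz.
  rewrite Cmod_sq_components in Mz, Hz; unfold Re, Im in *; simpl in Mz.
  split; [lra|].
  apply Rmult_le_reg_l with a; [lra|]; nra.
- intros s Hs; destruct (Near 0 s (RtoC 0)) as [Y [EY NY]]; [lra | assumption | |].
  { unfold Cminus; rewrite Cplus_opp_r, Cmod_0; assumption. }
  exists ((/ (- RtoC 1))%C *: Y)%op.
  replace (segment s) with ((- RtoC 1)%C *: (RtoC 0 *: I - segment s))%op.
  + assert (N1 : (- RtoC 1)%C <> RtoC 0).
    { rewrite <- RtoC_opp; intros E; apply RtoC_inj in E; lra. }
    split; [now apply is_inverse_scal|].
    apply Rle_trans with (1 * / d); [apply le_norm_scal | lra]; [|assumption].
    rewrite Cmod_inv, Cmod_opp, Cmod_1 by assumption; lra.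
  + rewrite <- op_scal_opp_one, op_scal_zero_l; non_commutative_ring.
- intros z Pz Nz.
  assert (E1 : segment 1 = B).
  { unfold segment; rewrite Rminus_diag, op_scal_zero_l, op_scal_one.
    rewrite op_plus_comm; apply op_plus_zero_r. }
  assert (Hz : Cmod z ^ 2 < r).
  { apply Rnot_le_lt; intros Hz; apply Nz.
    destruct (Far z 1 ltac:(lra) Hz) as [Y [EY _]]; rewrite E1 in EY; now exists Y. }
  assert (Hz2 : eps < Re z).
  { apply Rnot_le_lt; intros Hz2; apply Nz.
    destruct (Thin z 1 ltac:(lra) ltac:(lra) ltac:(lra)) as [Y [EY _]]; rewrite E1 in EY; now exists Y. }
  apply Rsqr_incrst_0; [|apply Cmod_ge_0 | lra].
  rewrite !Rsqr_pow2, Cmod_sq_components; rewrite Cmod_sq_components in Hz.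
  unfold Re, Im in *; simpl; nra.
Qed.

End ContourChoice.

(** * The Riesz square root *)

Lemma is_derive_C_pair (X Y : R -> R) (t dX dY : R) :
  is_derive X t dX -> is_derive Y t dY ->
  is_derive (K := R_AbsRing) (V := C_R_NormedModule) (fun t => (X t, Y t) : C) t (dX, dY).
Proof.
intros DX DY.
pose proof (is_derive_plus (V := C_R_NormedModule) _ _ _ _ _
  (is_derive_scal_l (V := C_R_NormedModule) X t dX (1, 0) DX)
  (is_derive_scal_l (V := C_R_NormedModule) Y t dY (0, 1) DY)) as D.
evar_last.
- apply is_derive_ext with (2 := D); intros s.
  apply injective_projections; unfold plus, scal; simpl; unfold plus, scal, mult; simpl; unfold mult; simpl; ring.
- apply injective_projections; unfold plus, scal; simpl; unfold plus, scal, mult; simpl; unfold mult; simpl; ring.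
Qed.

Section SquaredCircle.

Variables a rho : R.
Hypothesis rho_pos : 0 < rho.
Hypothesis rho_lt : rho < a.
Variable c : C.

Notation v := (circ a rho).
Notation dv := (dcirc rho).

Lemma sq_circ_derive t :
  is_derive (K := R_AbsRing) (V := C_R_NormedModule) (fun t => c * (v t * v t))%C t
    (c * (RtoC 2 * (v t * dv t)))%C.
Proof.
pose proof (is_derive_C_pair (fun t => Re (c * (v t * v t))%C) (fun t => Im (c * (v t * v t))%C)
  t (Re (c * (RtoC 2 * (v t * dv t)))%C) (Im (c * (RtoC 2 * (v t * dv t)))%C)) as P.
apply P; unfold circ, dcirc; simpl; auto_derive; auto; ring.
Qed.

Lemma sq_circ_der_continuous t :
  continuous (U := C_UniformSpace) (fun t => c * (RtoC 2 * (v t * dv t)))%C t.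
Proof.
apply (ex_derive_continuous (K := R_AbsRing) (V := C_R_NormedModule)).
eexists.
apply (is_derive_C_pair (fun t => Re (c * (RtoC 2 * (v t * dv t)))%C) (fun t => Im (c * (RtoC 2 * (v t * dv t)))%C));
  unfold circ, dcirc; simpl; auto_derive; auto.
Qed.

Definition sq_arc : C1_arc :=
  @Build_C1_arc (fun t => c * (v t * v t))%C (fun t => c * (RtoC 2 * (v t * dv t)))%C
    (fun t _ => sq_circ_derive t) (fun t _ => sq_circ_der_continuous t).

Lemma sq_arc_closed : closed_contour (sq_arc :: nil)%list.
Proof.
exists (sq_arc 0); split; [reflexivity|]; simpl; now rewrite circ_closed.
Qed.

(** With [z = c u^2], the integrand [dw / (w - z)] for [w = c v^2] is
    [dv / (v - u) + dv / (v + u)]. *)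
Lemma sq_arc_winding (u : C) : c <> RtoC 0 -> 0 < Re u -> Cmod (u - RtoC a) < rho ->
  is_contour_int (V := C_NormedModule) (fun w => / (w - c * (u * u)))%C (sq_arc :: nil)%list two_pi_i.
Proof.
intros Nc Pu Iu.
pose proof (winding_inside a rho rho_pos u Iu) as P.
pose proof (winding_outside a rho rho_pos rho_lt u Pu) as Q.
pose proof (is_RInt_plus (V := restr_NormedModule C_NormedModule) _ _ _ _ _ _ P Q) as D.
exists two_pi_i, (RtoC 0); split; [|split; [reflexivity | symmetry; apply Cplus_0_r]].
evar_last.
- apply is_RInt_ext with (2 := D); intros t _.
  change (dv t / (v t - u) + dv t / (v t + u) =
    c * (RtoC 2 * (v t * dv t)) * / (c * (v t * v t) - c * (u * u)))%C.
  assert (N1 : (v t - u <> RtoC 0)%C).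
  { intros Z; pose proof (circ_mod a rho rho_pos t) as E.
    replace (v t) with u in E; [lra|].
    replace (v t) with (v t - u + u)%C by ring; rewrite Z; ring. }
  assert (N2 : (v t + u <> RtoC 0)%C).
  { intros Z; pose proof (circ_Re_pos a rho rho_pos rho_lt t) as P'.
    apply (f_equal Re) in Z; rewrite re_plus, re_RtoC in Z; lra. }
  replace (c * (v t * v t) - c * (u * u))%C with (c * ((v t - u) * (v t + u)))%C by ring.
  field; auto.
- apply Cplus_0_r.
Qed.

Lemma circ_sq_not_negative t (x : R) : (v t * v t)%C = RtoC x -> 0 < x.
Proof.
intros E; pose proof (circ_Re_pos a rho rho_pos rho_lt t) as P.
destruct (v t) as [p q]; simpl in P; injection E as E1 E2.
assert (q = 0) by nra; subst q; nra.
Qed.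

End SquaredCircle.

Section Branch.

Variable phi : R.

(** A square root of minus the direction of the ray: multiplication by [omega] maps
    the right half-plane onto one of the two components in which the square roots of
    the points off the ray lie. *)
Definition omega : C := (- sin (phi / 2), cos (phi / 2)).

Lemma omega_sq : (omega * omega)%C = (- (cos phi, sin phi))%C.
Proof.
assert (E : phi = 2 * (phi / 2)) by field.
rewrite (f_equal cos E), (f_equal sin E), cos_2a, sin_2a; unfold omega; apply injective_projections; simpl; ring.
Qed.

Lemma omega_neq_0 : omega <> RtoC 0.
Proof.
intros E; injection E as E1 E2; pose proof (cos_sin_1 (phi / 2)) as P.
replace (sin (phi / 2)) with 0 in P by lra; rewrite E2 in P; lra.
Qed.

Lemma omega_sq_neq_0 : (omega * omega)%C <> RtoC 0.
Proof. apply Cmult_neq_0; apply omega_neq_0. Qed.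

Lemma ray_iff_omega (z : C) : ray phi (omega * omega * z)%C <-> exists x, x <= 0 /\ z = RtoC x.
Proof.
split.
- intros [x [Hx E]]; exists (- x); split; [lra|].
  apply (f_equal (fun u => / (omega * omega) * u)%C) in E.
  rewrite Cmult_assoc, Cinv_l, Cmult_1_l in E by apply omega_sq_neq_0; rewrite E.
  replace (RtoC x * (cos phi, sin phi))%C with (omega * omega * RtoC (- x))%C.
  + rewrite Cmult_assoc, Cinv_l by apply omega_sq_neq_0; ring.
  + rewrite omega_sq, RtoC_opp; ring.
- intros [x [Hx ->]]; exists (- x); split; [lra|].
  rewrite omega_sq, RtoC_opp; ring.
Qed.

Variable g : C -> C.
Hypothesis branch : sqrt_branch phi g.

Lemma root_off_ray (z : C) : ~ ray phi z ->
  exists u, 0 < Re u /\ z = (omega * omega * (u * u))%C.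
Proof.
intros Nz; destruct (branch z Nz) as [E _].
set (u := (g z / omega)%C).
assert (Eu : z = (omega * omega * (u * u))%C).
{ rewrite <- E; unfold u; field; apply omega_neq_0. }
destruct (Rtotal_order (Re u) 0) as [L|[Z|L]].
- exists (- u)%C; split; [rewrite re_opp; lra | rewrite Eu; ring].
- exfalso; apply Nz; rewrite Eu; apply ray_iff_omega.
  exists (- (Im u * Im u)); split; [nra|].
  unfold Re, Im in *; destruct u as [p q]; simpl in *; subst p.
  apply injective_projections; simpl; ring.
- now exists u.
Qed.

Variables a rho : R.
Hypothesis rho_pos : 0 < rho.
Hypothesis rho_lt : rho < a.
Notation v := (circ a rho).

Lemma sq_circ_off_ray t : ~ ray phi (omega * omega * (v t * v t))%C.
Proof.
rewrite ray_iff_omega; intros [x [Hx E]].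
pose proof (circ_sq_not_negative a rho rho_pos rho_lt t x E); lra.
Qed.

(** The branch is one of the two roots [omega v], [- omega v], and by continuity it is
    the same one along the whole contour. *)
Lemma branch_sign : exists sigma : C, (sigma * sigma = RtoC 1)%C /\
  forall t, g (omega * omega * (v t * v t))%C = (sigma * (omega * v t))%C.
Proof.
set (w := fun t => (omega * omega * (v t * v t))%C).
set (u := fun t => (omega * v t)%C).
assert (Gu : forall t, g (w t) = u t \/ g (w t) = (- u t)%C).
{ intros t; destruct (branch (w t) (sq_circ_off_ray t)) as [E _].
  assert (Z : ((g (w t) - u t) * (g (w t) + u t) = RtoC 0)%C).
  { replace ((g (w t) - u t) * (g (w t) + u t))%C with (g (w t) * g (w t) - u t * u t)%C by ring.
    rewrite E; unfold w, u; ring. }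
  destruct (classic (g (w t) - u t = RtoC 0)%C) as [Z1|Z1].
  - left; now apply Ceq_minus.
  - destruct (classic (g (w t) + u t = RtoC 0)%C) as [Z2|Z2].
    + right; apply Ceq_minus; rewrite <- Z2; ring.
    + now apply (Cmult_neq_0 _ _ Z1) in Z2. }
set (k := fun t => Re (g (w t)) * Re (u t) + Im (g (w t)) * Im (u t)).
assert (Pu : forall t, 0 < Re (u t) * Re (u t) + Im (u t) * Im (u t)).
{ intros t; rewrite <- Cmod_sq_components.
  apply pow_lt, Cmod_gt_0, Cmult_neq_0; [apply omega_neq_0|].
  intros Z; pose proof (circ_Re_pos a rho rho_pos rho_lt t) as P.
  rewrite Z, re_RtoC in P; lra. }
assert (Kplus : forall t, g (w t) = u t -> 0 < k t).
{ intros t E; unfold k; rewrite E; apply Pu. }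
assert (Kminus : forall t, g (w t) = (- u t)%C -> k t < 0).
{ intros t E; unfold k; rewrite E; pose proof (Pu t).
  change (- Re (u t) * Re (u t) + - Im (u t) * Im (u t) < 0); lra. }
assert (Cw : forall t, continuous (U := C_UniformSpace) w t).
{ intros t; apply (ex_derive_continuous (K := R_AbsRing) (V := C_R_NormedModule)).
  eexists; apply sq_circ_derive. }
assert (Cg : forall t, continuous (U := C_UniformSpace) (fun t => g (w t)) t).
{ intros t; destruct (branch (w t) (sq_circ_off_ray t)) as [_ D].
  pose proof (ex_derive_continuous (K := C_AbsRing) (V := C_NormedModule) _ _ D) as Cg.
  intros P HP; apply (Cw t (fun z => P (g z))).
  apply locally_C; exact (Cg P HP). }
assert (Cu : forall t, continuous (U := C_UniformSpace) u t).
{ intros t; apply (ex_derive_continuous (K := R_AbsRing) (V := C_R_NormedModule)).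
  eexists.
  apply (is_derive_C_pair (fun t => Re (u t)) (fun t => Im (u t)));
    unfold u, circ; simpl; auto_derive; auto. }
assert (Cre : forall (f : R -> C) t, continuous (U := C_UniformSpace) f t -> continuous (fun t => Re (f t)) t).
{ intros f t Cf; apply (continuous_comp f fst); [exact Cf | apply continuous_fst]. }
assert (Cim : forall (f : R -> C) t, continuous (U := C_UniformSpace) f t -> continuous (fun t => Im (f t)) t).
{ intros f t Cf; apply (continuous_comp f snd); [exact Cf | apply continuous_snd]. }
assert (Ck : Ranalysis1.continuity k).
{ intros t; apply continuity_pt_filterlim.
  apply (continuous_plus (V := R_NormedModule) (fun t => Re (g (w t)) * Re (u t))
           (fun t => Im (g (w t)) * Im (u t)));
    apply (continuous_mult (K := R_AbsRing)); auto. }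
assert (Same : forall t, k 0 * k t > 0).
{ intros t; apply Rnot_le_gt; intros L.
  destruct (IVT_gen k 0 t 0 Ck) as [x [_ Z]].
  - unfold Rmin, Rmax.
    destruct (Gu 0) as [E0|E0], (Gu t) as [Et|Et];
      first [pose proof (Kplus 0 E0) | pose proof (Kminus 0 E0)];
      first [pose proof (Kplus t Et) | pose proof (Kminus t Et)];
      destruct (Rle_dec (k 0) (k t)); split; nra.
  - destruct (Gu x) as [E|E]; [pose proof (Kplus x E) | pose proof (Kminus x E)]; lra. }
destruct (Gu 0) as [E0|E0].
- exists (RtoC 1); split; [ring|]; intros t.
  destruct (Gu t) as [E|E]; [fold (w t); rewrite E; unfold u; ring|].
  pose proof (Kplus 0 E0); pose proof (Kminus t E); pose proof (Same t); nra.
- exists (- RtoC 1)%C; split; [ring|]; intros t.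
  destruct (Gu t) as [E|E]; [|fold (w t); rewrite E; unfold u; ring].
  pose proof (Kminus 0 E0); pose proof (Kplus t E); pose proof (Same t); nra.
Qed.

End Branch.

Section RieszRoot.

Variable H : HilbertSpace.
Notation I := (op_id H).
Notation VO := (restr_NormedModule (bounded_op_NormedModule H)).

Lemma transp_linear (J : conjugation H) :
  is_linear (U := bounded_op_NormedModule H) (V := bounded_op_NormedModule H) (J_transp J).
Proof.
split.
- apply transp_plus.
- apply transp_scal.
- exists 1; split; [lra|]; intros X; rewrite Rmult_1_l; apply transp_norm.
Qed.

Lemma transp_inverse (J : conjugation H) X Y :
  is_inverse X Y -> is_inverse (J_transp J X) (J_transp J Y).
Proof.
intros [L R]; split; rewrite <- transp_mult; [rewrite R | rewrite L]; apply transp_id.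
Qed.

Lemma circ_integral a rho : 0 < rho -> rho < a ->
  is_RInt (V := VO) (fun t => dcirc rho t *: I)%op 0 1 (op_zero H).
Proof.
intros Hr Ha; evar_last.
- apply (is_RInt_derive (V := restr_Complete (bounded_op_Complete H)) (fun t => circ a rho t *: I)%op).
  + intros t _; apply is_derive_of_quadratic with (8 * PI ^ 2 * rho); intros t'.
    change (op_norm (circ a rho t' *: I - circ a rho t *: I - RtoC (t' - t) *: (dcirc rho t *: I))%op
      <= 8 * PI ^ 2 * rho * (t' - t) ^ 2).
    rewrite op_scal_assoc, <- !op_scalar_minus; apply le_norm_scalar; now apply circ_taylor.
  + intros t _; apply lip_continuous; now apply lip_dcirc.
- cbv beta; rewrite circ_closed; apply op_plus_opp_r.
Qed.

(** Put [B = c b] with [c = omega^2], so that the ray becomes the negative axis for [b], and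
    use the contour [z = c v^2] with [v] on the circle. Since [g(z) = sigma omega v], the
    Riesz integral is a multiple of the integral of [2 v^2 R dv = 2 (1 + b R) dv], hence
    of [b T], where [T] is the integral of [R dv], and [b T^2] is known. The values of the
    resolvent lie in the bicommutant and are J-self-adjoint when [B] is; both properties
    pass to the integral. *)
Lemma riesz_sqrt_exists (phi : R) (g : C -> C) (B : bounded_op H) :
  sqrt_branch phi g -> avoids_ray phi (spectrum B) ->
  exists S : bounded_op H, riesz_sqrt phi g B S /\ (S * S = B)%op /\ bicomm H B S /\
    forall J : conjugation H, J_self_adjoint J B -> J_self_adjoint J S.
Proof.
intros Hg HB.
set (om := omega phi); set (c := (om * om)%C).
assert (Nc : c <> RtoC 0) by apply omega_sq_neq_0.
assert (Nom : om <> RtoC 0) by apply omega_neq_0.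
set (Bh := ((/ c)%C *: B)%op).
assert (EB : B = (c *: Bh)%op).
{ unfold Bh; rewrite op_scal_assoc, Cinv_r, op_scal_one by assumption; reflexivity. }
assert (Shift : forall z : C, (z *: I - Bh = (/ c)%C *: ((c * z)%C *: I - B))%op).
{ intros z; rewrite op_scal_minus, op_scal_assoc, Cmult_assoc, Cinv_l, Cmult_1_l by assumption.
  reflexivity. }
assert (Ninv : forall z X, is_inverse ((c * z)%C *: I - B)%op X -> is_inverse (z *: I - Bh)%op (c *: X)%op).
{ intros z X E; rewrite Shift.
  assert (Nic : (/ c)%C <> RtoC 0).
  { intros Z; apply Nc; rewrite <- (Cmult_1_l c), <- (Cinv_r c Nc), Z; ring. }
  pose proof (is_inverse_scal H (/ c)%C _ X Nic E) as P.
  replace (/ / c)%C with c in P by (field; auto); exact P. }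
assert (Ninv' : forall z X, is_inverse (z *: I - Bh)%op X -> is_inverse ((c * z)%C *: I - B)%op ((/ c)%C *: X)%op).
{ intros z X E.
  replace ((c * z)%C *: I - B)%op with (c *: (z *: I - Bh))%op.
  - now apply is_inverse_scal.
  - rewrite Shift, op_scal_assoc, Cinv_r, op_scal_one by assumption; reflexivity. }
destruct (contour_choice H Bh) as (a & rho & M & Hr & Ha & H1 & Hres & Hseg & Hin).
{ intros x Hx.
  destruct (classic (spectrum B (c * RtoC x)%C)) as [Sp|Sp].
  - exfalso; apply (HB _ Sp); apply ray_iff_omega; now exists x.
  - apply NNPP in Sp; destruct Sp as [X EX]; exists (c *: X)%op; now apply Ninv. }
assert (Hres1 : forall t, exists R,
   is_inverse ((circ a rho t * circ a rho t)%C *: I - Bh)%op R /\ op_norm R <= M).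
{ intros t; destruct (Hres 1 t ltac:(lra)) as [R ER]; exists R.
  replace (segment H Bh 1) with Bh in ER; [exact ER|].
  unfold segment; rewrite Rminus_diag, op_scal_zero_l, op_scal_one.
  symmetry; rewrite op_plus_comm; apply op_plus_zero_r. }
destruct (contour_integral_inverse_root H a rho M Hr Ha H1 Bh Hres Hseg) as [T [IT ET]].
set (R := fun t => op_inv ((circ a rho t * circ a rho t)%C *: I - Bh)%op) in *.
assert (ER : forall t, is_inverse ((circ a rho t * circ a rho t)%C *: I - Bh)%op (R t)).
{ intros t; exact (resolvent_inv H a rho M Bh Hres1 t). }
change (is_RInt (V := VO) (fun t => dcirc rho t *: R t)%op 0 1 T) in IT.
destruct (branch_sign phi g Hg a rho Hr Ha) as [sg [Esg Hsg]]; fold om in Hsg; fold c in Hsg.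
set (S := ((RtoC 2 * sg * om / two_pi_i)%C *: (Bh * T))%op).
assert (N2 : RtoC 2 <> RtoC 0) by (intros E; apply RtoC_inj in E; lra).
assert (Npi : two_pi_i <> RtoC 0).
{ intros E; apply (f_equal Im) in E; unfold two_pi_i in E; simpl in E; pose proof PI_RGT_0; lra. }
assert (bBh : bicomm H B Bh) by (apply bicomm_scal, bicomm_self).
assert (bR : forall t, bicomm H B (R t)).
{ intros t; apply bicomm_inverse with (1 := ER t).
  apply bicomm_plus; [apply bicomm_scal, bicomm_id | now apply bicomm_opp]. }
assert (bT : bicomm H B T).
{ intros Y HY; apply (integral_commute H _ _ _ _ IT); intros t; now apply bR. }
exists S; split; [|split; [|split]].
- split; [exact HB|].
  exists (sq_arc a rho c :: nil)%list.
  assert (On : forall z, on_contour (sq_arc a rho c :: nil)%list z -> exists t, z = (c * (circ a rho t * circ a rho t))%C).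
  { intros z (al & t & [<-|[]] & _ & Ez); exists t; now symmetry. }
  split; [|split].
  + intros z Hz; destruct (On z Hz) as [t ->]; now apply sq_circ_off_ray.
  + split; [apply sq_arc_closed|].
    intros z Sz.
    destruct (root_off_ray phi g Hg z (HB z Sz)) as [u [Pu Ez]]; fold om in Ez; fold c in Ez.
    assert (Iu : Cmod (u - RtoC a) < rho).
    { apply Hin; [exact Pu|]; intros [X EX]; apply Sz; rewrite Ez.
      exists ((/ c)%C *: X)%op; exact (Ninv' _ _ EX). }
    split; [|rewrite Ez; now apply sq_arc_winding].
    intros Oz; destruct (On z Oz) as [t Et]; rewrite Ez in Et.
    (* [u^2 = v^2] forces [u = v], which is not inside the circle *)
    set (vt := circ a rho t) in *.
    assert (Z : ((vt - u) * (vt + u) = RtoC 0)%C).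
    { replace ((vt - u) * (vt + u))%C with (/ c * (c * (vt * vt) - c * (u * u)))%C by (now field).
      rewrite Et; ring. }
    destruct (classic (vt - u = RtoC 0)%C) as [Z1|Z1].
    * apply Ceq_minus in Z1; subst u; unfold vt in Iu; rewrite circ_mod in Iu; lra.
    * destruct (classic (vt + u = RtoC 0)%C) as [Z2|Z2].
      -- pose proof (circ_Re_pos a rho Hr Ha t) as Pv; fold vt in Pv.
         apply (f_equal Re) in Z2; rewrite re_plus, re_RtoC in Z2; lra.
      -- now apply (Cmult_neq_0 _ _ Z1) in Z2.
  + exists (two_pi_i *: S)%op, (op_zero H); split; [|split; [reflexivity | symmetry; apply op_plus_zero_r]].
    (* the integrand is [2 sigma omega v^2 R dv = 2 sigma omega (1 + Bh R) dv] *)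
    pose proof (is_RInt_linear _ _ _ _ _ _ _ (op_mult_linear_l H Bh) IT) as D1; cbv beta in D1.
    pose proof (is_RInt_plus (V := VO) _ _ _ _ _ _ (circ_integral a rho Hr Ha) D1) as D2.
    apply (is_RInt_linear _ _ _ _ _ _ _ (op_mult_linear_l H ((RtoC 2 * sg * om)%C *: I)%op)) in D2.
    cbv beta in D2.
    evar_last.
    * apply is_RInt_ext with (2 := D2); intros t _.
      set (vt := circ a rho t).
      change (((RtoC 2 * sg * om)%C *: I) * (dcirc rho t *: I + Bh * (dcirc rho t *: R t))
        = (c * (RtoC 2 * (vt * dcirc rho t)))%C *: (g (c * (vt * vt))%C *: resolvent B (c * (vt * vt))%C))%op.
      unfold vt; rewrite Hsg; fold vt.
      replace (resolvent B (c * (vt * vt))%C) with ((/ c)%C *: R t)%op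
        by (symmetry; apply op_inv_eq; apply Ninv', ER).
      rewrite op_scal_mult_r, <- op_scal_distr_l, op_scal_mult_l, op_mult_id_l, !op_scal_assoc.
      assert (E : (I + Bh * R t = (vt * vt)%C *: R t)%op).
      { destruct (ER t) as [E _]; fold vt in E.
        rewrite <- E, (op_scalar_left H _ (R t)); non_commutative_ring. }
      rewrite E, op_scal_assoc; f_equal; now field.
    * change (((RtoC 2 * sg * om)%C *: I) * (op_zero H + Bh * T) = two_pi_i *: S)%op.
      unfold S; rewrite op_scal_assoc, op_scal_mult_l, op_mult_id_l.
      f_equal; [now field|]; rewrite op_plus_comm; apply op_plus_zero_r.
- unfold S; rewrite op_scal_mult_l, op_scal_mult_r, op_scal_assoc.
  replace (Bh * T * (Bh * T))%op with (Bh * (Bh * (T * T)))%op.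
  + rewrite ET, op_scal_mult_r, op_mult_id_r, op_scal_assoc, EB; f_equal.
    transitivity (om * om * (sg * sg))%C; [now field|]; rewrite Esg; unfold c; ring.
  + rewrite <- !op_mult_assoc; f_equal.
    rewrite !op_mult_assoc; f_equal; now apply (bicomm_comm H B).
- now apply bicomm_scal, bicomm_mult.
- intros J JB; unfold J_self_adjoint in *.
  assert (JBh : J_transp J Bh = Bh) by (unfold Bh; now rewrite transp_scal, <- JB).
  assert (JT : J_transp J T = T).
  { apply (is_RInt_op_unique H) with (fun t => dcirc rho t *: R t)%op 0 1; [|exact IT].
    apply is_RInt_ext with (2 := is_RInt_linear _ _ _ _ _ _ _ (transp_linear J) IT); intros t _.
    rewrite transp_scal; f_equal.
    apply is_inverse_unique with (J_transp J ((circ a rho t * circ a rho t)%C *: I - Bh)%op).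
    - apply transp_inverse, ER.
    - replace (J_transp J ((circ a rho t * circ a rho t)%C *: I - Bh)%op)
        with ((circ a rho t * circ a rho t)%C *: I - Bh)%op; [apply ER|].
      rewrite op_scal_opp_one.
      rewrite (transp_plus _ J), !transp_scal, transp_id, JBh; reflexivity. }
  unfold S; rewrite transp_scal, transp_mult, JBh, JT; f_equal; now apply (bicomm_comm H B).
Qed.

End RieszRoot.

(** * Polar representations *)

Section Polar.

Variable H : HilbertSpace.
Variable J : conjugation H.
Notation I := (op_id H).
Notation tr := (J_transp J).
Implicit Types A B S U : bounded_op H.

Lemma invertible_transp A : invertible A -> invertible (tr A).
Proof. intros [X E]; exists (tr X); now apply transp_inverse. Qed.

Lemma J_unitary_of_right_inverse U : invertible U -> (U * tr U = I)%op -> J_unitary J U.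
Proof.
intros [V EV] E; split; [now exists V|].
rewrite (op_inv_eq _ _ _ EV); destruct EV as [_ EV].
now rewrite <- (op_mult_id_r _ V), <- E, op_mult_assoc, EV, op_mult_id_l.
Qed.

Lemma J_unitary_inverse U : J_unitary J U -> is_inverse U (tr U).
Proof. intros [N E]; rewrite <- E; now apply op_inv_spec. Qed.

(** Take [U = S^{-1} A]. As [S^T = S] and [S^2 = A A^T], one gets
    [U U^T = S^{-1} A A^T S^{-1} = 1]. If [U] and [S] commute, then
    [A^T A = U^T S^2 U = S^2 = A A^T]. Conversely, if [A] is J-normal then [A] commutes with
    [A A^T], hence with [S] in its bicommutant, hence so does [U]. *)
Lemma left_polar_exists A (phi : R) (g : C -> C) :
  invertible A -> avoids_ray phi (spectrum (A * tr A)%op) -> sqrt_branch phi g ->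
  left_polar J phi g A.
Proof.
intros IA HB Hg; set (B := (A * tr A)%op) in *.
assert (JB : J_self_adjoint J B).
{ unfold J_self_adjoint, B; now rewrite transp_mult, transp_transp. }
destruct (riesz_sqrt_exists H phi g B Hg HB) as (S & RS & SS & bS & JS).
specialize (JS J JB).
destruct IA as [Ai EA].
pose proof (is_inverse_mult _ _ _ _ _ EA (transp_inverse _ J _ _ EA)) as EB; fold B in EB.
set (Bi := (tr Ai * Ai)%op) in EB.
assert (bBi : bicomm H B Bi) by (apply bicomm_inverse with (1 := EB); apply bicomm_self).
set (Si := (S * Bi)%op).
assert (ES : is_inverse S Si).
{ assert (E1 : (S * Si = I)%op) by (unfold Si; rewrite op_mult_assoc, SS; apply EB).
  split; [exact E1|]; rewrite <- E1; apply (bicomm_comm H B); [|assumption].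
  now apply bicomm_mult. }
assert (JSi : tr Si = Si).
{ apply is_inverse_unique with S; [|exact ES].
  pose proof (transp_inverse _ J _ _ ES) as E; now rewrite <- JS in E. }
set (U := (Si * A)%op).
assert (ASU : A = (S * U)%op).
{ unfold U; rewrite op_mult_assoc; destruct ES as [-> _]; now rewrite op_mult_id_l. }
assert (JU : J_unitary J U).
{ apply J_unitary_of_right_inverse.
  - eexists; exact (is_inverse_mult _ _ _ _ _ (is_inverse_sym _ _ _ ES) EA).
  - unfold U; rewrite transp_mult, JSi.
    transitivity (Si * (A * tr A) * Si)%op; [now rewrite !op_mult_assoc|].
    fold B; rewrite <- SS, op_mult_assoc; destruct ES as [E1 E2].
    now rewrite E2, op_mult_id_l, E1. }
exists S, U; do 4 (split; [assumption|]).
destruct (J_unitary_inverse U JU) as [_ UU].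
unfold J_normal; fold B; split.
- intros C.
  assert (CB : (U * B = B * U)%op).
  { rewrite <- SS, op_mult_assoc, C, <- op_mult_assoc, C; apply op_mult_assoc. }
  rewrite ASU at 1 2; rewrite transp_mult, <- JS.
  transitivity (tr U * (S * S * U))%op; [now rewrite !op_mult_assoc|].
  now rewrite SS, <- CB, op_mult_assoc, UU, op_mult_id_l.
- intros N.
  assert (CA : (A * S = S * A)%op).
  { apply bS; transitivity (A * (tr A * A))%op.
    - now rewrite N.
    - unfold B; apply op_mult_assoc. }
  rewrite <- ASU; unfold U; rewrite <- op_mult_assoc, CA, op_mult_assoc.
  destruct ES as [_ ->]; apply op_mult_id_l.
Qed.

(** [A^T A = A^{-1} (A A^T) A]. *)
Lemma spectrum_swap A (phi : R) : invertible A ->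
  avoids_ray phi (spectrum (A * tr A)%op) -> avoids_ray phi (spectrum (tr A * A)%op).
Proof.
intros [Ai EA] HB z Hz; apply HB; intros [X EX]; apply Hz.
exists (Ai * X * A)%op.
replace (minus (op_scal z I) (tr A * A)%op) with (Ai * (z *: I - A * tr A) * A)%op.
- replace (Ai * X * A)%op with (Ai * (X * A))%op by (now rewrite op_mult_assoc).
  apply is_inverse_mult; [|exact EA].
  apply is_inverse_mult; [now apply is_inverse_sym | exact EX].
- destruct EA as [_ EA].
  transitivity (Ai * (z *: I) * A - (Ai * A) * tr A * A)%op; [non_commutative_ring|].
  now rewrite op_scal_mult_r, op_mult_id_r, op_scal_mult_l, EA, op_mult_id_l.
Qed.

(** The right representation of [A] is the transpose of the left one of its
    transpose. *)
Lemma right_polar_exists A (phi : R) (g : C -> C) :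
  invertible A -> avoids_ray phi (spectrum (A * tr A)%op) -> sqrt_branch phi g ->
  right_polar J phi g A.
Proof.
intros IA HB Hg.
destruct (left_polar_exists (tr A) phi g (invertible_transp A IA)) as (S & U & RS & JS & JU & E & N);
  [|exact Hg|].
{ rewrite transp_transp; now apply spectrum_swap. }
rewrite transp_transp in RS; unfold J_normal in N; rewrite transp_transp in N.
unfold J_self_adjoint in JS.
exists (tr U), S; split; [exact RS|]; split; [exact JS|]; split; [|split].
- pose proof (J_unitary_inverse U JU) as EU.
  apply J_unitary_of_right_inverse; [exists U; now apply is_inverse_sym|].
  rewrite transp_transp; apply EU.
- rewrite <- (transp_transp _ J A), E, transp_mult, <- JS; reflexivity.
- assert (Sw : (tr U * S = S * tr U <-> U * S = S * U)%op).
  { split; intros C; apply (f_equal tr) in C; rewrite !transp_mult, <- JS, ?transp_transp in C;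
      now symmetry. }
  rewrite Sw, N; unfold J_normal; split; intros C; now symmetry.
Qed.

(** [1 - t T] is a strict contraction for small [t > 0], and [t = c / m^2] is optimal in the
    estimate [|(1 - t T) x|^2 <= (1 - 2 t c + t^2 m^2) |x|^2]. *)
Lemma coercive_invertible (T : bounded_op H) (c : R) : 0 < c ->
  (forall x : H, c * norm x ^ 2 <= Re (ip (T x) x)) -> invertible T.
Proof.
intros Hc HT.
set (m := op_norm T + c).
assert (Hm : c <= m) by (pose proof (op_norm_ge_0 _ T); unfold m; lra).
set (t := c / m ^ 2).
assert (Ht : 0 < t) by (unfold t; apply Rdiv_lt_0_compat; [assumption | nra]).
assert (Htm : t * m ^ 2 = c) by (unfold t; field; lra).
set (q := sqrt (1 - t * c)).
assert (Hq0 : 0 <= 1 - t * c).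
{ assert (Hp : 0 < m ^ 2) by nra.
  assert (t * c <= 1); [|lra].
  apply Rmult_le_reg_r with (m ^ 2); [exact Hp|].
  replace (t * c * m ^ 2) with (c * c) by (rewrite <- Htm at 2; ring); nra. }
assert (Hq : q < 1).
{ pose proof (Rmult_lt_0_compat _ _ Ht Hc).
  apply Rlt_le_trans with (sqrt 1); [apply sqrt_lt_1; lra | rewrite sqrt_1; lra]. }
destruct (neumann H (I - RtoC t *: T)%op q) as [L [EL _]]; [|exact Hq|].
- apply op_norm_le; intros x Hx.
  change (norm (minus x (scal (RtoC t : C_AbsRing) (T x))) <= q).
  apply Rsqr_incr_0_var; [|apply sqrt_pos].
  unfold q; rewrite Rsqr_sqrt by assumption; rewrite Rsqr_pow2, norm_minus_sq.
  rewrite norm_scal_real_sq.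
  replace (Re (ip x (scal (RtoC t : C_AbsRing) (T x)))) with (t * Re (ip (T x) x)).
  + pose proof (HT x) as C1; pose proof (op_norm_bound T x) as C2.
    pose proof (norm_ge_0 x) as C3; pose proof (norm_ge_0 (T x)) as C4.
    assert (C5 : norm (T x) ^ 2 <= m ^ 2 * norm x ^ 2).
    { assert (norm (T x) <= m * norm x) by (unfold m; nra).
      replace (m ^ 2 * norm x ^ 2) with ((m * norm x) ^ 2) by ring.
      apply pow_incr; split; assumption. }
    assert (C6 : t ^ 2 * norm (T x) ^ 2 <= t * c * norm x ^ 2).
    { apply Rle_trans with (t ^ 2 * (m ^ 2 * norm x ^ 2)).
      - apply Rmult_le_compat_l; [apply pow2_ge_0 | assumption].
      - apply Req_le; rewrite <- Htm; ring. }
    assert (C7 : norm x ^ 2 <= 1) by (simpl; nra).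
    assert (C8 : t * (c * norm x ^ 2) <= t * Re (ip (T x) x)) by (apply Rmult_le_compat_l; lra).
    nra.
  + rewrite ip_scal_r.
    replace (Cconj (RtoC t)) with (RtoC t) by (apply injective_projections; simpl; ring).
    rewrite re_scal_l; f_equal; apply Re_ip_sym.
- assert (Nt : RtoC t <> RtoC 0) by (intros E; apply RtoC_inj in E; lra).
  exists (RtoC t *: L)%op.
  replace (I - (I - RtoC t *: T))%op with (RtoC t *: T)%op in EL by non_commutative_ring.
  destruct EL as [E1 E2]; split.
  + now rewrite op_scal_mult_r, <- op_scal_mult_l.
  + now rewrite op_scal_mult_l, <- op_scal_mult_r.
Qed.

Lemma perturbed_identity_coercive (K : bounded_op H) (k : R) : op_norm K <= k ->
  forall x : H, (1 - k) * norm x ^ 2 <= Re (ip ((I + K)%op x) x).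
Proof.
intros Hk x.
change ((I + K)%op x) with (plus x (K x)).
rewrite ip_plus_l, re_plus, ip_norm, re_RtoC.
pose proof (Re_ip_le _ (K x) (scal (RtoC (-1) : C_AbsRing) x)) as P.
rewrite ip_scal_r in P.
replace (Cconj (RtoC (-1))) with (RtoC (-1)) in P by (apply injective_projections; simpl; ring).
rewrite re_scal_l in P.
pose proof (hs_norm_scal (RtoC (-1)) x) as Q; rewrite Cmod_R, Rabs_left in Q by lra.
pose proof (op_norm_bound K x); pose proof (norm_ge_0 x); pose proof (norm_ge_0 (K x)).
assert (norm (K x) * norm (scal (RtoC (-1) : C_AbsRing) x) <= k * norm x * norm x).
{ apply Rmult_le_compat; try apply norm_ge_0; nra. }
simpl; lra.
Qed.

(** For [A = 1 + K] with [|K| < 1] and [x >= 0], factor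
    [A A^T + x = (A + x (A^T)^{-1}) A^T]; the first factor is coercive because the
    numerical range of the inverse of a coercive operator stays in the right
    half-plane. *)
Lemma perturbed_identity_negative_axis (K : bounded_op H) : op_norm K < 1 ->
  let A := (I + K)%op in
  invertible A /\ avoids_ray PI (spectrum (A * tr A)%op).
Proof.
intros HK A.
pose proof (perturbed_identity_coercive K (op_norm K) (Rle_refl _)) as CA; fold A in CA.
assert (EtA : tr A = (I + tr K)%op) by (unfold A; rewrite transp_plus, transp_id; reflexivity).
pose proof (perturbed_identity_coercive (tr K) (op_norm K) (transp_norm _ J K)) as CtA.
rewrite <- EtA in CtA.
assert (IA : invertible A) by (apply coercive_invertible with (1 - op_norm K); [lra | exact CA]).
split; [exact IA|].
destruct (invertible_transp A IA) as [V EV].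
intros z Hz [x [Hx Ez]]; apply Hz.
rewrite cos_PI, sin_PI in Ez.
destruct (coercive_invertible (A + RtoC x *: V)%op (1 - op_norm K)) as [W EW]; [lra| |].
- intros y.
  change ((A + RtoC x *: V)%op y) with (plus (A y) (scal (RtoC x : C_AbsRing) (V y))).
  rewrite ip_plus_l, re_plus, ip_scal_l, re_scal_l.
  assert (0 <= Re (ip (V y) y)).
  { pose proof (CtA (V y)) as P.
    replace (tr A (V y)) with y in P.
    - rewrite Re_ip_sym in P; apply Rle_trans with (2 := P).
      apply Rmult_le_pos; [lra | apply pow2_ge_0].
    - destruct EV as [EV _]; symmetry; exact (f_equal (fun X : bounded_op H => X y) EV). }
  pose proof (CA y); nra.
- exists (op_scal (/ (- RtoC 1))%C (V * W)%op).
  replace (minus (op_scal z I) (A * tr A)%op) with ((- RtoC 1)%C *: ((A + RtoC x *: V) * tr A))%op.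
  + apply is_inverse_scal; [|apply is_inverse_mult; [exact EW | exact EV]].
    rewrite <- RtoC_opp; intros E; apply RtoC_inj in E; lra.
  + replace z with ((- RtoC 1) * RtoC x)%C by (rewrite Ez; apply injective_projections; simpl; ring).
    change (minus (op_scal ((- RtoC 1) * RtoC x)%C I) (A * tr A)%op)
      with (((- RtoC 1) * RtoC x)%C *: I - A * tr A)%op.
    rewrite <- op_scal_assoc, <- !op_scal_opp_one, op_mult_plus_l, op_scal_mult_l.
    destruct EV as [_ ->]; non_commutative_ring.
Qed.

End Polar.

Theorem theorem2p3 (H : HilbertSpace) (Hsep : separable H) (J : conjugation H) :
  (forall (A : bounded_op H) (phi : R),
     0 <= phi < 2 * PI ->
     ~ spectrum A (RtoC 0) ->
     avoids_ray phi (spectrum (op_mult A (J_transp J A))) ->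
     forall g : C -> C, sqrt_branch phi g ->
       left_polar J phi g A /\ right_polar J phi g A)
  /\
  (forall K : bounded_op H,
     compact_op K -> norm K < 1 ->
     let A := op_plus (op_id H) K in
     exists phi : R,
       0 <= phi < 2 * PI /\
       avoids_ray phi (spectrum (op_mult A (J_transp J A))) /\
       forall g : C -> C, sqrt_branch phi g ->
         left_polar J phi g A /\ right_polar J phi g A).
Proof.
assert (Polar : forall (A : bounded_op H) (phi : R), invertible A ->
     avoids_ray phi (spectrum (op_mult A (J_transp J A))) ->
     forall g : C -> C, sqrt_branch phi g ->
       left_polar J phi g A /\ right_polar J phi g A).
{ intros A phi IA HA g Hg; split; [now apply left_polar_exists | now apply right_polar_exists]. }
split.
- intros A phi _ HA; apply Polar.
  apply NNPP in HA; destruct HA as [X EX]; exists ((- RtoC 1)%C *: X)%op.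
  replace (minus (op_scal (RtoC 0) (op_id H)) A) with ((- RtoC 1)%C *: A)%op in EX.
  + destruct EX as [E1 E2]; split.
    * now rewrite op_scal_mult_r, <- op_scal_mult_l.
    * now rewrite op_scal_mult_l, <- op_scal_mult_r.
  + change ((- RtoC 1)%C *: A = RtoC 0 *: op_id H - A)%op.
    rewrite op_scal_zero_l, <- op_scal_opp_one; non_commutative_ring.
- intros K _ HK A.
  destruct (perturbed_identity_negative_axis H J K HK) as [IA HA].
  exists PI; pose proof PI_RGT_0; split; [lra|]; split; [exact HA|].
  exact (Polar A PI IA HA).
Qed.
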